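(* Let $\tau>2$ and $\sigma\in(0,\tau-1)$, and let $\mu_{\sigma,\tau}$ be the limiting spectral distribution of the scaled adjacency matrices of the kernel-based random graph. Then $\mu_{\sigma,\tau}$ is symmetric and absolutely continuous with respect to the Lebesgue measure on $\mathbb{R}$.
   Context: Notation: $a\wedge b=\min(a,b)$, $a\vee b=\max(a,b)$. Let $d\ge1$ and $0<\alpha<d$. The vertex set $\mathbf{V}_N=\{1,\dots,N\}^d$ carries the torus distance $\|i-j\|=\sum_{\ell=1}^d |i_\ell-j_\ell|\wedge(N-|i_\ell-j_\ell|)$. The weights $(W_i)_{i\in\mathbf{V}_N}$ are i.i.d. Pareto with $\mathbf{P}(W>t)=t^{-(\tau-1)}$ for $t\ge 1$ and $\mathbf{P}(W>t)=1$ for $t<1$. The kernel is $\kappa_\sigma(w,v)=(w\vee v)(w\wedge v)^\sigma$. Conditionally on the weights, distinct vertices $i,j$ are joined by an undirected edge, independently over pairs, with probability $\frac{\kappa_\sigma(W_i,W_j)}{\|i-j\|^\alpha}\wedge 1$; no self-loops. $\mathbb{P}$ is the joint law of weights and edges. With $\mathbb{A}_{\mathbb{G}_N}$ the adjacency matrix, let $c_N=\frac{1}{N^d}\sum_{i\ne j\in\mathbf{V}_N}\|i-j\|^{-\alpha}$ and $\mathbf{A}_N=\mathbb{A}_{\mathbb{G}_N}/\sqrt{c_N}$. For $\tau>2$, $0<\alpha<d$, $\sigma\in(0,\tau-1)$, the empirical spectral distribution $\mathrm{ESD}(\mathbf{A}_N)=\frac{1}{N^d}\sum_i\delta_{\lambda_i(\mathbf{A}_N)}$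 converges weakly in $\mathbb{P}$-probability (i.e. in Lévy–Prokhorov distance, in probability) to a deterministic probability measure denoted $\mu_{\sigma,\tau}$ (which does not depend on $\alpha$ or $d$), called the limiting spectral distribution. *)

(* Defs.v *)
From HB Require Import structures.
From mathcomp Require Import all_boot all_order all_algebra.
From mathcomp Require Import spectral sesquilinear complex.
From mathcomp Require Import all_classical all_reals all_analysis.

Set Implicit Arguments.
Unset Strict Implicit.
Unset Printing Implicit Defensive.

Import Order.TTheory GRing.Theory Num.Theory.
Import numFieldNormedType.Exports.

Local Open Scope classical_set_scope.
Local Open Scope ring_scope.

Lemma char_poly_conj (F : comUnitRingType) (n : nat) (Q D : 'M[F]_n) :
  Q \in unitmx -> char_poly (invmx Q *m D *m Q) = char_poly D.
Proof.
move=> uQ; rewrite /char_poly /char_poly_mx.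
have -> : 'X%:M - map_mx polyC (invmx Q *m D *m Q) =
    map_mx polyC (invmx Q) *m ('X%:M - map_mx polyC D) *m map_mx polyC Q.
  rewrite mulmxBr mulmxBl !map_mxM; congr (_ - _).
  by rewrite scalar_mxC -mulmxA -map_mxM mulVmx// map_mx1 mulmx1.
rewrite !det_mulmx !det_map_mx mulrC mulrA -rmorphM/= -det_mulmx mulmxV//.
by rewrite det1 mul1r.
Qed.

Section spectral_distribution.
Variable R : realType.

Lemma char_poly_symmetric_split (n : nat) (A : 'M[R]_n) : A^T = A ->
  exists s : n.-tuple R, char_poly A = \prod_(x <- s) ('X - x%:P).
Proof.
move=> symA; pose f : {rmorphism R -> R[i]} := real_complex R.
pose C := map_mx f A.
have hC : C \is hermsymmx.
  apply/is_hermitianmxP; rewrite expr0 scale1r; apply/matrixP => i j.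
  rewrite !mxE -[in LHS]symA mxE; symmetry; apply/CrealP.
  by apply/complex_realP; exists (A j i).
have /orthomx_spectralP CE := hermitian_normalmx hC.
have /mxOverP dR := hermitian_spectral_diag_real hC.
exists [tuple complex.Re (spectral_diag C 0 i) | i < n].
apply: (map_poly_inj f); rewrite map_char_poly -/C {1}CE.
rewrite char_poly_conj ?spectral_unit// char_poly_trig ?diag_mx_is_trig//.
rewrite rmorph_prod/= big_map enumT/=.
rewrite -(big_enum _ _ predT)/= enumT.
apply: eq_bigr => i _; rewrite rmorphB/= map_polyX map_polyC/= mxE eqxx mulr1n.
by rewrite RRe_real// dR.
Qed.

(* The eigenvalues of A with multiplicity, in some order. The default value is
   only reached when the characteristic polynomial does not split over R, which
   eigenvaluesP excludes for symmetric matrices. *)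
Definition eigenvalues (n : nat) (A : 'M[R]_n) : n.-tuple R :=
  xget (nseq_tuple n 0)
    [set s : n.-tuple R | char_poly A = \prod_(x <- s) ('X - x%:P)].

Lemma eigenvaluesP (n : nat) (A : 'M[R]_n) :
  A^T = A -> char_poly A = \prod_(x <- eigenvalues A) ('X - x%:P).
Proof.
case/char_poly_symmetric_split => s sE.
by rewrite /eigenvalues; case: xgetP => // /(_ s)/(_ sE).
Qed.

Definition esd (n : nat) (A : 'M[R]_n) (B : set R) : \bar R :=
  ((n%:R^-1)%:E * \sum_(i < n) \d_(tnth (eigenvalues A) i) B)%E.

Definition thickening (eps : R) (A : set R) : set R :=
  [set x | exists2 a, A a & `|x - a| < eps].

Definition levy_prokhorov (mu nu : set R -> \bar R) : R :=
  inf [set eps : R | 0 < eps /\ forall A : set R, measurable A ->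
    (mu A <= nu (thickening eps A) + eps%:E)%E /\
    (nu A <= mu (thickening eps A) + eps%:E)%E].

Definition symmetric_law (mu : set R -> \bar R) : Prop :=
  forall A : set R, measurable A -> mu (-%R @^-1` A) = mu A.

End spectral_distribution.

(* Sites are numbered from 0 instead of 1; only differences of coordinates are
   ever used. *)
Definition vertex (d N : nat) : finType := {ffun 'I_d -> 'I_N}.

Definition torus_dist (d N : nat) (i j : vertex d N) : nat :=
  (\sum_(l < d) minn `|i l - j l| (N - `|i l - j l|))%N.

Section kernel_based_random_graph.
Variable R : realType.

Definition kappa (sigma w v : R) : R := Num.max w v * Num.min w v `^ sigma.

Definition connection_prob (d N : nat) (alpha sigma : R)
    (W : vertex d N -> R) (i j : vertex d N) : R :=
  Num.min (kappa sigma (W i) (W j) / (torus_dist i j)%:R `^ alpha) 1.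

Definition mutually_independent (I : finType) (disp : measure_display)
    (Omega : measurableType disp) (P : probability Omega R)
    (X : I -> {RV P >-> R}) : Prop :=
  forall (J : {set I}) (A : I -> set R), (forall i, measurable (A i)) ->
    P (\bigcap_(i in [set` J]) X i @^-1` A i) =
    (\prod_(i in J) P (X i @^-1` A i))%E.

Definition sigma_algebra_of (I : finType) (disp : measure_display)
    (Omega : measurableType disp) (P : probability Omega R)
    (X : I -> {RV P >-> R}) : set (set Omega) :=
  <<s \bigcup_i g_sigma_algebra_preimage (X i) >>.

(* kbrg_edge_law is the conditional law of the edges given the weights: for any
   configuration e of the unordered pairs (represented by their increasing
   representatives), the product below is a version of the conditional
   probability of {edges = e} with respect to the sigma-algebra of the
   weights; as a function of the weights it is measurable for it. *)
Record kbrg (d N : nat) (alpha tau sigma : R) (disp : measure_display)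
    (Omega : measurableType disp) (P : probability Omega R) := Kbrg {
  weight : vertex d N -> {RV P >-> R} ;
  edge : vertex d N -> vertex d N -> {RV P >-> bool} ;
  kbrg_weight_pareto : forall (i : vertex d N) (t : R),
    ccdf (weight i) t = (if 1 <= t then t `^ (- (tau - 1)) else 1)%:E ;
  kbrg_weight_indep : mutually_independent weight ;
  kbrg_edge_irr : forall i w, edge i i w = false ;
  kbrg_edge_sym : forall i j w, edge i j w = edge j i w ;
  kbrg_edge_law : forall (e : rel (vertex d N)) (S : set Omega),
    sigma_algebra_of weight S ->
    P (S `&` [set w | forall i j : vertex d N,
         (enum_rank i < enum_rank j)%N -> edge i j w = e i j]) =
    (\int[P]_(w in S)
      (\prod_(p : vertex d N * vertex d N
               | (enum_rank p.1 < enum_rank p.2)%N)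
         let q := connection_prob alpha sigma (weight ^~ w) p.1 p.2 in
         if e p.1 p.2 then q else 1 - q)%:E)%E
}.

Definition scaling (d N : nat) (alpha : R) : R :=
  ((N ^ d)%:R)^-1 *
  \sum_(i : vertex d N) \sum_(j : vertex d N | j != i)
    (torus_dist i j)%:R `^ (- alpha).

Section scaled_adjacency.
Variables (d N : nat) (alpha tau sigma : R) (disp : measure_display).
Variables (Omega : measurableType disp) (P : probability Omega R).

Definition adjacency (G : kbrg d N alpha tau sigma P) (w : Omega) :
    'M[R]_#|vertex d N| :=
  \matrix_(a, b) (edge G (enum_val a) (enum_val b) w)%:R.

Definition scaled_adjacency (G : kbrg d N alpha tau sigma P) (w : Omega) :
    'M[R]_#|vertex d N| :=
  (Num.sqrt (scaling d N alpha))^-1 *: adjacency G w.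

Lemma scaled_adjacency_sym (G : kbrg d N alpha tau sigma P) (w : Omega) :
  (scaled_adjacency G w)^T = scaled_adjacency G w.
Proof. by apply/matrixP => a b; rewrite !mxE kbrg_edge_sym. Qed.

End scaled_adjacency.

(* The graphs of different sizes may live on different probability spaces:
   convergence in probability to a deterministic limit only depends on the law
   of each of them. *)
Definition limiting_spectral_distribution (d : nat) (alpha tau sigma : R)
    (disp : nat -> measure_display)
    (Omega : forall N, measurableType (disp N))
    (P : forall N, probability (Omega N) R)
    (G : forall N, kbrg d N alpha tau sigma (P N))
    (mu : probability R R) : Prop :=
  forall eps : R, 0 < eps ->
    P N [set w | eps < levy_prokhorov (esd (scaled_adjacency (G N) w)) mu]
      @[N --> \oo] --> 0%E.

End kernel_based_random_graph.

(* Main.v *)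
(* Write H for the scaled adjacency matrix, n for its size, z = x + i eta and
   G = (H - z)^-1. Weak convergence of the empirical spectral distributions
   identifies the Poisson transform int eta / ((y - x)^2 + eta^2) mu(dy) as the
   limit of E X, where X = n^-1 Im tr G, so it suffices to show that this limit
   is bounded uniformly in x and eta, which gives absolute continuity, and that
   it is even in x, which gives symmetry.
   Given the weights, the edges are independent Bernoulli variables. Replacing H
   by H - E H costs at most a small constant plus a multiple of
   n^-1 sum_ij p_ij^2 / c_N; on average over the weights this is negligible since
   E p_ij^s <= K r_ij^(-alpha s) for some s > 1.
   For the centered matrix, the diagonal of (H - z) G = 1 and integration by parts
   in each entry give n^-1 sum_ij Var(H_ij) E |G_ii|^2 Im G_jj <= E X + o(1).
   Weights being at least 1, n Var(H_ij) is essentially bounded below by a constant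
   c > 0, so that c (E X)^3 <= c E X^3 <= E X + o(1) and E X stays bounded.
   Evenness follows from the Lindeberg replacement of H_ij by - H_ij: both have
   the same first two moments, and the spectrum of - H is the opposite of that of
   H. *)

Require Import Defs.
From mathcomp Require Import all_boot all_order all_algebra.
From mathcomp Require Import spectral complex.
From mathcomp Require Import all_classical all_reals all_analysis.
From mathcomp Require Import measurable_realfun.
From mathcomp Require Import ring lra.

Set Implicit Arguments.
Unset Strict Implicit.
Unset Printing Implicit Defensive.

Import Order.TTheory GRing.Theory Num.Theory.
Import numFieldNormedType.Exports.

Local Open Scope classical_set_scope.
Local Open Scope ring_scope.

(** * Resolvents of symmetric matrices *)

(** The limit in N is taken at fixed eta and fixed AM-GM parameter [del], so error terms may grow
    polynomially in 1 / eta; only the main term 1 + 2 / c must be free of x and eta, and the cube on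
    the left of the self-consistent inequality provides this. The obstacle is that connection
    probabilities need not be small: between close or heavy vertices p may be near or equal to 1, so
    the variance p (1 - p) has no useful lower bound there, and for tau <= 3 the weights have
    infinite second moment. Both the centering and the passage from p (1 - p) to p are therefore
    charged to p ^ 2 <= p ^ s, where 1 < s <= 2 is small enough for the Pareto moments of order s
    and sigma s to be finite; the gain is that [scaling] at alpha s is negligible compared with
    [scaling] at alpha. Given the weights, edge expectations are finite sums over configurations,
    and only the average over the weights is an integral. No formula for mu enters: the estimates
    reach it through the convergence hypothesis alone. *)

Section inverse_matrices.
Variables (F : comUnitRingType) (n : nat).
Implicit Types A B Q : 'M[F]_n.

Lemma mulmx1_invmx A B : A *m B = 1%:M -> invmx A = B.
Proof.
move=> AB; have [uA _] := mulmx1_unit AB.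
by rewrite -[LHS]mulmx1 -AB mulmxA mulVmx// mul1mx.
Qed.

Lemma mulmx_conj Q A B : Q \in unitmx ->
  (invmx Q *m A *m Q) *m (invmx Q *m B *m Q) = invmx Q *m (A *m B) *m Q.
Proof.
move=> uQ; rewrite !mulmxA; congr (_ *m B *m Q).
by rewrite -[X in X = _]mulmxA mulmxV// mulmx1.
Qed.

Lemma mxtrace_conj Q A : Q \in unitmx -> \tr (invmx Q *m A *m Q) = \tr A.
Proof. by move=> uQ; rewrite mxtrace_mulC mulmxA mulmxV// mul1mx. Qed.

Lemma conj_subr_scalar Q A z : Q \in unitmx ->
  invmx Q *m A *m Q - z%:M = invmx Q *m (A - z%:M) *m Q.
Proof.
move=> uQ; rewrite mulmxBr mulmxBl; congr (_ - _).
by rewrite scalar_mxC -mulmxA mulVmx// mulmx1.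
Qed.

End inverse_matrices.

Lemma char_poly_conj_diag (F : comUnitRingType) (n : nat) (Q : 'M[F]_n)
    (s : 'rV[F]_n) : Q \in unitmx ->
  char_poly (invmx Q *m diag_mx s *m Q) = \prod_i ('X - (s 0 i)%:P).
Proof.
move=> uQ; rewrite char_poly_conj// char_poly_trig ?diag_mx_is_trig//.
by apply: eq_bigr => i _; rewrite mxE eqxx mulr1n.
Qed.

Lemma mxtrace_inv_conj_diag (F : fieldType) (n : nat) (Q : 'M[F]_n)
    (s : 'rV[F]_n) (z : F) : Q \in unitmx -> (forall i, s 0 i - z != 0) ->
  \tr (invmx (invmx Q *m diag_mx s *m Q - z%:M)) = \sum_i (s 0 i - z)^-1.
Proof.
move=> uQ dnz; pose D : 'M[F]_n := diag_mx (\row_i (s 0 i - z)^-1).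
have DE : (diag_mx s - z%:M) *m D = 1%:M.
  rewrite /D; apply/matrixP => i j; rewrite mul_mx_diag !mxE.
  case: (eqVneq i j) => [->|_]; rewrite ?mulr1n ?mulr0n ?subr0 ?mul0r//.
  by rewrite mulfV.
rewrite conj_subr_scalar// (@mulmx1_invmx _ _ _ (invmx Q *m D *m Q)).
  rewrite mxtrace_conj// /D mxtrace_diag.
  by apply: eq_bigr => i _; rewrite mxE.
by rewrite mulmx_conj// DE mulmx1 mulVmx.
Qed.

Section modulus.
Variable R : realType.
Implicit Types x y : R[i].

(** The norm of [R[i]] takes values in [R[i]] itself; its real part lets all estimates live in the
    ordered field R. *)
Definition cabs x : R := complex.Re `|x|.

Lemma cabsE x : (cabs x)%:C%C = `|x|.
Proof. by rewrite /cabs; case: x => a b; rewrite normc_def. Qed.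

Lemma cabs_ge0 x : 0 <= cabs x.
Proof. by rewrite -lecR cabsE normr_ge0. Qed.

Lemma cabs0 : cabs 0 = 0.
Proof. by apply: complexI; rewrite cabsE normr0. Qed.

Lemma cabsM x y : cabs (x * y) = cabs x * cabs y.
Proof. by apply: complexI; rewrite rmorphM/= !cabsE normrM. Qed.

Lemma cabsN x : cabs (- x) = cabs x.
Proof. by apply: complexI; rewrite !cabsE normrN. Qed.

Lemma cabsJ x : cabs (conjc x) = cabs x.
Proof. by apply: complexI; rewrite !cabsE normcJ. Qed.

Lemma cabsR (r : R) : cabs r%:C%C = `|r|.
Proof. by rewrite /cabs normc_def/= expr0n addr0 sqrtr_sqr. Qed.

Lemma cabsD x y : cabs (x + y) <= cabs x + cabs y.
Proof. by rewrite -lecR rmorphD/= !cabsE ler_normD. Qed.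

Lemma cabs_sum (I : Type) (r : seq I) (P : pred I) (F : I -> R[i]) :
  cabs (\sum_(i <- r | P i) F i) <= \sum_(i <- r | P i) cabs (F i).
Proof.
elim/big_ind2: _ => //; first by rewrite cabs0.
move=> x a y b xa yb; apply: (le_trans (cabsD _ _)); exact: lerD.
Qed.

Lemma sqr_cabs x : cabs x ^+ 2 = complex.Re x ^+ 2 + complex.Im x ^+ 2.
Proof.
by rewrite /cabs normc_def/= sqr_sqrtr// addr_ge0// sqr_ge0.
Qed.

Lemma conjc_mul_cabs x : conjc x * x = (cabs x ^+ 2)%:C%C.
Proof. by rewrite rmorphXn/= cabsE sqr_normc mulrC. Qed.

Lemma Im_cabs x : `|complex.Im x| <= cabs x.
Proof.
rewrite -[leRHS]ger0_norm ?cabs_ge0// -ler_sqr ?nnegrE//.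
by rewrite -!normrX ger0_norm ?sqr_ge0// ger0_norm ?sqr_ge0// sqr_cabs lerDr sqr_ge0.
Qed.

Lemma Im_sum (I : Type) (r : seq I) (P : pred I) (F : I -> R[i]) :
  complex.Im (\sum_(i <- r | P i) F i) = \sum_(i <- r | P i) complex.Im (F i).
Proof. by apply: (big_morph (@complex.Im R)) => // -[a b] [c e]. Qed.

Lemma ImD x y : complex.Im (x + y) = complex.Im x + complex.Im y.
Proof. by case: x y => [a b] [c e]. Qed.

Lemma ImN x : complex.Im (- x) = - complex.Im x.
Proof. by case: x. Qed.

Lemma ImB x y : complex.Im (x - y) = complex.Im x - complex.Im y.
Proof. by rewrite ImD ImN. Qed.

Lemma ImMR (r : R) y : complex.Im (r%:C%C * y) = r * complex.Im y.
Proof. by case: y => a b /=; rewrite mul0r addr0. Qed.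

Lemma ImJ x : complex.Im (conjc x) = - complex.Im x.
Proof. by case: x. Qed.

End modulus.

Section resolvent.
Variables (R : realType) (n : nat).
Implicit Types (H A B : 'M[R]_n) (x eta : R).

Local Notation toC := (map_mx (real_complex R)).

Definition resolvent (z : R[i]) H : 'M[R[i]]_n := invmx (toC H - z%:M).

(** If the matrix were singular, z would be a root of the characteristic polynomial, which splits
    over the reals by [eigenvaluesP]. *)
Lemma resolvent_unit H x eta : H^T = H -> 0 < eta ->
  toC H - (x +i* eta)%C%:M \in unitmx.
Proof.
move=> symH eta0; apply: contraT => nu.
have : eigenvalue (toC H) (x +i* eta)%C.
  rewrite /eigenvalue kermx_eq0; apply: contra nu.
  by rewrite row_free_unit.
rewrite eigenvalue_root_char -map_char_poly (eigenvaluesP symH) rmorph_prod/=.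
rewrite /root horner_prod prodf_seq_eq0 => /hasP[l _ /=].
rewrite map_polyXsubC hornerXsubC subr_eq0 => /eqP[_ e0].
by rewrite e0 ltxx in eta0.
Qed.

Section fixed.
Variables (x eta : R).
Hypothesis eta0 : 0 < eta.
Let z := (x +i* eta)%C.
Local Notation G := (resolvent z).

Lemma mulVres H : H^T = H -> (toC H - z%:M) *m G H = 1%:M.
Proof. by move=> sH; rewrite mulmxV// resolvent_unit. Qed.

Lemma mulresV H : H^T = H -> G H *m (toC H - z%:M) = 1%:M.
Proof. by move=> sH; rewrite mulVmx// resolvent_unit. Qed.

Lemma resolvent_tr H : H^T = H -> (G H)^T = G H.
Proof.
move=> sH; rewrite /resolvent trmx_inv linearB/= tr_scalar_mx.
suff -> : (toC H)^T = toC H by [].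
by apply/matrixP => i j; rewrite !mxE -[in LHS]sH mxE.
Qed.

Lemma resolvent_sym H a b : H^T = H -> G H a b = G H b a.
Proof. by move=> sH; rewrite -[in LHS](resolvent_tr sH) mxE. Qed.

Lemma resolvent_sub A B : A^T = A -> B^T = B ->
  G A - G B = G A *m toC (B - A) *m G B.
Proof.
move=> sA sB.
have -> : toC (B - A) = (toC B - z%:M) - (toC A - z%:M).
  by rewrite map_mxB opprB addrA subrK.
by rewrite mulmxBr mulmxBl mulresV// mul1mx -mulmxA mulVres// mulmx1.
Qed.

Lemma quadratic_form_real H (y : 'cV[R[i]]_n) : H^T = H ->
  complex.Im (\sum_a conjc (y a 0) * (toC H *m y) a 0) = 0.
Proof.
move=> sH; set q := \sum_a _.
have : conjc q = q.
  rewrite /q rmorph_sum/=.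
  under eq_bigr => a _ do rewrite rmorphM/= conjcK mxE rmorph_sum/= mulr_sumr.
  rewrite exchange_big/=; apply: eq_bigr => a _.
  rewrite mxE mulr_sumr; apply: eq_bigr => b _.
  rewrite rmorphM/= !mxE -[in LHS]sH mxE /=.
  have -> : (H a b -i* 0)%C = (H a b)%:C%C by rewrite oppr0.
  ring.
case: q => u v /= [] /eqP; rewrite eq_sym -subr_eq0 opprK -mulr2n mulrn_eq0/=.
by move/eqP.
Qed.

(** With y = G v one has v = H y - z y, and y* H y is real. Both the contraction bound and the Ward
    identity are read off from this formula. *)
Lemma resolvent_form H (v : 'cV[R[i]]_n) : H^T = H ->
  complex.Im (\sum_a conjc ((G H *m v) a 0) * v a 0) =
  - eta * \sum_a cabs ((G H *m v) a 0) ^+ 2.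
Proof.
move=> sH; set y := G H *m v.
have -> : v = toC H *m y - z *: y.
  by rewrite -mul_scalar_mx -mulmxBl mulmxA mulVres// mul1mx.
under eq_bigr => a _.
  rewrite [X in _ * X]mxE mulrDr.
  have -> : (- (z *: y)) a 0 = - (z * y a 0) by rewrite !mxE.
  rewrite mulrN mulrCA conjc_mul_cabs.
  over.
rewrite big_split/= ImD quadratic_form_real// add0r sumrN ImN Im_sum mulNr mulr_sumr.
by congr (- _); apply: eq_bigr => a _; rewrite mulrC ImMR /= mulrC.
Qed.

Lemma resolvent_contract H (v : 'cV[R[i]]_n) : H^T = H ->
  \sum_a cabs ((G H *m v) a 0) ^+ 2 <= eta ^- 2 * \sum_a cabs (v a 0) ^+ 2.
Proof.
move=> sH; have := resolvent_form v sH.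
set Y := \sum_a cabs _ ^+ 2; set V := \sum_a cabs _ ^+ 2.
set s := \sum_a conjc _ * _ => e.
(* The AM-GM weights are chosen so that half of eta * Y is absorbed by the left-hand side. *)
have h : eta * Y <= eta / 2 * Y + (2 * eta)^-1 * V.
  have -> : eta * Y = - complex.Im s by rewrite e mulNr opprK.
  apply: (le_trans (ler_norm _)); rewrite normrN.
  apply: (le_trans (Im_cabs _)); apply: (le_trans (cabs_sum _ _ _)).
  rewrite !mulr_sumr -big_split/=; apply: ler_sum => a _.
  rewrite cabsM cabsJ; set p := cabs _; set q := cabs _.
  rewrite -subr_ge0.
  have -> : eta / 2 * p ^+ 2 + (2 * eta)^-1 * q ^+ 2 - p * q =
     (2 * eta)^-1 * (eta * p - q) ^+ 2 by field; exact: lt0r_neq0.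
  by rewrite mulr_ge0 ?sqr_ge0// invr_ge0 mulr_ge0// ltW.
have {}h : eta / 2 * Y <= (2 * eta)^-1 * V by lra.
rewrite -(ler_pM2l (divr_gt0 eta0 (ltr0n _ 2)))//.
apply: (le_trans h); rewrite le_eqVlt; apply/orP; left; apply/eqP.
by field; exact: lt0r_neq0.
Qed.

Lemma sum_sqr_resolvent H b : H^T = H ->
  \sum_a cabs (G H a b) ^+ 2 <= eta ^- 2.
Proof.
move=> sH; have := resolvent_contract (delta_mx b 0) sH.
have -> : \sum_a cabs ((delta_mx b 0 : 'cV[R[i]]_n) a 0) ^+ 2 = 1.
  rewrite (bigD1 b)//= mxE !eqxx /= big1 ?addr0.
    by have := cabsR (1 : R); rewrite /= => ->; rewrite normr1 expr1n.
  by move=> i ib; rewrite mxE (negbTE ib)/= cabs0 expr0n.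
rewrite mulr1; under eq_bigr => a _ do rewrite -colE mxE.
by [].
Qed.

Lemma cabs_resolvent H a b : H^T = H -> cabs (G H a b) <= eta^-1.
Proof.
move=> sH; have h : 0 <= eta^-1 by rewrite invr_ge0 ltW.
rewrite -ler_sqr ?nnegrE ?cabs_ge0//.
rewrite exprVn; apply: le_trans (sum_sqr_resolvent b sH).
by rewrite (bigD1 a)//= lerDl sumr_ge0// => *; rewrite sqr_ge0.
Qed.

(** Ward identity: [resolvent_form] at a basis vector. *)
Lemma Im_resolvent H a : H^T = H ->
  complex.Im (G H a a) = eta * \sum_b cabs (G H b a) ^+ 2.
Proof.
move=> sH; have := resolvent_form (delta_mx a 0) sH.
under [X in - eta * X]eq_bigr => b _ do rewrite -colE mxE.
rewrite (bigD1 a)//= big1 ?addr0.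
  by rewrite -colE !mxE !eqxx mulr1 ImJ mulNr => /oppr_inj.
by move=> i ib; rewrite [delta_mx _ _ _ _]mxE (negbTE ib)/= mulr0.
Qed.

Lemma Im_resolvent_ge0 H a : H^T = H -> 0 <= complex.Im (G H a a).
Proof.
move=> sH; rewrite Im_resolvent//; apply: mulr_ge0; first exact: ltW.
by apply: sumr_ge0 => b _; exact: sqr_ge0.
Qed.

End fixed.

(** Changing the sign of H sends z to - z, in the lower half-plane; since H is real, conjugation
    brings it back to - x + i eta. *)
Lemma resolventN H x eta a b : H^T = H -> 0 < eta ->
  resolvent (x +i* eta)%C (- H) a b =
  - conjc (resolvent (- x +i* eta)%C H a b).
Proof.
move=> sH eta0.
set G := resolvent (- x +i* eta)%C H.
suff -> : resolvent (x +i* eta)%C (- H) = - map_mx conjc G by rewrite !mxE.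
apply: mulmx1_invmx.
have -> : toC (- H) - (x +i* eta)%C%:M =
          - map_mx conjc (toC H - (- x +i* eta)%C%:M).
  apply/matrixP => i j; rewrite !mxE.
  case: (i == j) => /=; rewrite ?mulr1n ?mulr0n;
    by apply/eqP; rewrite eq_complex/=; apply/andP; split; apply/eqP; ring.
by rewrite mulmxN mulNmx opprK -map_mxM mulVres// map_mx1.
Qed.

(** The trace is computed from a unitary diagonalization over the complex numbers, whereas
    [eigenvalues] comes from the factorization of the characteristic polynomial over R. Unique
    factorization shows that the two lists agree up to order. *)
Lemma Im_trace_resolvent H x eta : H^T = H -> 0 < eta ->
  \sum_a complex.Im (resolvent (x +i* eta)%C H a a) =
  \sum_(k < n) eta / ((tnth (eigenvalues H) k - x) ^+ 2 + eta ^+ 2).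
Proof.
move=> sH eta0; set z := (x +i* eta)%C.
have hC : toC H \is hermsymmx.
  apply/is_hermitianmxP; rewrite expr0 scale1r; apply/matrixP => i j.
  rewrite !mxE -[in LHS]sH mxE; symmetry; apply/CrealP.
  by apply/complex_realP; exists (H j i).
have /orthomx_spectralP CE := hermitian_normalmx hC.
have uQ := spectral_unit (toC H).
move: CE uQ; move: (spectralmx _) (spectral_diag _) => Q sp CE uQ.
have cE : \prod_i ('X - (sp 0 i)%:P) = \prod_(l <- eigenvalues H) ('X - l%:C%C%:P).
  rewrite -(char_poly_conj_diag sp uQ) -CE -map_char_poly (eigenvaluesP sH).
  by rewrite rmorph_prod/=; apply: eq_bigr => l _; rewrite map_polyXsubC.
have pE : perm_eq [seq sp 0 i | i <- enum 'I_n]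
                  [seq l%:C%C | l <- eigenvalues H].
  by apply: prod_XsubC_eq; rewrite !big_map -cE -[RHS](big_enum _ _ predT)/= enumT.
have dnz i : sp 0 i - z != 0.
  have : sp 0 i \in [seq l%:C%C | l <- eigenvalues H].
    by rewrite -(perm_mem pE) map_f// mem_enum.
  move=> /mapP[l _ ->]; apply/eqP => -[] _ /eqP.
  by rewrite sub0r oppr_eq0 (gt_eqF eta0).
rewrite -Im_sum -/(mxtrace _) /resolvent CE mxtrace_inv_conj_diag//.
rewrite -(big_enum _ _ predT)/= -(big_map (fun i => sp 0 i) predT (fun s => (s - z)^-1)).
rewrite (perm_big _ pE)/= big_map Im_sum big_tuple; apply: eq_bigr => k _.
set l := tnth _ _.
have -> : l%:C%C - z = ((l - x) +i* (- eta))%C.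
  by apply/eqP; rewrite eq_complex/= sub0r !eqxx.
by rewrite /= sqrrN; have : 0 < (l - x) ^+ 2 + eta ^+ 2;
  [rewrite ltr_wpDl ?sqr_ge0 ?exprn_gt0 | move=> h; field; exact: lt0r_neq0].
Qed.

End resolvent.

(** * Matrices with independent Bernoulli entries *)

Section bernoulli_product.
Variables (R : realType) (T : finType) (p : T -> R).
Implicit Types (b : {ffun T -> bool}) (t : T) (F : {ffun T -> bool} -> R).

(** The identities below are algebraic and hold for arbitrary real p; the bounds 0 <= p <= 1 enter
    only with the inequalities. *)
Definition bernoulli_weight b : R := \prod_t (if b t then p t else 1 - p t).

Definition bernoulli_mean F : R := \sum_b bernoulli_weight b * F b.

Definition update b t x : {ffun T -> bool} := [ffun s => if s == t then x else b s].

Local Notation E := bernoulli_mean.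

Lemma update_id b t : update b t (b t) = b.
Proof. by apply/ffunP => s; rewrite ffunE; case: eqVneq => [->|]. Qed.

Lemma updateK b t x y : update (update b t x) t y = update b t y.
Proof. by apply/ffunP => s; rewrite !ffunE; case: eqVneq. Qed.

Lemma sum_update F t :
  \sum_b F b = \sum_(b : {ffun T -> bool} | b t) (F (update b t true) + F (update b t false)).
Proof.
rewrite (bigID (fun b : {ffun T -> bool} => b t))/= big_split/=; congr (_ + _).
  by apply: eq_bigr => b bt; rewrite -[in RHS]bt update_id.
(* Configurations come in pairs differing only at t; the pair is indexed by its member with b t =
   true. *)
rewrite (reindex_onto (fun b => update b t false) (fun b => update b t true))/=.
  apply: eq_bigl => b; rewrite !ffunE eqxx/= updateK.
  apply/eqP/idP => [<-|bt]; first by rewrite ffunE eqxx.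
  by rewrite -bt update_id.
by move=> b /negbTE bt; rewrite updateK -bt update_id.
Qed.

Lemma bernoulli_weight_update b t x :
  bernoulli_weight (update b t x) =
  (if x then p t else 1 - p t) * \prod_(s | s != t) (if b s then p s else 1 - p s).
Proof.
rewrite /bernoulli_weight (bigD1 t)//= ffunE eqxx; congr (_ * _).
by apply: eq_bigr => s /negbTE st; rewrite ffunE st.
Qed.

Lemma bernoulli_mean_update F t :
  E F = E (fun b => p t * F (update b t true) + (1 - p t) * F (update b t false)).
Proof.
rewrite /bernoulli_mean (sum_update _ t) [in RHS](sum_update _ t).
apply: eq_bigr => b _; rewrite !bernoulli_weight_update !updateK; ring.
Qed.

Lemma bernoulli_weight_sum : \sum_b bernoulli_weight b = 1.
Proof.
rewrite /bernoulli_weight.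
rewrite -(bigA_distr_bigA (fun t (x : bool) => if x then p t else 1 - p t)).
by rewrite big1// => t _; rewrite big_bool/=; ring.
Qed.

Lemma bernoulli_mean_cst r : E (fun=> r) = r.
Proof. by rewrite /bernoulli_mean -mulr_suml bernoulli_weight_sum mul1r. Qed.

Lemma bernoulli_meanD F F' : E (fun b => F b + F' b) = E F + E F'.
Proof. by rewrite -big_split/=; apply: eq_bigr => b _; rewrite mulrDr. Qed.

Lemma bernoulli_meanZ r F : E (fun b => r * F b) = r * E F.
Proof. by rewrite mulr_sumr; apply: eq_bigr => b _; rewrite mulrCA. Qed.

Lemma bernoulli_meanN F : E (fun b => - F b) = - E F.
Proof. by rewrite -sumrN; apply: eq_bigr => b _; rewrite mulrN. Qed.

Lemma bernoulli_meanB F F' : E (fun b => F b - F' b) = E F - E F'.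
Proof. by rewrite bernoulli_meanD bernoulli_meanN. Qed.

Lemma bernoulli_mean_sum (I : Type) (r : seq I) (P : pred I)
    (F : I -> {ffun T -> bool} -> R) :
  E (fun b => \sum_(i <- r | P i) F i b) = \sum_(i <- r | P i) E (F i).
Proof.
by rewrite exchange_big/=; apply: eq_bigr => b _; rewrite mulr_sumr.
Qed.

(* The two-point form of integration by parts. *)
Lemma bernoulli_mean_centered F t :
  E (fun b => ((b t)%:R - p t) * F b) =
  p t * (1 - p t) * E (fun b => F (update b t true) - F (update b t false)).
Proof.
rewrite (bernoulli_mean_update _ t) -bernoulli_meanZ.
by apply: eq_bigr => b _; rewrite !ffunE eqxx/=; ring.
Qed.

Hypothesis p01 : forall t, 0 <= p t <= 1.

Lemma bernoulli_weight_ge0 b : 0 <= bernoulli_weight b.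
Proof.
apply: prodr_ge0 => t _; have /andP[p0 p1] := p01 t.
by case: ifP => // _; rewrite subr_ge0.
Qed.

Lemma ler_bernoulli_mean F F' : (forall b, F b <= F' b) -> E F <= E F'.
Proof.
by move=> FF'; apply: ler_sum => b _; rewrite ler_wpM2l ?bernoulli_weight_ge0.
Qed.

Lemma bernoulli_mean_ge0 F : (forall b, 0 <= F b) -> 0 <= E F.
Proof.
by move=> F0; rewrite -(bernoulli_mean_cst 0); exact: ler_bernoulli_mean.
Qed.

(** Jensen's inequality, obtained by averaging the tangent to the cube at the mean m. *)
Lemma bernoulli_mean_exp3 F : (forall b, 0 <= F b) -> E F ^+ 3 <= E (fun b => F b ^+ 3).
Proof.
move=> F0; have m0 := bernoulli_mean_ge0 F0; set m := E F in m0 *.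
have -> : m ^+ 3 = E (fun b => 3 * m ^+ 2 * F b - 2 * m ^+ 3).
  by rewrite bernoulli_meanB bernoulli_meanZ bernoulli_mean_cst -/m; ring.
apply: ler_bernoulli_mean => b; rewrite -subr_ge0.
have -> : F b ^+ 3 - (3 * m ^+ 2 * F b - 2 * m ^+ 3) =
  (F b - m) ^+ 2 * (F b + 2 * m) by ring.
by rewrite mulr_ge0 ?sqr_ge0 ?addr_ge0 ?mulr_ge0.
Qed.

End bernoulli_product.

(** * Symmetric matrices and the effect of changing one entry *)

Section symmetric_entries.
Variables (R : realType) (n : nat).
Implicit Types (A B M : 'M[R]_n) (t : 'I_n * 'I_n) (v w : 'I_n * 'I_n -> R).

Local Notation toC := (map_mx (real_complex R)).

(** One coordinate per unordered pair, read at its increasing representative, and a zero diagonal as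
    there are no self-loops: independent coordinates give entries that are independent up to
    symmetry. *)
Definition symmetric_mx v : 'M[R]_n :=
  \matrix_(i, j) if (i < j)%N then v (i, j) else if (j < i)%N then v (j, i) else 0.

Definition entry_dir t : 'M[R]_n := delta_mx t.1 t.2 + delta_mx t.2 t.1.

Lemma symmetric_mx_tr v : (symmetric_mx v)^T = symmetric_mx v.
Proof. by apply/matrixP => i j; rewrite !mxE; case: ltngtP. Qed.

Lemma entry_dirC i j : entry_dir (i, j) = entry_dir (j, i).
Proof. by rewrite /entry_dir addrC. Qed.

Lemma symmetric_mxB v w t : (t.1 < t.2)%N -> (forall s, s != t -> v s = w s) ->
  symmetric_mx v - symmetric_mx w = (v t - w t) *: entry_dir t.
Proof.
case: t => k l /= kl vw; apply/matrixP => i j; rewrite !mxE.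
case: ltngtP => [ij|ji|ij].
- have [[-> ->]|ne] := eqVneq (i, j) (k, l).
    have lk : (k == l) = false by apply/negbTE; rewrite neq_ltn kl.
    by rewrite !eqxx lk /= addr0 mulr1.
  rewrite vw// subrr.
  have -> : (i == k) && (j == l) = false by apply/negbTE; move: ne; rewrite xpair_eqE.
  have -> : (i == l) && (j == k) = false.
    by apply/negbTE/negP => /andP[/eqP il /eqP jk]; rewrite il jk ltnNge ltnW in ij.
  by rewrite addr0 mulr0.
- have [[-> ->]|ne] := eqVneq (j, i) (k, l).
    have lk : (k == l) = false by apply/negbTE; rewrite neq_ltn kl.
    by rewrite /= !eqxx [l == k]eq_sym lk /= add0r mulr1.
  rewrite vw// subrr.
  have -> : (i == l) && (j == k) = false.
    by apply/negbTE; move: ne; rewrite xpair_eqE andbC.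
  have -> : (i == k) && (j == l) = false.
    by apply/negbTE/negP => /andP[/eqP il /eqP jk]; rewrite il jk ltnNge ltnW in ji.
  by rewrite addr0 mulr0.
- have {ij} -> : i = j by exact/val_inj.
  have -> : (j == k) && (j == l) = false.
    by apply/negbTE/negP => /andP[/eqP jk /eqP jl]; rewrite -jk -jl ltnn in kl.
  have -> : (j == l) && (j == k) = false.
    by apply/negbTE/negP => /andP[/eqP jk /eqP jl]; rewrite -jk -jl ltnn in kl.
  by rewrite subrr addr0 mulr0.
Qed.

Lemma mulmx_entry_dir (A B : 'M[R[i]]_n) (u : R) i j c d :
  (A *m toC (u *: entry_dir (i, j)) *m B) c d =
  u%:C%C * (A c i * B j d + A c j * B i d).
Proof.
have de k l : (A *m toC (delta_mx k l) *m B) c d = A c k * B l d.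
  rewrite map_delta_mx mxE (bigD1 l)//= big1 ?addr0.
    rewrite mxE (bigD1 k)//= big1 ?addr0.
      by rewrite !mxE !eqxx mulr1.
    by move=> s sk; rewrite !mxE (negbTE sk)/= mulr0.
  move=> s sl; rewrite mxE big1 ?mul0r// => r _.
  by rewrite !mxE (negbTE sl) andbF mulr0.
rewrite map_mxZ map_mxD -scalemxAr -scalemxAl mxE.
by rewrite mulmxDr mulmxDl mxE !de.
Qed.

Variables (x eta : R).
Hypothesis eta0 : 0 < eta.
Local Notation G := (resolvent (x +i* eta)%C).
Local Notation e := eta^-1.

Let e0 : 0 < e. Proof. by rewrite invr_gt0. Qed.

Lemma resolvent_entryB A B (u : R) i j c d : A^T = A -> B^T = B ->
  B - A = u *: entry_dir (i, j) ->
  G A c d - G B c d = u%:C%C * (G A c i * G B j d + G A c j * G B i d).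
Proof.
move=> sA sB BA; rewrite -mulmx_entry_dir -BA -(resolvent_sub x eta0 sA sB).
by rewrite !mxE.
Qed.

Lemma cabs_resolventM A B c d k l : A^T = A -> B^T = B ->
  cabs (G A c d * G B k l) <= e ^+ 2.
Proof.
move=> sA sB; rewrite cabsM expr2.
by apply: ler_pM; rewrite ?cabs_ge0 ?cabs_resolvent.
Qed.

Lemma cabs_resolvent_entryB A B (u : R) i j c d : A^T = A -> B^T = B ->
  B - A = u *: entry_dir (i, j) ->
  cabs (G A c d - G B c d) <= 2 * `|u| * e ^+ 2.
Proof.
move=> sA sB BA; rewrite (resolvent_entryB _ _ sA sB BA) cabsM cabsR.
have -> : 2 * `|u| * e ^+ 2 = `|u| * (2 * e ^+ 2) by ring.
apply: ler_wpM2l => //.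
apply: (le_trans (cabsD _ _)).
rewrite mulr_natl mulr2n; apply: lerD; exact: cabs_resolventM.
Qed.

Lemma Im_cubicB (k : R) (g0 g : R) (y w : R) : 0 <= k -> 0 <= g0 <= e -> 0 <= g <= e ->
  `|y| <= e -> `|g0 - g| <= k -> `|w - y| <= k ->
  `|g0 ^+ 2 * w - g ^+ 2 * y| <= 3 * k * e ^+ 2.
Proof.
move=> k0 /andP[g00 g0e] /andP[gp ge] ye gk wk.
have -> : g0 ^+ 2 * w - g ^+ 2 * y = g0 ^+ 2 * (w - y) + (g0 - g) * (g0 + g) * y by ring.
apply: (le_trans (ler_normD _ _)).
have -> : 3 * k * e ^+ 2 = e ^+ 2 * k + k * (e + e) * e by ring.
apply: lerD; rewrite !normrM.
  apply: ler_pM => //.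
  by rewrite -expr2 ger0_norm// ler_pXn2r ?nnegrE// ltW.
apply: ler_pM => //.
apply: ler_pM => //; rewrite ger0_norm ?addr_ge0//; exact: lerD.
Qed.

Lemma cabs_subr_le (y w : R[i]) : `|cabs y - cabs w| <= cabs (y - w).
Proof. by rewrite -lecR cabsE -(cabsR (cabs y - cabs w)) cabsE rmorphB/= !cabsE ler_dist_dist. Qed.

End symmetric_entries.

(** * Integration by parts and the cubic inequality *)

Section cubic_inequality.
Variables (R : realType) (n : nat) (x eta a : R).
Hypotheses (eta0 : 0 < eta) (a0 : 0 <= a).
Local Notation G := (resolvent (x +i* eta)%C).
Local Notation e := eta^-1.
Local Notation k := (2 * a * e ^+ 2).
Local Notation T := ('I_n * 'I_n)%type.

Let e0 : 0 < e. Proof. by rewrite invr_gt0. Qed.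
Let k0 : 0 <= k. Proof. by rewrite !mulr_ge0// ?exprn_ge0// ltW. Qed.

(** A and B stand for the matrix with the edge ij present and absent, M for the actual one.
    Expressing the difference through M allows averaging under the original law. The main term has a
    sign; the other resolvent products carry two off-diagonal factors, whose squares have bounded
    sums over j. *)
Lemma resolvent_cubic_step (A B M : 'M[R]_n) i j : A^T = A -> B^T = B ->
  M = A \/ M = B -> B - A = - a *: entry_dir R (i, j) ->
  complex.Im (conjc (G A i i) * G A j i) - complex.Im (conjc (G B i i) * G B j i)
  <= a * (- (cabs (G M i i) ^+ 2 * complex.Im (G M j j)) + 3 * k * e ^+ 2
          + 6 * e * (cabs (G M j i) ^+ 2 + k ^+ 2)).
Proof.
move=> sA sB MAB BA.
have sM : M^T = M by case: MAB => ->.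
have dAB c d : cabs (G A c d - G B c d) <= k.
  have := cabs_resolvent_entryB x eta0 c d sA sB BA.
  by rewrite normrN ger0_norm.
have dMA c d : cabs (G A c d - G M c d) <= k.
  by case: MAB => -> //; rewrite subrr cabs0.
have dMB c d : cabs (G B c d - G M c d) <= k.
  by case: MAB => ->; [rewrite -cabsN opprB dAB | rewrite subrr cabs0].
rewrite -ImB.
(* The three terms with one diagonal and two off-diagonal factors; what remains is |G_ii|^2 for B
   times G_jj for A. *)
set S := conjc (G A i i * G B j i + G A i j * G B i i) * G A j i +
         conjc (G B i i) * (G A j i * G B j i).
have -> : conjc (G A i i) * G A j i - conjc (G B i i) * G B j i =
    (- a)%:C%C * (S + (cabs (G B i i) ^+ 2)%:C%C * G A j j).
  have Di := resolvent_entryB x eta0 i i sA sB BA.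
  have Dj := resolvent_entryB x eta0 j i sA sB BA.
  have -> : conjc (G A i i) * G A j i - conjc (G B i i) * G B j i =
      conjc (G A i i - G B i i) * G A j i + conjc (G B i i) * (G A j i - G B j i).
    by rewrite rmorphB/=; ring.
  rewrite Di Dj -conjc_mul_cabs /S rmorphM/=.
  have -> : (- a -i* 0)%C = (- a)%:C%C by rewrite oppr0.
  by ring.
rewrite ImMR ImD ImMR mulNr -mulrN; apply: ler_wpM2l => //.
have hS : `|complex.Im S| <= 6 * e * (cabs (G M j i) ^+ 2 + k ^+ 2).
  apply: (le_trans (Im_cabs _)); rewrite /S mulrC [conjc (G B i i) * _]mulrC.
  set g := cabs (G M j i).
  have gA : cabs (G A j i) <= g + k.
    rewrite -[X in cabs X](subrK (G M j i)) addrC; apply: (le_trans (cabsD _ _)).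
    exact: lerD.
  have gB : cabs (G B j i) <= g + k.
    rewrite -[X in cabs X](subrK (G M j i)) addrC; apply: (le_trans (cabsD _ _)).
    exact: lerD.
  have gA' : cabs (G A i j) <= g + k by rewrite resolvent_sym.
  have bA c d : cabs (G A c d) <= e by exact: cabs_resolvent.
  have bB c d : cabs (G B c d) <= e by exact: cabs_resolvent.
  have n0 (y : R[i]) := cabs_ge0 y.
  (* Common bound for the three terms of S, which yields the factor 6. *)
  have m3 (u v w : R) : 0 <= u <= e -> 0 <= v <= g + k -> 0 <= w <= g + k ->
      u * v * w <= e * (2 * g ^+ 2 + 2 * k ^+ 2).
    move=> /andP[u0 ue] /andP[v0 vk] /andP[w0 wk].
    rewrite -mulrA; apply: ler_pM => //; first exact: mulr_ge0.
    apply: (@le_trans _ _ ((g + k) * (g + k))); first exact: ler_pM.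
    rewrite -subr_ge0.
    have -> : 2 * g ^+ 2 + 2 * k ^+ 2 - (g + k) * (g + k) = (g - k) ^+ 2 by ring.
    exact: sqr_ge0.
  rewrite rmorphD/= !rmorphM/= mulrDr.
  apply: (le_trans (cabsD _ _)).
  apply: (le_trans (lerD (cabsD _ _) (lexx _))).
  rewrite !cabsM !cabsJ.
  have -> : 6 * e * (g ^+ 2 + k ^+ 2) =
      e * (2 * g ^+ 2 + 2 * k ^+ 2) + e * (2 * g ^+ 2 + 2 * k ^+ 2) +
      e * (2 * g ^+ 2 + 2 * k ^+ 2) by ring.
  apply: lerD; first apply: lerD.
  - by rewrite mulrC; apply: m3; rewrite n0 /= ?bA ?bB.
  - by rewrite mulrC [cabs (G A i j) * _]mulrC; apply: m3; rewrite n0 /= ?bA ?bB.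
  - by rewrite mulrC mulrA; apply: m3; rewrite n0 /= ?bA ?bB.
have hQ : `|cabs (G B i i) ^+ 2 * complex.Im (G A j j) -
            cabs (G M i i) ^+ 2 * complex.Im (G M j j)| <= 3 * k * e ^+ 2.
  apply: (Im_cubicB eta0) => //; rewrite ?cabs_ge0 ?cabs_resolvent//.
  - by apply: (le_trans (Im_cabs _)); rewrite cabs_resolvent.
  - by apply: (le_trans (cabs_subr_le _ _)).
  - by rewrite -ImB; apply: (le_trans (Im_cabs _)).
move: hS hQ; rewrite !ler_norml => /andP[h1 _] /andP[h2 _].
by lra.
Qed.

(** Imaginary part of the i-th diagonal entry of (H - z) G = 1 times the conjugate of G_ii. This
    multiplier is what makes the main term of the integration by parts equal to |G_ii|^2 Im G_jj,
    which is nonnegative. *)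
Lemma resolvent_row_identity (H : 'M[R]_n) i : H^T = H ->
  \sum_j H i j * complex.Im (conjc (G H i i) * G H j i) =
  - complex.Im (G H i i) + eta * cabs (G H i i) ^+ 2.
Proof.
move=> sH; have := mulVres x eta0 sH => /matrixP/(_ i i).
rewrite mulmxBl mul_scalar_mx !mxE eqxx /= mulr1n => h.
have {}h : \sum_j (H i j)%:C%C * G H j i = 1 + (x +i* eta)%C * G H i i.
  by rewrite -h subrK; apply: eq_bigr => j _; rewrite mxE.
have : complex.Im (conjc (G H i i) * \sum_j (H i j)%:C%C * G H j i) =
       - complex.Im (G H i i) + eta * cabs (G H i i) ^+ 2.
  rewrite h mulrDr mulr1 mulrCA conjc_mul_cabs ImD ImJ mulrC ImMR /=.
  by rewrite mulrC.
move=> <-; rewrite mulr_sumr Im_sum; apply: eq_bigr => j _.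
by rewrite -ImMR; congr complex.Im; ring.
Qed.

Variable p : 'I_n -> 'I_n -> R.
Hypotheses (p01 : forall i j, 0 <= p i j <= 1) (psym : forall i j, p i j = p j i).

Definition upper_prob (t : T) : R := if (t.1 < t.2)%N then p t.1 t.2 else 0.

Lemma upper_prob01 t : 0 <= upper_prob t <= 1.
Proof. by rewrite /upper_prob; case: ifP; rewrite ?p01// lexx ler01. Qed.

Definition centered_mx (b : {ffun T -> bool}) : 'M[R]_n :=
  symmetric_mx (fun t => a * ((b t)%:R - upper_prob t)).

Local Notation E := (bernoulli_mean upper_prob).
Local Notation H := centered_mx.

Lemma centered_mx_tr b : (H b)^T = H b.
Proof. exact: symmetric_mx_tr. Qed.

Lemma mean_entry_resolvent_le i j : i != j ->
  E (fun b => H b i j * complex.Im (conjc (G (H b) i i) * G (H b) j i)) <=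
  a ^+ 2 * (p i j * (1 - p i j)) *
  E (fun b => - (cabs (G (H b) i i) ^+ 2 * complex.Im (G (H b) j j))
       + 3 * k * e ^+ 2 + 6 * e * (cabs (G (H b) j i) ^+ 2 + k ^+ 2)).
Proof.
move=> ij.
pose t : T := if (i < j)%N then (i, j) else (j, i).
have tlt : (t.1 < t.2)%N.
  by rewrite /t; case: (ltngtP i j) ij => // /val_inj ->; rewrite eqxx.
have pt : upper_prob t = p i j.
  rewrite /upper_prob tlt /t; case: ifP => //= _; exact: psym.
have dt : entry_dir R t = entry_dir R (i, j).
  by rewrite /t; case: ifP => // _; rewrite entry_dirC.
have Ht b : H b i j = a * ((b t)%:R - upper_prob t).
  rewrite mxE /t; case: (ltngtP i j) ij => // /val_inj ->.
  by rewrite eqxx.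
set F := fun b => complex.Im (conjc (G (H b) i i) * G (H b) j i).
have -> : E (fun b => H b i j * F b) =
          a * E (fun b => ((b t)%:R - upper_prob t) * F b).
  rewrite -bernoulli_meanZ; congr bernoulli_mean; apply/funext => b.
  by rewrite Ht mulrA.
rewrite bernoulli_mean_centered pt.
set Y := (X in a * (_ * X)); set Z := (X in _ <= _ * X).
suff YZ : Y <= a * Z.
  have -> : a ^+ 2 * (p i j * (1 - p i j)) * Z = a * (p i j * (1 - p i j) * (a * Z)).
    by ring.
  case/andP: (p01 i j) => pp0 pp1; apply: ler_wpM2l => //; apply: ler_wpM2l => //.
  by rewrite mulr_ge0// subr_ge0.
rewrite /Y /Z -bernoulli_meanZ; apply: ler_bernoulli_mean; first exact: upper_prob01.
move=> b; rewrite /F.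
apply: resolvent_cubic_step; rewrite ?centered_mx_tr//.
(* The configuration b is itself one of its two updates at t. *)
- case bt : (b t); [left|right]; congr H; rewrite -[LHS](update_id b t) bt//.
- rewrite (@symmetric_mxB _ _ _ _ t)//; last first.
    by move=> s /negbTE st; rewrite !ffunE st.
  by rewrite !ffunE eqxx dt; congr (_ *: _) => /=; ring.
Qed.

Definition mean_Im_resolvent (M : 'M[R]_n) : R :=
  n%:R^-1 * \sum_i complex.Im (G M i i).

Lemma mean_Im_resolvent_ge0 M : M^T = M -> 0 <= mean_Im_resolvent M.
Proof.
move=> sM; rewrite mulr_ge0// ?invr_ge0// sumr_ge0// => i _.
exact: Im_resolvent_ge0.
Qed.

(** The conditional mean degree times a ^+ 2. With a = c_N^(-1/2) it stays bounded on average over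
    the weights, whereas [sqr_density], which is n^-1 times the squared Hilbert-Schmidt norm of the
    mean matrix, tends to 0. *)
Definition edge_density := n%:R^-1 * (a ^+ 2 * \sum_i \sum_(j | j != i) p i j).
Definition sqr_density := n%:R^-1 * (a ^+ 2 * \sum_i \sum_(j | j != i) p i j ^+ 2).

(** The double sum factorizes. The sum over j is n X, and the sum over i is at least n X^2 because
    |G_ii| >= Im G_ii and a mean of squares dominates the square of the mean. *)
Lemma mean_Im_exp3_le (M : 'M[R]_n) : M^T = M -> (0 < n)%N ->
  n%:R * mean_Im_resolvent M ^+ 3 <=
  n%:R^-1 * \sum_i \sum_j cabs (G M i i) ^+ 2 * complex.Im (G M j j).
Proof.
move=> sM n0; set X := mean_Im_resolvent M.
have n0' : 0 < n%:R :> R by rewrite ltr0n.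
have XE : \sum_j complex.Im (G M j j) = n%:R * X.
  by rewrite /X /mean_Im_resolvent mulrA mulfV ?mul1r// lt0r_neq0.
under eq_bigr => i _ do rewrite -mulr_sumr XE.
rewrite -mulr_suml.
have X0 : 0 <= X by exact: mean_Im_resolvent_ge0.
have : n%:R * X ^+ 2 <= \sum_i cabs (G M i i) ^+ 2.
  apply: (@le_trans _ _ (\sum_i (2 * X * complex.Im (G M i i) - X ^+ 2))).
    rewrite sumrB -mulr_sumr XE sumr_const card_ord -mulr_natl.
    by rewrite le_eqVlt; apply/orP; left; apply/eqP; ring.
  apply: ler_sum => i _; apply: (@le_trans _ _ (complex.Im (G M i i) ^+ 2)).
    rewrite -subr_ge0; set y := complex.Im _.
    have -> : y ^+ 2 - (2 * X * y - X ^+ 2) = (y - X) ^+ 2 by ring.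
    exact: sqr_ge0.
  have := Im_cabs (G M i i); set y := complex.Im _ => h.
  rewrite -[y ^+ 2]ger0_norm ?sqr_ge0// normrX.
  by rewrite ler_pXn2r ?nnegrE ?cabs_ge0.
set Y := \sum_i _ => YX.
have -> : n%:R^-1 * (Y * (n%:R * X)) = Y * X by field; exact: lt0r_neq0.
by rewrite exprSr mulrA; apply: ler_wpM2r.
Qed.

(* Summing the integration by parts over all entries: the lower bound on the
   variance profile turns the left-hand side into the third moment. *)
Lemma mean_cubic_le (c : R) : (0 < n)%N -> 0 <= c ->
  (forall i j, i != j -> c / n%:R <= a ^+ 2 * p i j) ->
  c * E (fun b => mean_Im_resolvent (H b) ^+ 3) <=
  E (fun b => mean_Im_resolvent (H b)) +
  (3 * k * e ^+ 2 + 6 * e * k ^+ 2) * edge_density + 6 * e ^+ 3 * a ^+ 2 +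
  c * e ^+ 3 / n%:R + e ^+ 3 * sqr_density.
Proof.
move=> n0 c0 cp.
have n0' : 0 < n%:R :> R by rewrite ltr0n.
have nu : n%:R != 0 :> R by exact: lt0r_neq0.
have sH b : (H b)^T = H b by exact: centered_mx_tr.
pose Q i j := E (fun b => cabs (G (H b) i i) ^+ 2 * complex.Im (G (H b) j j)).
pose m i := E (fun b => complex.Im (G (H b) i i)).
have Qb b i j : 0 <= cabs (G (H b) i i) ^+ 2 * complex.Im (G (H b) j j) <= e ^+ 3.
  rewrite mulr_ge0 ?sqr_ge0 ?Im_resolvent_ge0//=.
  rewrite (exprSr _ 2); apply: ler_pM; rewrite ?sqr_ge0 ?Im_resolvent_ge0//.
    by rewrite ler_pXn2r ?nnegrE ?cabs_ge0 ?cabs_resolvent// ltW.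
  apply: (le_trans (ler_norm _)); apply: (le_trans (Im_cabs _)).
  exact: cabs_resolvent.
have Q0 i j : 0 <= Q i j.
  by apply: bernoulli_mean_ge0 => [|b]; [exact: upper_prob01 | case/andP: (Qb b i j)].
have Qe i j : Q i j <= e ^+ 3.
  rewrite -[leRHS](bernoulli_mean_cst upper_prob).
  apply: ler_bernoulli_mean => [|b]; [exact: upper_prob01 | by case/andP: (Qb b i j)].
set K := 3 * k * e ^+ 2 + 6 * e * k ^+ 2.
have K0 : 0 <= K.
  have ? := ltW e0.
  by rewrite addr_ge0 ?mulr_ge0 ?exprn_ge0.
pose g i j := E (fun b => cabs (G (H b) j i) ^+ 2).
have g0 i j : 0 <= g i j.
  by apply: bernoulli_mean_ge0 => [|b]; [exact: upper_prob01 | exact: sqr_ge0].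
have gsum i : \sum_(j | j != i) g i j <= e ^+ 2.
  apply: (@le_trans _ _ (\sum_j g i j)).
    by rewrite [leRHS](bigD1 i)//= lerDr.
  rewrite -bernoulli_mean_sum -[leRHS](bernoulli_mean_cst upper_prob).
  apply: ler_bernoulli_mean => [|b]; first exact: upper_prob01.
  by rewrite exprVn sum_sqr_resolvent.
have step1 : \sum_i \sum_(j | j != i) a ^+ 2 * (p i j * (1 - p i j)) * Q i j <=
    \sum_i m i + a ^+ 2 * K * (\sum_i \sum_(j | j != i) p i j)
    + 6 * e ^+ 3 * a ^+ 2 * n%:R.
  have -> : 6 * e ^+ 3 * a ^+ 2 * n%:R = \sum_(i < n) 6 * e ^+ 3 * a ^+ 2.
    by rewrite sumr_const card_ord mulr_natr.
  rewrite mulr_sumr -!big_split/=; apply: ler_sum => i _.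
  have : - m i <= \sum_(j | j != i)
      a ^+ 2 * (p i j * (1 - p i j)) * (- Q i j + K + 6 * e * g i j).
    (* [resolvent_row_identity] is used after dropping its nonnegative term eta * |G_ii|^2. *)
    apply: (@le_trans _ _ (E (fun b => \sum_j H b i j *
               complex.Im (conjc (G (H b) i i) * G (H b) j i)))).
      rewrite -bernoulli_meanN; apply: ler_bernoulli_mean => [|b].
        exact: upper_prob01.
      by rewrite resolvent_row_identity// lerDl mulr_ge0 ?sqr_ge0// ltW.
    rewrite bernoulli_mean_sum (bigD1 i)//=.
    have -> : E (fun b => H b i i * complex.Im (conjc (G (H b) i i) * G (H b) i i)) = 0.
      rewrite -[RHS](bernoulli_mean_cst upper_prob); congr bernoulli_mean.
      by apply/funext => b; rewrite mxE ltnn mul0r.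
    rewrite add0r; apply: ler_sum => j ji.
    have := @mean_entry_resolvent_le i j; rewrite eq_sym => /(_ ji)/le_trans; apply.
    rewrite le_eqVlt; apply/orP; left; apply/eqP; congr (_ * _).
    rewrite bernoulli_meanD bernoulli_meanD bernoulli_meanN bernoulli_mean_cst.
    rewrite bernoulli_meanZ bernoulli_meanD bernoulli_mean_cst -/(Q i j) -/(g i j).
    by rewrite /K; ring.
  move=> h.
  have {}h : \sum_(j | j != i) a ^+ 2 * (p i j * (1 - p i j)) * Q i j <=
     m i + \sum_(j | j != i) a ^+ 2 * (p i j * (1 - p i j)) * (K + 6 * e * g i j).
    have hs : \sum_(j | j != i) a ^+ 2 * (p i j * (1 - p i j)) * (- Q i j + K + 6 * e * g i j) =
        \sum_(j | j != i) a ^+ 2 * (p i j * (1 - p i j)) * (K + 6 * e * g i j)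
        - \sum_(j | j != i) a ^+ 2 * (p i j * (1 - p i j)) * Q i j.
      by rewrite -sumrB; apply: eq_bigr => j _; ring.
    by move: h; rewrite hs; lra.
  apply: (le_trans h); rewrite -addrA lerD2l.
  apply: (@le_trans _ _ (\sum_(j | j != i) (a ^+ 2 * K * p i j + 6 * e * a ^+ 2 * g i j))).
    apply: ler_sum => j _; rewrite mulrDr; case/andP: (p01 i j) => pp0 pp1.
    have a20 : 0 <= a ^+ 2 by exact: sqr_ge0.
    apply: lerD.
      rewrite mulrAC; apply: ler_wpM2l; first exact: mulr_ge0.
      by rewrite ler_piMr// gerBl.
    have -> : 6 * e * a ^+ 2 * g i j = a ^+ 2 * 1 * (6 * e * g i j) by ring.
    apply: ler_wpM2r; first by rewrite !mulr_ge0// ltW.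
    by apply: ler_wpM2l => //; rewrite mulr_ile1// ?subr_ge0// gerBl.
  rewrite big_split/= -!mulr_sumr lerD2l.
  have -> : 6 * e ^+ 3 * a ^+ 2 = 6 * e * a ^+ 2 * e ^+ 2 by ring.
  by apply: ler_wpM2l => //; rewrite !mulr_ge0 ?sqr_ge0// ltW.
(* The diagonal pairs, absent on the right, cost at most c * e ^+ 3; replacing the variance p (1 -
   p) by p costs the sum of the p ^+ 2. *)
have step2 : c / n%:R * (\sum_i \sum_j Q i j) - c * e ^+ 3
    - a ^+ 2 * e ^+ 3 * (\sum_i \sum_(j | j != i) p i j ^+ 2) <=
    \sum_i \sum_(j | j != i) a ^+ 2 * (p i j * (1 - p i j)) * Q i j.
  have -> : c * e ^+ 3 = \sum_(i < n) c / n%:R * e ^+ 3.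
    by rewrite sumr_const card_ord -[RHS]mulr_natr mulrAC divfK.
  rewrite !mulr_sumr -!sumrB; apply: ler_sum => i _.
  rewrite (bigD1 i)//= mulrDr.
  apply: (@le_trans _ _ (\sum_(j | j != i) c / n%:R * Q i j -
     a ^+ 2 * e ^+ 3 * \sum_(j | j != i) p i j ^+ 2)).
    rewrite -mulr_sumr.
    have : c / n%:R * Q i i <= c / n%:R * e ^+ 3.
      by apply: ler_wpM2l => //; rewrite divr_ge0.
    by lra.
  rewrite mulr_sumr -sumrB; apply: ler_sum => j ji.
  have /andP[pp0 pp1] := p01 i j.
  have h1 := @cp i j; rewrite eq_sym in h1; have {}h1 := h1 ji.
  apply: (@le_trans _ _ (a ^+ 2 * p i j * Q i j - a ^+ 2 * p i j ^+ 2 * Q i j)).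
    apply: lerB; first exact: ler_wpM2r.
    rewrite [leRHS]mulrAC; apply: ler_wpM2l => //.
    by rewrite mulr_ge0 ?sqr_ge0.
  by rewrite le_eqVlt; apply/orP; left; apply/eqP; ring.
have step3 : E (fun b => mean_Im_resolvent (H b) ^+ 3) <=
    n%:R ^- 2 * \sum_i \sum_j Q i j.
  have -> : \sum_i \sum_j Q i j = E (fun b => \sum_i \sum_j
      cabs (G (H b) i i) ^+ 2 * complex.Im (G (H b) j j)).
    by rewrite bernoulli_mean_sum; apply: eq_bigr => i _; rewrite bernoulli_mean_sum.
  rewrite -bernoulli_meanZ; apply: ler_bernoulli_mean => [|b].
    exact: upper_prob01.
  have := mean_Im_exp3_le (sH b) n0.
  rewrite -(ler_pM2l (x := n%:R^-1)) ?invr_gt0// mulrA mulVf// mul1r mulrA.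
  by rewrite -invfM expr2.
have mE : E (fun b => mean_Im_resolvent (H b)) = n%:R^-1 * \sum_i m i.
  by rewrite bernoulli_meanZ bernoulli_mean_sum.
rewrite mE /edge_density /sqr_density.
have := le_trans step2 step1.
move: step3; set X3 := E _; set SQ := \sum_i \sum_j Q i j.
set M := \sum_i m i; set S2 := \sum_i _; set S1 := \sum_i _ => h3 h.
have h4 : c * X3 <= c * (n%:R ^- 2 * SQ) by exact: ler_wpM2l.
apply: (le_trans h4).
have -> : c * (n%:R ^- 2 * SQ) = n%:R^-1 * (c / n%:R * SQ).
  by field.
have -> : n%:R^-1 * M + K * (n%:R^-1 * (a ^+ 2 * S1)) + 6 * e ^+ 3 * a ^+ 2 +
    c * e ^+ 3 / n%:R + e ^+ 3 * (n%:R^-1 * (a ^+ 2 * S2)) =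
  n%:R^-1 * (M + a ^+ 2 * K * S1 + 6 * e ^+ 3 * a ^+ 2 * n%:R + c * e ^+ 3
     + a ^+ 2 * e ^+ 3 * S2).
  by field; rewrite nu lt0r_neq0.
rewrite ler_pM2l ?invr_gt0//; lra.
Qed.

End cubic_inequality.

(** Cyclicity joins the first resolvent to the last one. For D a multiple of [entry_dir], every
    product except B A then reduces to two terms per entry, so the trace can be bounded without any
    factor n. *)
Lemma mxtrace_rotate (F : comPzRingType) (n : nat) (A D B : 'M[F]_n) :
  \tr (A *m D *m (A *m D *m (A *m D *m B))) =
  \tr (1%:M *m D *m (A *m D *m (A *m D *m (B *m A)))).
Proof. by rewrite mul1mx -mulmxA mxtrace_mulC -!mulmxA. Qed.

(** * Lindeberg replacement and the cost of centering *)

Section lindeberg.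
Variables (R : realType) (n : nat) (x eta : R).
Hypothesis eta0 : 0 < eta.
Local Notation toC := (map_mx (real_complex R)).
Local Notation G := (resolvent (x +i* eta)%C).
Local Notation e := eta^-1.
Local Notation T := ('I_n * 'I_n)%type.
Local Notation f M := (\sum_i complex.Im (G M i i)).
Implicit Types (A B M : 'M[R]_n).

Let e0 : 0 < e. Proof. by rewrite invr_gt0. Qed.

Lemma cabs_lin_comb (u w r : R) (y1 z1 y2 z2 : R[i]) :
  cabs y1 <= w -> cabs y2 <= w -> cabs z1 <= r -> cabs z2 <= r ->
  cabs (u%:C%C * (y1 * z1 + y2 * z2)) <= `|u| * (2 * (w * r)).
Proof.
move=> h1 h2 h3 h4; rewrite cabsM cabsR; apply: ler_wpM2l => //.
rewrite mulr_natl mulr2n; apply: (le_trans (cabsD _ _)).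
by rewrite !cabsM; apply: lerD; apply: ler_pM; rewrite ?cabs_ge0.
Qed.

(** Cauchy-Schwarz together with the column sums of [sum_sqr_resolvent], hence independent of n. *)
Lemma cabs_mulmx_resolvent A B i j : A^T = A -> B^T = B ->
  cabs ((G A *m G B) i j) <= e ^+ 2.
Proof.
move=> sA sB; rewrite mxE; apply: (le_trans (cabs_sum _ _ _)).
apply: (@le_trans _ _ (\sum_k (2^-1 * cabs (G A k i) ^+ 2 + 2^-1 * cabs (G B k j) ^+ 2))).
  apply: ler_sum => k _; rewrite cabsM [G A i k]resolvent_sym//.
  set y := cabs _; set z := cabs _; rewrite -subr_ge0.
  have -> : 2^-1 * y ^+ 2 + 2^-1 * z ^+ 2 - y * z = 2^-1 * (y - z) ^+ 2 by field.
  by rewrite mulr_ge0 ?sqr_ge0.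
rewrite big_split/= -!mulr_sumr exprVn.
have h1 := sum_sqr_resolvent x eta0 i sA.
have h2 := sum_sqr_resolvent x eta0 j sB.
by lra.
Qed.

Definition imtr (X : 'M[R[i]]_n) : R := complex.Im (\tr X).

Lemma imtrB X Y : imtr (X - Y) = imtr X - imtr Y.
Proof. by rewrite /imtr raddfB ImB. Qed.

Lemma imtrD X Y : imtr (X + Y) = imtr X + imtr Y.
Proof. by rewrite /imtr raddfD ImD. Qed.

Lemma imtrZ (u : R) X : imtr (u%:C%C *: X) = u * imtr X.
Proof. by rewrite /imtr mxtraceZ ImMR. Qed.

(** The resolvent identity iterated three times: the coefficients depend on M and the direction
    only, not on u. In the remainder each of the three perturbations contributes [|u|] and a factor
    2 for its two terms, whence 8. *)
Lemma Im_trace_resolvent_taylor M i j : M^T = M ->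
  exists c0 c1 c2 : R, forall u,
  `|f (M + u *: entry_dir R (i, j)) - (c0 + c1 * u + c2 * u ^+ 2)| <=
  8 * e ^+ 4 * `|u| ^+ 3.
Proof.
move=> sM; set D := entry_dir R (i, j).
exists (imtr (G M)), (- imtr (G M *m toC D *m G M)).
exists (imtr (G M *m toC D *m (G M *m toC D *m G M))) => u.
have sD : D^T = D by rewrite /D /entry_dir linearD/= !trmx_delta addrC.
set N := M + u *: D.
have sN : N^T = N by rewrite /N linearD/= linearZ/= sM sD.
pose Du := toC (u *: D).
have DuE : Du = u%:C%C *: toC D by rewrite /Du map_mxZ.
have GN : G N = G M - G M *m Du *m G N.
  have := resolvent_sub x eta0 sM sN.
  have -> : N - M = u *: D by rewrite /N addrAC subrr add0r.
  by rewrite -/Du => <-; rewrite opprB addrC subrK.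
have GN3 : G N = G M - G M *m Du *m G M + G M *m Du *m (G M *m Du *m G M)
    - G M *m Du *m (G M *m Du *m (G M *m Du *m G N)).
  rewrite {1}GN [in X in _ - X = _]GN [in X in _ - (_ *m (_ - X)) = _]GN.
  have zE (V : zmodType) (X Y Z W : V) : X - (Y - (Z - W)) = X - Y + Z - W.
    by rewrite opprB [Z - W - Y]addrC !addrA.
  by rewrite !mulmxBr zE.
have rE : f N - (imtr (G M) + - imtr (G M *m toC D *m G M) * u
    + imtr (G M *m toC D *m (G M *m toC D *m G M)) * u ^+ 2) =
   - imtr (G M *m Du *m (G M *m Du *m (G M *m Du *m G N))).
  have -> : f N = imtr (G N) by rewrite /imtr /mxtrace Im_sum.
  rewrite mulNr.
  have -> : imtr (G M *m toC D *m G M) * u = imtr (G M *m Du *m G M).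
    by rewrite DuE -scalemxAr -scalemxAl imtrZ mulrC.
  have -> : imtr (G M *m toC D *m (G M *m toC D *m G M)) * u ^+ 2 =
            imtr (G M *m Du *m (G M *m Du *m G M)).
    rewrite DuE -!scalemxAr -!scalemxAl -!scalemxAr !imtrZ.
    by rewrite mulrC expr2 mulrA.
  rewrite {1}GN3 imtrB imtrD imtrB; ring.
rewrite rE normrN; apply: (le_trans (Im_cabs _)).
have -> : \tr (G M *m Du *m (G M *m Du *m (G M *m Du *m G N))) =
          \tr (1%:M *m Du *m (G M *m Du *m (G M *m Du *m (G N *m G M)))).
  exact: mxtrace_rotate.
set L := G N *m G M.
have hL k l : cabs (L k l) <= e ^+ 2 by exact: cabs_mulmx_resolvent.
have hG k l : cabs (G M k l) <= e by exact: cabs_resolvent.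
set Z := G M *m Du *m L.
have hZ k l : cabs (Z k l) <= `|u| * (2 * (e * e ^+ 2)).
  by rewrite /Z /Du mulmx_entry_dir; exact: cabs_lin_comb.
set Y := G M *m Du *m Z.
have hY k l : cabs (Y k l) <= `|u| * (2 * (e * (`|u| * (2 * (e * e ^+ 2))))).
  by rewrite /Y /Du mulmx_entry_dir; exact: cabs_lin_comb.
have -> : \tr (1%:M *m Du *m Y) = u%:C%C * (1 * Y j i + 1 * Y i j).
  clearbody Y; rewrite /mxtrace; under eq_bigr => k _ do rewrite /Du mulmx_entry_dir !mxE.
  rewrite -mulr_sumr big_split/= (bigD1 i)//= big1 ?addr0.
    rewrite (bigD1 j)//= big1 ?addr0 ?eqxx//.
    by move=> k /negbTE ->; rewrite mul0r.
  by move=> k /negbTE ->; rewrite mul0r.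
have c1 : cabs (1 : R[i]) <= 1 by have := cabsR (1 : R); rewrite normr1 => ->.
apply: (le_trans (cabs_lin_comb _ c1 c1 (hY _ _) (hY _ _))).
by rewrite le_eqVlt; apply/orP; left; apply/eqP; ring.
Qed.

Variables (a : R) (p : 'I_n -> 'I_n -> R).
Hypotheses (a0 : 0 <= a) (p01 : forall i j, 0 <= p i j <= 1).
Local Notation E := (bernoulli_mean (upper_prob p)).

(** Interpolates between the centered matrix (s = 1) and its opposite (s = -1), one sign at a
    time. *)
Definition signed_mx (s : T -> R) (b : {ffun T -> bool}) : 'M[R]_n :=
  symmetric_mx (fun t => s t * (a * ((b t)%:R - upper_prob p t))).

(* A centered entry and its opposite have the same first two moments, so only the
   cubic Taylor remainder contributes. *)
Lemma mean_sign_flip (s s' : T -> R) t : s t = 1 -> s' t = -1 ->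
  (forall r, r != t -> s r = s' r) ->
  `|E (fun b => f (signed_mx s b)) - E (fun b => f (signed_mx s' b))| <=
  16 * e ^+ 4 * a ^+ 3 * upper_prob p t.
Proof.
move=> st s't ss'; have [tlt|tge] := boolP (t.1 < t.2)%N; last first.
  have -> : signed_mx s = signed_mx s'.
    apply/funext => b; apply/matrixP => i j; rewrite !mxE.
    case: ltngtP => // ij; rewrite ss'//; apply: contraNneq tge => <-//.
  rewrite subrr normr0; case/andP: (upper_prob01 p01 t) => q0 _.
  by apply: mulr_ge0 => //; rewrite !mulr_ge0// ?exprn_ge0// ltW.
rewrite -bernoulli_meanB (bernoulli_mean_update _ _ t).
set q := upper_prob p t; have /andP[q0 q1] : 0 <= q <= 1 by exact: upper_prob01.
(* The matrix with coordinate t erased, common to both sides and unaffected by updates at t: the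
   base point of the Taylor expansion. *)
pose s0 r := if r == t then 0 else s r.
have sE c b y : (forall r, r != t -> c r = s r) ->
    signed_mx c (update b t y) = signed_mx s0 b + (c t * (a * (y%:R - q))) *: entry_dir R t.
  move=> cs; apply/eqP; rewrite addrC -subr_eq; apply/eqP.
  rewrite (@symmetric_mxB _ _ _ _ t)//; last first.
    by move=> r rt; rewrite ffunE /s0 (negbTE rt) cs.
  by rewrite ffunE /s0 eqxx mul0r subr0.
have stepb b : `|q * (f (signed_mx s (update b t true)) - f (signed_mx s' (update b t true)))
   + (1 - q) * (f (signed_mx s (update b t false)) - f (signed_mx s' (update b t false)))|
   <= 16 * e ^+ 4 * a ^+ 3 * q.
  have s's r : r != t -> s' r = s r by move=> rt; rewrite ss'.
  rewrite !sE// st s't.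
  have sM : (signed_mx s0 b)^T = signed_mx s0 b by exact: symmetric_mx_tr.
  have tE : entry_dir R t = entry_dir R (t.1, t.2) by case: (t).
  have [c0 [c1 [c2 h]]] := Im_trace_resolvent_taylor t.1 t.2 sM.
  rewrite tE; set M := signed_mx s0 b in h *; set D := entry_dir R _ in h *.
  (* The even coefficients c0 and c2 cancel between u and - u. The linear term disappears on
     averaging over the bit at t, since a centered entry has mean zero. *)
  have hh u : `|f (M + (1 * u) *: D) - f (M + (-1 * u) *: D) - 2 * c1 * u| <=
      16 * e ^+ 4 * `|u| ^+ 3.
    rewrite mul1r mulN1r.
    have := lerD (h u) (h (- u)); rewrite normrN => hu.
    have -> : 16 * e ^+ 4 * `|u| ^+ 3 = 8 * e ^+ 4 * `|u| ^+ 3 + 8 * e ^+ 4 * `|u| ^+ 3 by ring.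
    apply: le_trans hu; apply: le_trans (ler_normB _ _).
    by rewrite le_eqVlt; apply/orP; left; apply/eqP; congr `|_|; ring.
  have h1 := hh (a * (true%:R - q)); have h0 := hh (a * (false%:R - q)).
  move: h1 h0; set X1 := _ - f _; set X0 := _ - f _ => h1 h0.
  have -> : q * X1 + (1 - q) * X0 = q * (X1 - 2 * c1 * (a * (true%:R - q)))
      + (1 - q) * (X0 - 2 * c1 * (a * (false%:R - q))) by rewrite /=; ring.
  apply: (le_trans (ler_normD _ _)); rewrite !normrM.
  rewrite (ger0_norm q0) (ger0_norm (_ : 0 <= 1 - q)) ?subr_ge0//.
  have q1' : 0 <= 1 - q by rewrite subr_ge0.
  apply: (le_trans (lerD (ler_wpM2l q0 h1) (ler_wpM2l q1' h0))).
  rewrite /= sub0r mulrN normrN !normrM !(ger0_norm a0) (ger0_norm q0) (ger0_norm q1').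
  (* The third absolute moment of the centered entry is at most a ^+ 3 * q. *)
  rewrite -subr_ge0.
  have -> : 16 * e ^+ 4 * a ^+ 3 * q -
     (q * (16 * e ^+ 4 * (a * (1 - q)) ^+ 3) + (1 - q) * (16 * e ^+ 4 * (a * q) ^+ 3)) =
     16 * e ^+ 4 * a ^+ 3 * q * (1 - (1 - q) * ((1 - q) ^+ 2 + q ^+ 2)) by ring.
  apply: mulr_ge0; first by rewrite !mulr_ge0// ?exprn_ge0// ltW.
  rewrite subr_ge0; apply: mulr_ile1 => //.
  - by rewrite addr_ge0 ?sqr_ge0.
  - by rewrite gerBl.
  - have -> : (1 - q) ^+ 2 + q ^+ 2 = 1 - 2 * (q * (1 - q)) by ring.
    by rewrite gerBl mulr_ge0 ?mulr_ge0.
rewrite ler_norml; apply/andP; split.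
- rewrite -[leLHS](bernoulli_mean_cst (upper_prob p)); apply: ler_bernoulli_mean => [|b].
    exact: upper_prob01.
  by have := stepb b; rewrite ler_norml => /andP[].
- rewrite -[leRHS](bernoulli_mean_cst (upper_prob p)); apply: ler_bernoulli_mean => [|b].
    exact: upper_prob01.
  by have := stepb b; rewrite ler_norml => /andP[].
Qed.

(** Telescoping over all coordinates leaves n^-1 * a ^+ 3 times the sum of the p_ij, that is a *
    [edge_density]; the spare factor a = c_N^(-1/2) makes it vanish in the limit. *)
Lemma mean_centered_opp :
  `|E (fun b => mean_Im_resolvent x eta (centered_mx a p b)) -
    E (fun b => mean_Im_resolvent x eta (- centered_mx a p b))| <=
  16 * e ^+ 4 * a * edge_density a p.
Proof.
pose sg (r : seq T) t : R := if t \in r then -1 else 1.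
have flips (r : seq T) : uniq r ->
    `|E (fun b => f (signed_mx (sg [::]) b)) - E (fun b => f (signed_mx (sg r) b))| <=
    16 * e ^+ 4 * a ^+ 3 * \sum_(t <- r) upper_prob p t.
  elim: r => [_|t r IH /= /andP[tr ur]]; first by rewrite big_nil subrr normr0 mulr0.
  have step : `|E (fun b => f (signed_mx (sg r) b)) -
      E (fun b => f (signed_mx (sg (t :: r)) b))| <= 16 * e ^+ 4 * a ^+ 3 * upper_prob p t.
    apply: mean_sign_flip; rewrite /sg ?(negbTE tr) ?mem_head// => w wt.
    by rewrite in_cons (negbTE wt).
  rewrite big_cons mulrDr [leRHS]addrC; apply: le_trans (lerD (IH ur) step).
  exact: ler_distD.
have := flips (enum {: T}) (enum_uniq _).
have -> : signed_mx (sg [::]) = centered_mx a p.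
  by apply/funext => b; congr symmetric_mx; apply/funext => t; rewrite /sg mul1r.
have -> : signed_mx (sg (enum {: T})) = fun b => - centered_mx a p b.
  apply/funext => b; apply/matrixP => i j; rewrite !mxE /sg !mem_enum !mulN1r.
  by case: ltngtP => // _; rewrite oppr0.
rewrite big_enum/= => h.
rewrite !bernoulli_meanZ -mulrBr normrM ger0_norm ?invr_ge0//.
have -> : 16 * e ^+ 4 * a * edge_density a p =
  n%:R^-1 * (16 * e ^+ 4 * a ^+ 3 * \sum_i \sum_(j | j != i) p i j).
  by rewrite /edge_density; ring.
apply: ler_wpM2l; first by rewrite invr_ge0.
apply: (le_trans h); apply: ler_wpM2l.
  by rewrite !mulr_ge0// ?exprn_ge0// ltW.
rewrite -(pair_bigA _ (fun i j => upper_prob p (i, j)))/=.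
apply: ler_sum => i _; rewrite (bigD1 i)//= {1}/upper_prob ltnn add0r.
apply: ler_sum => j _; rewrite /upper_prob /=; case: ifP => // _.
by case/andP: (p01 i j).
Qed.

(* The resolvent identity bounds the difference by the product of two
   Hilbert-Schmidt norms, split by AM-GM with a free parameter del. *)
Lemma Im_trace_resolventB A B (del : R) : A^T = A -> B^T = B -> 0 < del ->
  `|f A - f B| <= del / 2 * (n%:R * e ^+ 2) +
    (2 * del)^-1 * (e ^+ 2 * \sum_i \sum_j (B i j - A i j) ^+ 2).
Proof.
move=> sA sB d0.
pose D := toC (B - A).
have sD i j : D i j = D j i.
  by rewrite !mxE; congr (_ (_ - _)); [rewrite -[in LHS]sB mxE|rewrite -[in LHS]sA mxE].
(* The trace of G_A D G_B, arranged as a pairing of G_A with the images under G_B of the columns of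
   D, to which [resolvent_contract] applies. *)
have -> : f A - f B = complex.Im (\sum_i \sum_j G A j i * (G B *m col j D) i 0).
  rewrite -sumrB Im_sum; apply: eq_bigr => i _.
  rewrite -ImB; congr complex.Im.
  have -> : G A i i - G B i i = (G A - G B) i i by rewrite !mxE.
  rewrite resolvent_sub// -mulmxA mxE; apply: eq_bigr => j _.
  rewrite resolvent_sym//; congr (_ * _); rewrite -/D !mxE.
  by apply: eq_bigr => k _; rewrite [col _ _ _ _]mxE mulrC resolvent_sym// sD.
apply: (le_trans (Im_cabs _)); apply: (le_trans (cabs_sum _ _ _)).
apply: (@le_trans _ _ (\sum_i \sum_j (del / 2 * cabs (G A j i) ^+ 2 +
   (2 * del)^-1 * cabs ((G B *m col j D) i 0) ^+ 2))).
  apply: ler_sum => i _; apply: (le_trans (cabs_sum _ _ _)).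
  apply: ler_sum => j _; rewrite cabsM; set y := cabs _; set z := cabs _.
  rewrite -subr_ge0.
  have -> : del / 2 * y ^+ 2 + (2 * del)^-1 * z ^+ 2 - y * z =
     (2 * del)^-1 * (del * y - z) ^+ 2 by field; exact: lt0r_neq0.
  by rewrite mulr_ge0 ?sqr_ge0// invr_ge0 mulr_ge0// ltW.
under eq_bigr => i _ do rewrite big_split/= -!mulr_sumr.
rewrite big_split/= -!mulr_sumr; apply: lerD.
  apply: ler_wpM2l; first by rewrite divr_ge0 ?ltW.
  have -> : n%:R * e ^+ 2 = \sum_(i < n) e ^+ 2.
    by rewrite sumr_const card_ord mulr_natl.
  by apply: ler_sum => i _; rewrite exprVn sum_sqr_resolvent.
apply: ler_wpM2l; first by rewrite invr_ge0 mulr_ge0// ltW.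
rewrite exchange_big/= mulr_sumr; apply: ler_sum => j _.
apply: (le_trans (resolvent_contract x eta0 _ sB)); rewrite exprVn.
apply: ler_wpM2l; first by rewrite invr_ge0 exprn_ge0// ltW.
apply: ler_sum => i _; rewrite !mxE cabsR.
rewrite -normrX ger0_norm ?sqr_ge0//.
by rewrite -[in leLHS]sB -[in leLHS]sA !mxE.
Qed.

Definition adjacency_mx (b : {ffun T -> bool}) : 'M[R]_n :=
  symmetric_mx (fun t => a * (b t)%:R).

Hypothesis psym : forall i j, p i j = p j i.

(** Valid for each configuration: the two matrices differ by the deterministic matrix of
    off-diagonal entries a * p_ij, whose normalized squared norm is [sqr_density]. *)
Lemma mean_Im_centering (b : {ffun T -> bool}) (del : R) : (0 < n)%N -> 0 < del ->
  `|mean_Im_resolvent x eta (adjacency_mx b) -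
    mean_Im_resolvent x eta (centered_mx a p b)| <=
  del / 2 * e ^+ 2 + (2 * del)^-1 * (e ^+ 2 * sqr_density a p).
Proof.
move=> n0 d0; rewrite /mean_Im_resolvent -mulrBr normrM ger0_norm ?invr_ge0//.
have nu : n%:R != 0 :> R by rewrite pnatr_eq0 -lt0n.
have := @Im_trace_resolventB (adjacency_mx b) (centered_mx a p b) del
  (symmetric_mx_tr _) (symmetric_mx_tr _) d0.
rewrite -(ler_pM2l (x := n%:R^-1)) ?invr_gt0 ?ltr0n// => /le_trans; apply.
rewrite le_eqVlt; apply/orP; left; apply/eqP.
have -> : \sum_i \sum_j (centered_mx a p b i j - adjacency_mx b i j) ^+ 2 =
   a ^+ 2 * \sum_i \sum_(j | j != i) p i j ^+ 2.
  rewrite mulr_sumr; apply: eq_bigr => i _.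
  rewrite (bigD1 i)//= !mxE ltnn subrr expr0n add0r mulr_sumr.
  apply: eq_bigr => j ji; rewrite !mxE /upper_prob.
  case: (ltngtP i j) ji => [ij|ij|/val_inj ->]; rewrite ?eqxx//= => _.
    by ring.
  by rewrite psym; ring.
rewrite /sqr_density mulrDr; congr (_ + _).
  by rewrite mulrCA [n%:R^-1 * _]mulrA mulVf// mul1r.
by ring.
Qed.

End lindeberg.

(** * Bounds conditional on the weights *)

Section conditional_estimates.
Variables (R : realType) (n : nat) (x eta a : R) (p : 'I_n -> 'I_n -> R).
Hypotheses (eta0 : 0 < eta) (a01 : 0 <= a <= 1).
Hypotheses (p01 : forall i j, 0 <= p i j <= 1) (psym : forall i j, p i j = p j i).
Local Notation e := eta^-1.
Local Notation E := (bernoulli_mean (upper_prob p)).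

Let a0 : 0 <= a. Proof. by case/andP: a01. Qed.
Let e0 : 0 < e. Proof. by rewrite invr_gt0. Qed.

Lemma edge_density_ge0 : 0 <= edge_density a p.
Proof.
rewrite !mulr_ge0// ?invr_ge0// sumr_ge0// => i _.
by apply: sumr_ge0 => j _; case/andP: (p01 i j).
Qed.

(** The cubic inequality reads c m^3 <= m + err. If m exceeds 1 + 2 / c, then c m >= 2 and m >= 1,
    so that c m^3 >= 2 m and m <= err. The part 1 + 2 / c involves neither x nor eta. *)
Lemma mean_Im_centered_le (c : R) : (0 < n)%N -> 0 < c ->
  (forall i j, i != j -> c / n%:R <= a ^+ 2 * p i j) ->
  E (fun b => mean_Im_resolvent x eta (centered_mx a p b)) <=
  1 + 2 / c + (6 * e ^+ 4 + 24 * e ^+ 5) * a * edge_density a p +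
  6 * e ^+ 3 * a ^+ 2 + c * e ^+ 3 / n%:R + e ^+ 3 * sqr_density a p.
Proof.
move=> n0 c0 cp.
have X0 b : 0 <= mean_Im_resolvent x eta (centered_mx a p b).
  by apply: mean_Im_resolvent_ge0 => //; exact: centered_mx_tr.
have h3 := bernoulli_mean_exp3 (upper_prob01 p01) X0.
have m0 := bernoulli_mean_ge0 (upper_prob01 p01) X0.
have := mean_cubic_le x eta0 a0 p01 psym n0 (ltW c0) cp.
set m := E _ in h3 m0 *; set X3 := E _ in h3 *.
set d1 := edge_density a p; set d2 := sqr_density a p.
set r := c * e ^+ 3 / n%:R.
(* Since a <= 1, the quadratic term in a is absorbed into a linear one. *)
have hk : (3 * (2 * a * e ^+ 2) * e ^+ 2 + 6 * e * (2 * a * e ^+ 2) ^+ 2) * d1 <=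
    (6 * e ^+ 4 + 24 * e ^+ 5) * a * d1.
  apply: ler_wpM2r; first exact: edge_density_ge0.
  rewrite -subr_ge0.
  have -> : (6 * e ^+ 4 + 24 * e ^+ 5) * a -
    (3 * (2 * a * e ^+ 2) * e ^+ 2 + 6 * e * (2 * a * e ^+ 2) ^+ 2) =
    24 * e ^+ 5 * a * (1 - a) by ring.
  by case/andP: a01 => _ a1; rewrite !mulr_ge0 ?exprn_ge0 ?subr_ge0// ltW.
move=> h; have {}h := le_trans (ler_wpM2l (ltW c0) h3) h.
set err := (6 * e ^+ 4 + 24 * e ^+ 5) * a * d1 + 6 * e ^+ 3 * a ^+ 2 + r + e ^+ 3 * d2.
have hm : c * m ^+ 3 <= m + err by rewrite /err; lra.
suff : m <= 1 + 2 / c + err by rewrite /err; lra.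
have d20 : 0 <= d2.
  rewrite !mulr_ge0// ?invr_ge0// sumr_ge0// => i _.
  by apply: sumr_ge0 => j _; exact: sqr_ge0.
have err0 : 0 <= err.
  have d10 := edge_density_ge0.
  have en k : 0 <= e ^+ k by rewrite exprn_ge0// ltW.
  have r0 : 0 <= r by rewrite divr_ge0// mulr_ge0// ltW.
  have K0 : 0 <= 6 * e ^+ 4 + 24 * e ^+ 5 by rewrite addr_ge0// mulr_ge0.
  rewrite /err; apply: addr_ge0; last by rewrite mulr_ge0.
  apply: addr_ge0 => //; apply: addr_ge0.
    by apply: mulr_ge0; [exact: mulr_ge0 | exact: d10].
  by apply: mulr_ge0; [exact: mulr_ge0 | exact: sqr_ge0].
have [mle|mgt] := leP m (1 + 2 / c); first by rewrite (le_trans mle)// lerDl.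
have cm : 2 <= c * m.
  have := ltW mgt; rewrite -(ler_pM2l c0) mulrDr mulrCA mulfV ?lt0r_neq0// !mulr1.
  by apply: le_trans; rewrite lerDr ltW.
have m1 : 1 <= m by apply: le_trans (ltW mgt); rewrite lerDl divr_ge0 ?ltW.
have : 2 * m <= c * m ^+ 3.
  have -> : c * m ^+ 3 = (c * m) * m * m by ring.
  apply: ler_wpM2r => //; rewrite -[leLHS]mulr1; exact: ler_pM.
have : 0 <= 2 / c by rewrite divr_ge0 ?ltW.
lra.
Qed.

End conditional_estimates.

Section centering.
Variables (R : realType) (n : nat) (x eta a : R) (p : 'I_n -> 'I_n -> R).
Hypotheses (eta0 : 0 < eta).
Hypotheses (p01 : forall i j, 0 <= p i j <= 1) (psym : forall i j, p i j = p j i).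
Local Notation e := eta^-1.
Local Notation E := (bernoulli_mean (upper_prob p)).

Lemma mean_Im_adjacency_dist (del : R) : (0 < n)%N -> 0 < del ->
  `|E (fun b => mean_Im_resolvent x eta (adjacency_mx a b)) -
    E (fun b => mean_Im_resolvent x eta (centered_mx a p b))| <=
  del / 2 * e ^+ 2 + (2 * del)^-1 * (e ^+ 2 * sqr_density a p).
Proof.
move=> n0 d0; rewrite -bernoulli_meanB ler_norml.
have h := mean_Im_centering x eta0 a psym _ n0 d0.
apply/andP; split; [rewrite -[leLHS](bernoulli_mean_cst (upper_prob p))|
  rewrite -[leRHS](bernoulli_mean_cst (upper_prob p))];
  (apply: ler_bernoulli_mean => [|b]; [exact: upper_prob01|]);
  by have := h b; rewrite ler_norml => /andP[].
Qed.

End centering.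

Lemma ler_chain_dist (R : realDomainType) (y1 y2 z1 z2 k l : R) :
  `|y1 - z1| <= k -> `|y2 - z2| <= k -> `|z1 - z2| <= l -> y1 <= y2 + l + (k + k).
Proof. by rewrite !ler_norml => /andP[? ?] /andP[? ?] /andP[? ?]; lra. Qed.

Section reflection.
Variables (R : realType) (n : nat) (x eta a : R) (p : 'I_n -> 'I_n -> R).
Hypotheses (eta0 : 0 < eta) (a0 : 0 <= a).
Hypotheses (p01 : forall i j, 0 <= p i j <= 1) (psym : forall i j, p i j = p j i).
Local Notation e := eta^-1.
Local Notation E := (bernoulli_mean (upper_prob p)).

Lemma mean_Im_resolventN (M : 'M[R]_n) : M^T = M ->
  mean_Im_resolvent x eta (- M) = mean_Im_resolvent (- x) eta M.
Proof.
move=> sM; congr (_ * _); apply: eq_bigr => i _.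
by rewrite resolventN// ImN ImJ opprK.
Qed.

Lemma mean_Im_adjacency_reflect (del : R) : (0 < n)%N -> 0 < del ->
  E (fun b => mean_Im_resolvent x eta (adjacency_mx a b)) <=
  E (fun b => mean_Im_resolvent (- x) eta (adjacency_mx a b)) +
  16 * e ^+ 4 * a * edge_density a p +
  (del * e ^+ 2 + del^-1 * (e ^+ 2 * sqr_density a p)).
Proof.
move=> n0 d0.
have := mean_centered_opp x eta0 a0 p01.
have -> : (fun b => mean_Im_resolvent x eta (- centered_mx a p b)) =
          fun b => mean_Im_resolvent (- x) eta (centered_mx a p b).
  by apply/funext => b; rewrite mean_Im_resolventN// centered_mx_tr.
have h1 := mean_Im_adjacency_dist x a eta0 p01 psym n0 d0.
have h2 := mean_Im_adjacency_dist (- x) a eta0 p01 psym n0 d0.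
move=> h3; apply: le_trans (ler_chain_dist h1 h2 h3) _.
rewrite lerD2l le_eqVlt; apply/orP; left; apply/eqP; field.
by rewrite !lt0r_neq0.
Qed.

End reflection.

(** * Size of the scaling constant *)

Section scaling_asymptotics.
Variable R : realType.
Implicit Types (x y r g beta : R) (d N : nat).

Lemma ler_powRN x y r : 0 <= r -> 0 < x -> x <= y -> y `^ (- r) <= x `^ (- r).
Proof.
move=> r0 x0 xy; have y0 := lt_le_trans x0 xy.
by rewrite !powRN lef_pV2 ?posrE ?powR_gt0// ge0_ler_powR ?nnegrE// ltW.
Qed.

Lemma powR_le_affine x r : 0 <= x -> 0 < r < 1 -> x `^ r <= r * x + (1 - r).
Proof.
move=> x0 /andP[r0 r1].
have r1' : 0 < 1 - r by rewrite subr_gt0.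
have := @conjugate_powR R (x `^ r) 1 r^-1 (1 - r)^-1 (powR_ge0 _ _) ler01.
rewrite !invr_gt0 !invrK => /(_ r0 r1'); rewrite addrC subrK => /(_ erefl).
by rewrite mulr1 -powRrM mulfV ?lt0r_neq0// powRr1// powR1 mul1r mulrC.
Qed.

(** Replaces the comparison with an integral. The induction step from m - 1 to m is the concavity of
    the power 1 - g, given by [powR_le_affine] at (m - 1) / m. *)
Lemma sum_powRN_le g N : 0 < g < 1 ->
  \sum_(k < N) k.+1%:R `^ (- g) <= N%:R `^ (1 - g) / (1 - g).
Proof.
move=> /andP[g0 g1]; have g1' : 0 < 1 - g by rewrite subr_gt0.
elim: N => [|N IH]; first by rewrite big_ord0 divr_ge0 ?powR_ge0// ltW.
rewrite big_ord_recr/=; apply: (le_trans (lerD IH (lexx _))).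
set m : R := N.+1%:R; have m0 : 0 < m by rewrite ltr0n.
rewrite -lerBrDl -mulrBl ler_pdivlMr// mulrC.
have -> : m `^ (1 - g) = m * m `^ (- g) by rewrite powRD ?(lt0r_neq0 m0) ?implybT// powRr1// ltW.
have -> : N%:R `^ (1 - g) = m `^ (1 - g) * (N%:R / m) `^ (1 - g).
  by rewrite -powRM ?divr_ge0 ?(ltW m0)// mulrC divfK// lt0r_neq0.
have h : (N%:R / m) `^ (1 - g) <= 1 - (1 - g) / m.
  have gg : 0 < 1 - g < 1 by rewrite g1' gtrBl g0.
  apply: (le_trans (powR_le_affine (divr_ge0 (ler0n _ _) (ltW m0)) gg)).
  have -> : N%:R = m - 1 by rewrite /m -natr1 addrK.
  by rewrite le_eqVlt; apply/orP; left; apply/eqP; field; exact: lt0r_neq0.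
have -> : m `^ (1 - g) = m * m `^ (- g) by rewrite powRD ?(lt0r_neq0 m0) ?implybT// powRr1// ltW.
have P0 := powR_ge0 m (- g); set P := m `^ (- g) in P0 *.
have mP : 0 <= m * P by rewrite mulr_ge0// ltW.
have := ler_wpM2l mP h; rewrite mulrBr mulr1.
have -> : m * P * ((1 - g) / m) = (1 - g) * P by field; exact: lt0r_neq0.
lra.
Qed.

(** A given distance to u is attained at most once on either side. *)
Lemma sum_dist_le N (u : 'I_N) (F : nat -> R) : (forall k, 0 <= F k) ->
  \sum_(v < N) F `|u - v|%N <= 2 * \sum_(k < N) F k.
Proof.
move=> F0; rewrite -(big_mkord xpredT (fun v => F `|u - v|%N)).
rewrite -(big_mkord xpredT F) mulr_natl mulr2n.
rewrite (@big_cat_nat _ _ _ u)//=; last exact: ltnW.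
have sub m1 m2 : (m1 <= m2 <= N)%N -> \sum_(m1 <= k < m2) F k <= \sum_(0 <= k < N) F k.
  move=> /andP[m12 m2N]; rewrite (@big_cat_nat _ _ _ m2 0 N)//=.
  rewrite (@big_cat_nat _ _ _ m1 0 m2)//= -addrA addrCA lerDl.
  by rewrite addr_ge0// sumr_ge0.
apply: lerD.
- rewrite big_nat_rev/= add0n.
  have -> : \sum_(0 <= i < u) F `|u - (u - i.+1)%N|%N = \sum_(1 <= i < u.+1) F i.
    rewrite big_add1/=; apply: eq_big_nat => i /andP[_ iu].
    by rewrite distnEl ?leq_subr// subKn.
  by apply: sub; rewrite /= ltn_ord.
- rewrite -{1}(add0n (nat_of_ord u)) big_addn.
  have -> : \sum_(0 <= i < N - u) F `|u - (i + u)%N|%N = \sum_(0 <= i < N - u) F i.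
    by apply: eq_big_nat => i _; rewrite distnEr ?leq_addl// addnK.
  by apply: sub; rewrite leq_subr.
Qed.

Definition coord_dist (N : nat) (u v : 'I_N) : nat := minn `|u - v|%N (N - `|u - v|%N).

(** The torus minimum is handled by summing over both of its possible values. The constant is 6 = 2
    * (2 + 1): 2 from the two sides of u, and a further 2 in one of the two sums to compare max(1,
    k) with k + 1. *)
Lemma sum_coord_dist_le g N (u : 'I_N) : 0 < g < 1 ->
  \sum_(v < N) (maxn 1 (coord_dist u v))%:R `^ (- g) <=
  6 / (1 - g) * N%:R `^ (1 - g) :> R.
Proof.
move=> g01; have /andP[g0 g1] := g01.
pose F k : R := (maxn 1 k)%:R `^ (- g) + (maxn 1 (N - k))%:R `^ (- g).
have F0 k : 0 <= F k by rewrite addr_ge0 ?powR_ge0.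
apply: (@le_trans _ _ (\sum_(v < N) F `|u - v|%N)).
  apply: ler_sum => v _; rewrite /F /coord_dist /minn.
  by case: ifP => _; rewrite ?lerDl ?lerDr powR_ge0.
apply: (le_trans (sum_dist_le u F0)).
have S1 : \sum_(k < N) (maxn 1 k)%:R `^ (- g) <= 2 * \sum_(k < N) k.+1%:R `^ (- g) :> R.
  rewrite mulr_sumr; apply: ler_sum => k _.
  have : (k.+1%:R : R) <= 2 * (maxn 1 k)%:R.
    rewrite -natrM ler_nat mul2n -addnn -addn1 addnC.
    by apply: leq_add; [exact: leq_maxl | exact: leq_maxr].
  move/(ler_powRN (ltW g0) (ltr0Sn _ _)).
  rewrite powRM// => h.
  have : 2^-1 * (maxn 1 k)%:R `^ (- g) <= k.+1%:R `^ (- g) :> R.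
    apply: le_trans h; apply: ler_wpM2r; first exact: powR_ge0.
    rewrite powRN lef_pV2 ?posrE ?powR_gt0//.
    by apply: ler1_powR; rewrite ?ler1n ?ltW.
  by rewrite -ler_pdivrMl// mulrC => h2; rewrite mulrC.
have S2 : \sum_(k < N) (maxn 1 (N - k))%:R `^ (- g) = \sum_(k < N) k.+1%:R `^ (- g) :> R.
  rewrite (reindex_inj rev_ord_inj)/=; apply: eq_bigr => k _.
  by rewrite subKn ?ltn_ord// (maxn_idPr _).
rewrite /F big_split/= S2.
have h := sum_powRN_le N g01.
have -> : 6 / (1 - g) * N%:R `^ (1 - g) = 2 * (3 * (N%:R `^ (1 - g) / (1 - g))) by ring.
lra.
Qed.

Section torus.
Variables (d N : nat).
Implicit Types i j : vertex d N.

Lemma torus_distE i j : torus_dist i j = (\sum_(l < d) coord_dist (i l) (j l))%N.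
Proof. by []. Qed.

Lemma torus_dist_sym i j : torus_dist i j = torus_dist j i.
Proof. by rewrite !torus_distE; apply: eq_bigr => l _; rewrite /coord_dist distnC. Qed.

Lemma torus_dist_gt0 i j : i != j -> (0 < torus_dist i j)%N.
Proof.
move=> ij; have [l il] : exists l, i l != j l.
  apply/existsP; apply: contraNT ij; rewrite negb_exists => /forallP h.
  by apply/eqP/ffunP => l; apply/eqP; move: (h l); rewrite negbK.
rewrite torus_distE (bigD1 l)//= ltn_addr// /coord_dist leq_min lt0n distn_eq0 il/=.
rewrite subn_gt0; case: (leqP (i l) (j l)) => h.
  by rewrite distnEr//; apply: leq_ltn_trans (leq_subr _ _) (ltn_ord _).
by rewrite distnEl ?(ltnW h)//; apply: leq_ltn_trans (leq_subr _ _) (ltn_ord _).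
Qed.

Lemma torus_dist_le i j : (torus_dist i j <= d * N)%N.
Proof.
rewrite torus_distE -[X in (_ <= X * N)%N]card_ord -sum_nat_const.
by apply: leq_sum => l _; rewrite /coord_dist (leq_trans (geq_minr _ _))// leq_subr.
Qed.

Lemma card_vertex : #|vertex d N| = (N ^ d)%N.
Proof. by rewrite card_ffun !card_ord. Qed.

(* ||i - j|| dominates each of the d factors max(1, |i_l - j_l|), hence their
   geometric mean, so that the sum over j factorizes over coordinates. *)
Lemma sum_torus_dist_le beta i : (0 < d)%N -> 0 < beta < d%:R ->
  \sum_(j | j != i) (torus_dist i j)%:R `^ (- beta) <=
  (6 / (1 - beta / d%:R)) ^+ d * N%:R `^ (d%:R - beta).
Proof.
move=> d0 /andP[b0 bd]; have d0' : 0 < d%:R :> R by rewrite ltr0n.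
set g := beta / d%:R.
have g01 : 0 < g < 1 by rewrite /g divr_gt0//= ltr_pdivrMr// mul1r.
have gd : g * d%:R = beta by rewrite /g divfK// lt0r_neq0.
pose F l (y : 'I_N) : R := (maxn 1 (coord_dist (i l) y))%:R `^ (- g).
apply: (@le_trans _ _ (\sum_(j : vertex d N) \prod_l F l (j l))).
  rewrite [leRHS](bigD1 i)//= -[leLHS]add0r; apply: lerD.
    by apply: prodr_ge0 => l _; exact: powR_ge0.
  apply: ler_sum => j ji.
  have r0 : (0 < torus_dist i j)%N by rewrite torus_dist_gt0// eq_sym.
  have -> : (torus_dist i j)%:R `^ (- beta) = \prod_(l < d) (torus_dist i j)%:R `^ (- g) :> R.
    by rewrite prodr_const card_ord -powR_mulrn ?powR_ge0// -powRrM mulNr gd.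
  apply: ler_prod => l _; rewrite powR_ge0/=.
  have m0 : (0 < maxn 1 (coord_dist (i l) (j l)))%N by rewrite leq_max.
  apply: ler_powRN; [by case/andP: g01 => /ltW | by rewrite ltr0n |].
  rewrite ler_nat geq_max r0/= torus_distE (bigD1 l)//= leq_addr//.
rewrite -(bigA_distr_bigA F)/=.
have -> : (6 / (1 - g)) ^+ d * N%:R `^ (d%:R - beta) =
    \prod_(l < d) (6 / (1 - g) * N%:R `^ (1 - g)).
  rewrite prodr_const card_ord [RHS]exprMn; congr (_ * _).
  by rewrite -powR_mulrn ?powR_ge0// -powRrM mulrBl mul1r gd.
apply: ler_prod => l _; rewrite sum_coord_dist_le// andbT.
by apply: sumr_ge0 => y _; exact: powR_ge0.
Qed.

Lemma scaling_le beta : (0 < d)%N -> 0 < beta < d%:R -> (0 < N)%N ->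
  scaling d N beta <= (6 / (1 - beta / d%:R)) ^+ d * N%:R `^ (d%:R - beta).
Proof.
move=> d0 b N0; rewrite /scaling.
have n0 : 0 < (N ^ d)%:R :> R by rewrite ltr0n expn_gt0 N0.
rewrite ler_pdivrMl// -card_vertex -sum1_card natr_sum mulr_suml.
apply: ler_sum => i _; rewrite mul1r; exact: sum_torus_dist_le.
Qed.

(** All distances are at most d N; the factor 1 / 2 pays for the excluded diagonal, as N ^ d - 1 >=
    N ^ d / 2. *)
Lemma scaling_ge beta : (0 < d)%N -> 0 <= beta -> (1 < N)%N ->
  2^-1 * d%:R `^ (- beta) * N%:R `^ (d%:R - beta) <= scaling d N beta.
Proof.
move=> d0 b0 N1; rewrite /scaling.
have N0 : (0 < N)%N := ltnW N1.
have N0' : 0 < N%:R :> R by rewrite ltr0n.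
have d0' : 0 < d%:R :> R by rewrite ltr0n.
have n0 : 0 < (N ^ d)%:R :> R by rewrite ltr0n expn_gt0 N0.
have n2 : (2 <= N ^ d)%N by rewrite (leq_trans N1)// -{1}(expn1 N) leq_exp2l.
rewrite ler_pdivlMl//.
apply: (@le_trans _ _ (\sum_(i : vertex d N) \sum_(j : vertex d N | j != i)
    (d * N)%:R `^ (- beta))).
  have -> : \sum_(i : vertex d N) \sum_(j : vertex d N | j != i) (d * N)%:R `^ (- beta)
    = (N ^ d)%:R * ((N ^ d).-1%:R * (d * N)%:R `^ (- beta)) :> R.
    under eq_bigr => i _.
      rewrite sumr_const -[_ *+ _]mulr_natl.
      have -> : #|[pred j : vertex d N | j != i]| = (N ^ d).-1.
        by rewrite (eq_card (B := predC1 i))// cardC1 card_vertex.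
      over.
    by rewrite sumr_const card_vertex -[LHS]mulr_natl.
  rewrite ler_pM2l//.
  have -> : 2^-1 * d%:R `^ (- beta) * N%:R `^ (d%:R - beta) =
     2^-1 * (N ^ d)%:R * (d * N)%:R `^ (- beta).
    rewrite natrM powRM// natrX powRD ?(lt0r_neq0 N0') ?implybT//.
    by rewrite powR_mulrn// [_ `^ (- beta) * _ `^ (- beta)]mulrC; ring.
  apply: ler_wpM2r; first exact: powR_ge0.
  rewrite mulrC ler_pdivrMr// mulrC -natrM ler_nat mul2n -addnn.
  by rewrite -{1}(prednK (ltnW n2)) -add1n leq_add2r -ltnS prednK// ltnW.
apply: ler_sum => i _; apply: ler_sum => j ji.
apply: ler_powRN => //; first by rewrite ltr0n torus_dist_gt0// eq_sym.
by rewrite ler_nat torus_dist_le.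
Qed.

End torus.

End scaling_asymptotics.

(** * Moments of the connection probabilities *)

Section pareto.
Variables (R : realType) (disp : measure_display) (Omega : measurableType disp).
Variable P : probability Omega R.

(** Independence identifies the law of the pair with the product of the two laws, by uniqueness of
    the product measure; Tonelli does the rest. *)
Lemma integral_indep (X Y : {RV P >-> R}) (f g : R -> \bar R) :
  (forall A B : set R, measurable A -> measurable B ->
     P (X @^-1` A `&` Y @^-1` B) = P (X @^-1` A) * P (Y @^-1` B))%E ->
  measurable_fun setT f -> measurable_fun setT g ->
  (forall x, 0 <= f x)%E -> (forall x, 0 <= g x)%E ->
  (\int[P]_w (f (X w) * g (Y w)) = \int[P]_w f (X w) * \int[P]_w g (Y w))%E.
Proof.
move=> XY mf mg f0 g0.
have mXY : measurable_fun setT (fun w => (X w, Y w)) by exact: measurable_fun_pair.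
pose Z : {RV P >-> (R * R)%type} := mfun_Sub (mem_set mXY).
have mh : measurable_fun setT (fun z : R * R => f z.1 * g z.2)%E.
  by apply: emeasurable_funM; apply: measurableT_comp.
have h0 (z : R * R) : (0 <= f z.1 * g z.2)%E by exact: mule_ge0.
have -> : (\int[P]_w (f (X w) * g (Y w)) =
           \int[distribution P Z]_z (f z.1 * g z.2))%E.
  by rewrite ge0_integral_distribution.
have -> : (\int[distribution P Z]_z (f z.1 * g z.2) =
  \int[(distribution P X \x distribution P Y)]_z (f z.1 * g z.2))%E.
  apply: eq_measure_integral => /= A mA _; apply/esym.
  by apply: product_measure_unique => // B C mB mC; exact: XY.
rewrite fubini_tonelli1//= /fubini_F/=.
under eq_integral => x _ do rewrite ge0_integralZl//.
rewrite ge0_integralZr//; last exact: integral_ge0.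
by rewrite !ge0_integral_distribution.
Qed.

Variables (tau : R) (X : {RV P >-> R}).
Hypothesis XP : forall t, ccdf X t = (if 1 <= t then t `^ (- (tau - 1)) else 1)%:E.

(* The geometric series obtained from the levels 2 ^ k < X <= 2 ^ k.+1. *)
Definition pareto_moment (tau a : R) : R := 1 + 2 `^ a / (1 - 2 `^ (a - (tau - 1))).

Lemma pareto_gt1 : P (X @^-1` `]1, +oo[) = 1%E.
Proof. by have := XP 1; rewrite lexx powR1. Qed.

Lemma pareto_moment_le (a : R) : 0 < a < tau - 1 ->
  (\int[P]_w (X w `^ a)%:E <= (pareto_moment tau a)%:E)%E.
Proof.
move=> /andP[a0 atau].
pose A k := X @^-1` `](2 ^+ k : R), +oo[.
have mA k : measurable (A k).
  by rewrite /A -[X in measurable X]setTI; apply: measurable_funPT.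
pose h k w : \bar R := ((2 `^ (k.+1%:R * a))%:E * (\1_(A k) w)%:E)%E.
have h0 k w : (0 <= h k w)%E by rewrite mule_ge0// lee_fin// powR_ge0.
have mind k : measurable_fun setT (fun w => (\1_(A k) w)%:E : \bar R).
  by apply/measurable_EFinP; exact: measurable_indic.
have mh k : measurable_fun setT (h k) by exact: measurable_funeM.
have bound w : ((X w `^ a)%:E <= 1 + \sum_(0 <= k <oo) h k w)%E.
  have s0 : (0 <= \sum_(0 <= k <oo) h k w)%E by exact: nneseries_ge0.
  have [X1|X1] := leP (X w) 1.
    have : X w `^ a <= 1.
      (* Pointwise X w may be negative; the power then has the default value 1. *)
      have [x0|x0] := ltP (X w) 0; first by rewrite lt0_powR1.
      have -> : 1 = 1 `^ a :> R by rewrite powR1.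
      by apply: ge0_ler_powR; rewrite ?nnegrE// ltW.
    by rewrite -lee_fin => /le_trans; apply; rewrite leeDl.
  have [k /andP[k1 k2]] : exists k, (2 ^+ k < X w <= 2 ^+ k.+1).
    have ex : exists k, X w <= 2 ^+ k.
      exists (Num.bound (X w)).
      have Xb : X w <= (Num.bound (X w))%:R.
        by rewrite ltW// archi_boundP// (le_trans ler01 (ltW X1)).
      by apply: (le_trans Xb); rewrite -natrX ler_nat ltnW// ltn_expl.
    case: (ex_minnP ex) => -[|m] mX mmin.
      by move: X1; rewrite ltNge mX.
    exists m; rewrite mX andbT ltNge; apply/negP => /mmin.
    by rewrite ltnn.
  apply: (@le_trans _ _ (h k w)).
    rewrite /h indicE mem_set/=; last by rewrite /A/= in_itv/= k1.
    rewrite mule1 lee_fin powRrM powR_mulrn//.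
    by apply: ge0_ler_powR; rewrite ?nnegrE ?exprn_ge0 ?(ltW a0)// (le_trans ler01 (ltW X1)).
  have := @nneseries_lim_ge R (h ^~ w) xpredT 0 k.+1 (fun n _ _ => h0 n w).
  rewrite big_nat_recr//= => hs; apply: (@le_trans _ _ (\sum_(0 <= k <oo) h k w)%E).
    by apply: le_trans hs; rewrite leeDr// sume_ge0.
  by rewrite leeDr.
have mX : measurable_fun setT (fun w => (X w `^ a)%:E).
  by apply/measurable_EFinP; apply: (measurableT_comp (measurable_powR _)).
apply: (@le_trans _ _ (\int[P]_w (1 + \sum_(0 <= k <oo) h k w))%E).
  apply: ge0_le_integral => //.
  - by move=> w _; rewrite lee_fin powR_ge0.
  - apply: emeasurable_funD => //; exact: ge0_emeasurable_sum.
rewrite ge0_integralD//; last 2 first.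
- by move=> w _; exact: nneseries_ge0.
- exact: ge0_emeasurable_sum.
rewrite integral_cst//= mul1e probability_setT integral_nneseries//.
set q : R := 2 `^ (a - (tau - 1)).
have q0 : 0 < q by rewrite powR_gt0.
have q1 : q < 1.
  have l2 : 0 < ln 2 :> R by rewrite ln_gt0 ?ltr1n.
  by rewrite /q /powR pnatr_eq0/= -[ltRHS]expR0 ltr_expR pmulr_llt0 ?subr_lt0.
have hE k : (\int[P]_w h k w = (2 `^ a * q ^+ k)%:E)%E.
  rewrite ge0_integralZl//= ?lee_fin ?powR_ge0//.
  have PA : P (A k) = ((2 ^+ k) `^ (- (tau - 1)))%:E.
    by have := XP (2 ^+ k); rewrite exprn_ege1 ?ler1n.
  have -> : (\int[P]_x (\1_(A k) x)%:E)%E = P (A k).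
    by rewrite integral_indic// setIT.
  rewrite PA -EFinM; congr EFin.
  have tw (y z : R) : 2 `^ y * 2 `^ z = 2 `^ (y + z).
    by rewrite -powRD// pnatr_eq0 implybT.
  have -> : (2 ^+ k) `^ (- (tau - 1)) = 2 `^ (k%:R * - (tau - 1)).
    by rewrite powRrM powR_mulrn.
  have -> : q ^+ k = 2 `^ ((a - (tau - 1)) * k%:R).
    by rewrite /q powRrM powR_mulrn ?powR_ge0.
  by rewrite !tw -[k.+1%:R]natr1; congr powR; ring.
under eq_eseriesr => k _ do rewrite hE.
rewrite /pareto_moment EFinD leeD2l//.
apply: lime_le.
  by apply: is_cvg_nneseries => k _ _; rewrite lee_fin mulr_ge0 ?powR_ge0 ?exprn_ge0 ?(ltW q0).
near=> m; rewrite sumEFin lee_fin big_mkord -mulr_sumr.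
apply: ler_wpM2l; first exact: powR_ge0.
have := subrX1 q m; rewrite -opprB -[q - 1]opprB mulNr => /oppr_inj e.
rewrite -(ler_pM2l (_ : 0 < 1 - q)) ?subr_gt0// -e mulfV ?subr_eq0 ?gt_eqF//.
by rewrite gerBl exprn_ge0// ltW.
Unshelve. all: by end_near. Qed.

End pareto.

Section connection_moments.
Variables (R : realType) (d N : nat) (alpha tau sigma : R).
Variables (disp : measure_display) (Omega : measurableType disp).
Variables (P : probability Omega R) (G : kbrg d N alpha tau sigma P).
Hypotheses (alpha0 : 0 < alpha) (hsigma : 0 < sigma < tau - 1).
Local Notation V := (vertex d N).
Local Notation W := (weight G).
Local Notation p i j w := (connection_prob alpha sigma (W ^~ w) i j).

(* An almost sure event, measurable for the weights, on which kappa is at least 1. *)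
Definition weights_gt1 : set Omega := [set w | forall i, 1 < W i w].

Lemma weights_gt1E :
  weights_gt1 = \bigcap_(i in [set` [set: V]%SET]) (W i @^-1` `]1, +oo[).
Proof.
apply/seteqP; split => [w w1 i _ /=|w w1 i]; first by rewrite in_itv/= w1.
by have := w1 i; rewrite /= in_itv/= andbT; apply; rewrite inE.
Qed.

Lemma probability_weights_gt1 : P weights_gt1 = 1%E.
Proof.
rewrite weights_gt1E.
have := @kbrg_weight_indep _ _ _ _ _ _ _ _ _ G [set: V]%SET (fun=> `]1, +oo[%classic).
rewrite /= => ->; last by move=> i; exact: measurable_itv.
by rewrite big1// => i _; apply: pareto_gt1; exact: kbrg_weight_pareto.
Qed.

Lemma sigma_algebra_weights_gt1 : sigma_algebra_of W weights_gt1.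
Proof.
rewrite /sigma_algebra_of weights_gt1E.
apply: (@fin_bigcap_measurable _ (g_sigma_algebraType _)) => // i _.
apply: sub_sigma_algebra; exists i => //.
by exists `]1, +oo[%classic => //; rewrite setTI.
Qed.

Lemma measurable_weights_gt1 : measurable weights_gt1.
Proof.
rewrite weights_gt1E; apply: fin_bigcap_measurable => // i _.
by rewrite -[X in measurable X]setTI; exact: measurable_funPT.
Qed.

Lemma connection_prob_sym (w : Omega) i j : p i j w = p j i w.
Proof.
by rewrite /connection_prob torus_dist_sym /kappa [Num.max (W i w) _]maxC [Num.min (W i w) _]minC.
Qed.

Lemma kappa_ge1 (u v : R) : 1 <= u -> 1 <= v -> 1 <= kappa sigma u v.
Proof.
move=> u1 v1; rewrite /kappa -[leLHS]mulr1; apply: ler_pM => //.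
  by rewrite le_max u1.
have /andP[s0 _] := hsigma.
have {1}-> : 1 = 1 `^ sigma :> R by rewrite powR1.
apply: ge0_ler_powR; first exact: ltW.
- by rewrite nnegrE.
- by rewrite nnegrE le_min !(le_trans ler01).
- by rewrite le_min u1.
Qed.

Lemma connection_prob_bounds (w : Omega) i j : weights_gt1 w ->
  0 <= p i j w <= 1.
Proof.
move=> w1; rewrite /connection_prob le_min ler01 ge_min lexx orbT !andbT.
by rewrite divr_ge0 ?powR_ge0// (le_trans ler01)// kappa_ge1 ?ltW.
Qed.

Lemma connection_prob_ge (w : Omega) i j : weights_gt1 w -> i != j ->
  (torus_dist i j)%:R `^ (- alpha) <= p i j w.
Proof.
move=> w1 ij; have r1 := torus_dist_gt0 ij.
have r0 : 0 < (torus_dist i j)%:R `^ alpha :> R by rewrite powR_gt0// ltr0n.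
rewrite powRN /connection_prob le_min; apply/andP; split.
  by rewrite -[leLHS]mul1r ler_pM2r ?invr_gt0// kappa_ge1 ?ltW.
rewrite invf_le1//.
have {1}-> : 1 = 1 `^ alpha :> R by rewrite powR1.
by apply: ge0_ler_powR; rewrite ?nnegrE ?ler1n// ltW.
Qed.

Lemma kappa_powR_le (s u v : R) : 0 < s -> 0 < u -> 0 < v ->
  kappa sigma u v `^ s <=
  u `^ s * v `^ (sigma * s) + v `^ s * u `^ (sigma * s).
Proof.
move=> s0 u0 v0; rewrite /kappa maxC minC; have [vu|uv] := leP v u.
  by rewrite powRM ?powR_ge0 ?(ltW u0)// -powRrM lerDl mulr_ge0 ?powR_ge0.
by rewrite powRM ?powR_ge0 ?(ltW v0)// -powRrM lerDr mulr_ge0 ?powR_ge0.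
Qed.

Lemma connection_prob_powR_le (s : R) (w : Omega) i j : weights_gt1 w -> 0 < s ->
  i != j ->
  p i j w `^ s <= (torus_dist i j)%:R `^ (- (alpha * s)) *
    (W i w `^ s * W j w `^ (sigma * s) + W j w `^ s * W i w `^ (sigma * s)).
Proof.
move=> w1 s0 ij; have r1 := torus_dist_gt0 ij.
have k0 : 0 <= kappa sigma (W i w) (W j w).
  by apply: (le_trans ler01); rewrite kappa_ge1 ?ltW.
have /andP[p0 _] := connection_prob_bounds i j w1.
apply: (@le_trans _ _ ((kappa sigma (W i w) (W j w) / (torus_dist i j)%:R `^ alpha) `^ s)).
  apply: ge0_ler_powR; rewrite ?nnegrE ?(ltW s0)//.
    by rewrite divr_ge0 ?powR_ge0.
  by rewrite /connection_prob ge_min lexx.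
rewrite -powRN powRM ?powR_ge0// -powRrM mulNr mulrC.
apply: ler_wpM2l; first exact: powR_ge0.
by apply: kappa_powR_le => //; exact: lt_trans ltr01 (w1 _).
Qed.

Lemma weight_pair_indep i j (A B : set R) : i != j ->
  measurable A -> measurable B ->
  P (W i @^-1` A `&` W j @^-1` B) = (P (W i @^-1` A) * P (W j @^-1` B))%E.
Proof.
move=> ij mA mB; pose F k := if k == i then A else B.
have := @kbrg_weight_indep _ _ _ _ _ _ _ _ _ G [set i; j]%SET F.
have mF k : measurable (F k) by rewrite /F; case: ifP.
move=> /(_ mF); rewrite big_setU1/= ?inE// big_set1 /F eqxx eq_sym (negbTE ij) => <-.
congr (P _); apply/seteqP; split => w /=.
  move=> [Aw Bw] k /=; rewrite !inE => /orP[] /eqP -> /=; rewrite ?eqxx//.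
  by rewrite eq_sym (negbTE ij).
move=> h; split; first by have := h i; rewrite /= eqxx; apply; rewrite !inE eqxx.
by have := h j; rewrite /= eq_sym (negbTE ij); apply; rewrite !inE eqxx orbT.
Qed.

(** Bounds the moment of order s of kappa; the factor 2 accounts for which of the two weights is the
    larger. *)
Definition connection_moment (tau sigma s : R) : R :=
  2 * (pareto_moment tau s * pareto_moment tau (sigma * s)).

Lemma integral_weight_product_le (s : R) i j : i != j -> 0 < s < tau - 1 ->
  sigma * s < tau - 1 ->
  (\int[P]_w (W i w `^ s * W j w `^ (sigma * s))%:E <=
   (pareto_moment tau s * pareto_moment tau (sigma * s))%:E)%E.
Proof.
move=> ij s01 ss; have /andP[s0 _] := s01; have /andP[sig0 _] := hsigma.
have mpow (a : R) : measurable_fun setT (fun x : R => (x `^ a)%:E).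
  by apply/measurable_EFinP; exact: measurable_powR.
under eq_integral => w _ do rewrite EFinM.
rewrite (@integral_indep _ _ _ P (W i) (W j) (fun x => (x `^ s)%:E)
   (fun x => (x `^ (sigma * s))%:E))//; last 3 first.
- by move=> A B mA mB; exact: weight_pair_indep.
- by move=> x; rewrite lee_fin powR_ge0.
- by move=> x; rewrite lee_fin powR_ge0.
rewrite EFinM; apply: lee_pmul.
- by apply: integral_ge0 => w _; rewrite lee_fin powR_ge0.
- by apply: integral_ge0 => w _; rewrite lee_fin powR_ge0.
- by apply: pareto_moment_le => //; exact: kbrg_weight_pareto.
- by apply: pareto_moment_le; [exact: kbrg_weight_pareto | rewrite mulr_gt0].
Qed.

Lemma measurable_connection_prob i j :
  measurable_fun setT (fun w => p i j w).
Proof.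
rewrite /connection_prob /kappa; apply: measurable_minr => //.
apply: measurable_funM => //; apply: measurable_funM.
  by apply: measurable_maxr; exact: measurable_funPT.
apply: (measurableT_comp (measurable_powR _)).
by apply: measurable_minr; exact: measurable_funPT.
Qed.

Lemma integral_connection_prob_le (s : R) i j : i != j -> 0 < s < tau - 1 ->
  sigma * s < tau - 1 ->
  (\int[P]_(w in weights_gt1) (p i j w `^ s)%:E <=
   (connection_moment tau sigma s * (torus_dist i j)%:R `^ (- (alpha * s)))%:E)%E.
Proof.
move=> ij s01 ss; have /andP[s0 _] := s01.
pose F i j w : \bar R := (W i w `^ s * W j w `^ (sigma * s))%:E.
have mF k l : measurable_fun setT (F k l).
  apply/measurable_EFinP; apply: measurable_funM;
    by apply: (measurableT_comp (measurable_powR _)); exact: measurable_funPT.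
have F0 k l w : (0 <= F k l w)%E by rewrite lee_fin mulr_ge0 ?powR_ge0.
set q := (torus_dist i j)%:R `^ (- (alpha * s)).
have q0 : 0 <= q by exact: powR_ge0.
apply: (@le_trans _ _ (\int[P]_(w in weights_gt1) (q%:E * (F i j w + F j i w)))%E).
  apply: ge0_le_integral.
  - exact: measurable_weights_gt1.
  - by move=> w _; rewrite lee_fin powR_ge0.
  - apply: measurable_funTS; apply/measurable_EFinP.
    by apply: (measurableT_comp (measurable_powR _)); exact: measurable_connection_prob.
  - by apply: measurable_funTS; apply: measurable_funeM; exact: emeasurable_funD.
  - by move=> w w1; rewrite /F -EFinD -EFinM lee_fin connection_prob_powR_le.
apply: (@le_trans _ _ (\int[P]_w (q%:E * (F i j w + F j i w)))%E).
  apply: ge0_subset_integral => //.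
  - exact: measurable_weights_gt1.
  - by apply: measurable_funeM; exact: emeasurable_funD.
  - by move=> w _; rewrite mule_ge0// adde_ge0.
rewrite ge0_integralZl//; last 2 first.
- exact: emeasurable_funD.
- by move=> w _; rewrite adde_ge0.
rewrite ge0_integralD// mulrC EFinM; apply: lee_wpmul2l => //.
rewrite /connection_moment mulr_natl mulr2n EFinD.
by apply: leeD; apply: integral_weight_product_le => //; rewrite eq_sym.
Qed.

End connection_moments.

(** * Poisson transforms and the Levy-Prokhorov distance *)

Section poisson_kernel.
Variables (R : realType) (x eta : R).
Hypothesis eta0 : 0 < eta.

(** Without the usual factor 1 / pi: this is the imaginary part of 1 / (y - z) at z = x + i eta. *)
Definition poisson_kernel (x eta y : R) : R := eta / ((y - x) ^+ 2 + eta ^+ 2).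
Local Notation g := (poisson_kernel x eta).

Let den_gt0 y : 0 < (y - x) ^+ 2 + eta ^+ 2.
Proof. by rewrite ltr_wpDl ?sqr_ge0 ?exprn_gt0. Qed.

Lemma poisson_kernel_gt0 y : 0 < g y.
Proof. by rewrite divr_gt0. Qed.

Lemma poisson_kernel_le y : g y <= eta^-1.
Proof.
rewrite ler_pdivrMr//.
have -> : eta^-1 * ((y - x) ^+ 2 + eta ^+ 2) = eta^-1 * (y - x) ^+ 2 + eta.
  by field; exact: lt0r_neq0.
rewrite lerDr.
by rewrite mulr_ge0 ?sqr_ge0// invr_ge0 ltW.
Qed.

Lemma poisson_kernel_lip y z : g y - g z <= eta ^- 2 * `|y - z|.
Proof.
rewrite /poisson_kernel; set u := y - x; set v := z - x.
have uv : y - z = u - v by rewrite /u /v; ring.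
have u0 := den_gt0 y; have v0 := den_gt0 z; rewrite -/u -/v in u0 v0 *.
have -> : eta / (u ^+ 2 + eta ^+ 2) - eta / (v ^+ 2 + eta ^+ 2) =
    eta * ((v - u) * (v + u)) / ((u ^+ 2 + eta ^+ 2) * (v ^+ 2 + eta ^+ 2)).
  by field; rewrite !lt0r_neq0.
rewrite ler_pdivrMr ?mulr_gt0// uv.
apply: (le_trans (ler_norm _)); rewrite !normrM (gtr0_norm eta0) [`|v - u|]distrC.
rewrite mulrCA [eta ^- 2 * _]mulrC -mulrA; apply: ler_wpM2l => //.
rewrite -(ler_pM2l (exprn_gt0 2 eta0)) mulrA mulrA mulfV ?mul1r ?lt0r_neq0 ?exprn_gt0//.
have au : `|u| ^+ 2 = u ^+ 2 by rewrite -normrX ger0_norm// sqr_ge0.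
have av : `|v| ^+ 2 = v ^+ 2 by rewrite -normrX ger0_norm// sqr_ge0.
rewrite -au -av.
have h : `|v + u| <= `|v| + `|u| by exact: ler_normD.
move: h (normr_ge0 u) (normr_ge0 v); set s := `|v + u|; set p := `|u|; set q := `|v|.
move=> h p0 q0.
apply: (@le_trans _ _ (eta ^+ 2 * eta * (q + p))).
  by apply: ler_wpM2l => //; rewrite mulr_ge0 ?sqr_ge0// ltW.
have h1 : 2 * (eta * p) <= p ^+ 2 + eta ^+ 2.
  rewrite -subr_ge0; have -> : p ^+ 2 + eta ^+ 2 - 2 * (eta * p) = (p - eta) ^+ 2 by ring.
  exact: sqr_ge0.
have h2 : 2 * (eta * q) <= q ^+ 2 + eta ^+ 2.
  rewrite -subr_ge0; have -> : q ^+ 2 + eta ^+ 2 - 2 * (eta * q) = (q - eta) ^+ 2 by ring.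
  exact: sqr_ge0.
have P0 := sqr_ge0 p; have Q0 := sqr_ge0 q; have E0 := sqr_ge0 eta.
have h3 : eta ^+ 2 * (2 * (eta * p)) <= eta ^+ 2 * (p ^+ 2 + eta ^+ 2) by exact: ler_wpM2l.
have h4 : eta ^+ 2 * (2 * (eta * q)) <= eta ^+ 2 * (q ^+ 2 + eta ^+ 2) by exact: ler_wpM2l.
have h5 : 0 <= p ^+ 2 * q ^+ 2 by exact: mulr_ge0.
have h6 : 0 <= eta ^+ 2 * p ^+ 2 by exact: mulr_ge0.
have h7 : 0 <= eta ^+ 2 * q ^+ 2 by exact: mulr_ge0.
nra.
Qed.

Lemma measurable_poisson_kernel : measurable_fun setT g.
Proof.
apply: continuous_measurable_fun => y.
apply: cvgM; first exact: cvg_cst.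
apply: cvgV; first by rewrite lt0r_neq0.
apply: cvgD; last exact: cvg_cst.
by apply: cvgM; apply: cvgB => //; exact: cvg_cst.
Qed.

Variables (m : nat) (top : R).
Hypotheses (m0 : (0 < m)%N) (top0 : 0 < top).
Local Notation del := (top / m%:R).

(* A layer cake with finitely many levels, so that the Levy-Prokhorov bound on
   superlevel sets can be summed without integrating over the level. *)
Lemma layers_ge (t : R) : t <= top ->
  t <= del * \sum_(k < m) (k%:R * del < t)%R%:R.
Proof.
move=> tt; have m0' : 0 < m%:R :> R by rewrite ltr0n.
have d0 : 0 < del by rewrite divr_gt0.
have h j : (j <= m)%N -> t <= j%:R * del -> t <= del * \sum_(k < j) (k%:R * del < t)%R%:R.
  elim: j => [_|j IH jm tj]; first by rewrite big_ord0 mulr0 mul0r.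
  rewrite big_ord_recr/=; have [tj'|tj'] := leP t (j%:R * del).
    by rewrite addr0; apply: IH => //; exact: ltnW.
  apply: (le_trans tj); rewrite mulrC ler_pM2l// -natr1 lerD2r.
  rewrite -[X in X%:R]card_ord -sum1_card natr_sum; apply: ler_sum => k _.
  suff -> : k%:R * del < t by [].
  apply: le_lt_trans tj'; rewrite ler_pM2r// ler_nat; exact: ltnW.
by apply: h => //; rewrite mulrCA mulfV ?mulr1// lt0r_neq0.
Qed.

Lemma layers_le (t : R) : 0 <= t ->
  del * \sum_(k < m) (k%:R * del < t)%R%:R <= t + del.
Proof.
move=> t0; have m0' : 0 < m%:R :> R by rewrite ltr0n.
have d0 : 0 < del by rewrite divr_gt0.
have h j : del * \sum_(k < j) (k%:R * del < t)%R%:R <= t + del.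
  elim: j => [|j IH]; first by rewrite big_ord0 mulr0 addr_ge0// ltW.
  rewrite big_ord_recr/=; have [tj|tj] := ltP (j%:R * del) t; last by rewrite addr0.
  rewrite mulrDr mulr1 lerD2r; apply: le_trans (ltW tj).
  rewrite mulrC ler_pM2r// -[X in _ <= X%:R]card_ord -sum1_card natr_sum.
  by apply: ler_sum => k _; case: (_ < t).
exact: h.
Qed.

End poisson_kernel.

Section levy_prokhorov_poisson.
Variables (R : realType) (x eta : R).
Hypothesis eta0 : 0 < eta.
Local Notation g := (poisson_kernel x eta).

Lemma open_thickening (e : R) (A : set R) : open (thickening e A).
Proof.
have -> : thickening e A = \bigcup_(a in A) ball a e.
  apply/seteqP; split => y /= [a Aa ya]; exists a => //.
    by rewrite -ball_normE/= distrC.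
  by move: ya; rewrite -ball_normE/= distrC.
by apply: bigcup_open => a _; exact: ball_open.
Qed.

Definition poisson_layer (m k : nat) : set R :=
  [set y | k%:R * (eta^-1 / m%:R) < g y].

Lemma measurable_poisson_layer m k : measurable (poisson_layer m k).
Proof.
rewrite -[X in measurable X]setTI /poisson_layer.
have -> : [set y | k%:R * (eta^-1 / m%:R) < g y] = g @^-1` `]k%:R * (eta^-1 / m%:R), +oo[.
  by apply/seteqP; split => y /=; rewrite in_itv/= andbT.
exact: measurable_poisson_kernel.
Qed.

(** By the Lipschitz bound, a displacement of less than e changes the kernel by less than one
    level. *)
Lemma thickening_poisson_layer m k (e : R) :
  e <= eta ^+ 2 * (eta^-1 / m%:R) ->
  thickening e (poisson_layer m k.+1) `<=` poisson_layer m k.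
Proof.
move=> em y [a]; rewrite /poisson_layer/= => ga ya.
have := poisson_kernel_lip x eta0 a y; rewrite distrC => h.
have : eta ^- 2 * `|y - a| < eta^-1 / m%:R.
  rewrite -(ltr_pM2l (exprn_gt0 2 eta0)) mulrA mulfV ?mul1r ?lt0r_neq0 ?exprn_gt0//.
  exact: lt_le_trans ya em.
by move: ga; rewrite -natr1 mulrDl mul1r; lra.
Qed.

Variables (mu nu : set R -> R) (m : nat) (e : R).
Hypotheses (m0 : (0 < m)%N) (e0 : 0 <= e).
Hypothesis em : e <= eta ^+ 2 * (eta^-1 / m%:R).
Hypothesis nu_mono : forall A B : set R, measurable A -> measurable B -> A `<=` B ->
  nu A <= nu B.
Hypothesis mu_le1 : forall A : set R, measurable A -> mu A <= 1.
Hypothesis nu_ge0 : forall A : set R, measurable A -> 0 <= nu A.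
Hypothesis munu : forall A : set R, measurable A -> mu A <= nu (thickening e A) + e.

(** Thickening shifts the levels by one: layer 0 is bounded by the total mass 1, and layer k + 1 is
    compared with layer k. The set functions are abstract so that the comparison can be made in both
    directions. *)
Lemma poisson_layers_compare :
  \sum_(k < m) mu (poisson_layer m k) <=
  1 + \sum_(k < m) nu (poisson_layer m k) + m%:R * e.
Proof.
have mL k := measurable_poisson_layer m k.
case: m m0 em mL => // m' _ em' mL; rewrite big_ord_recl/= -addrA; apply: lerD.
  exact: mu_le1.
apply: (@le_trans _ _ (\sum_(k < m') (nu (poisson_layer m'.+1 k) + e))).
  apply: ler_sum => k _; apply: (le_trans (munu (mL _))); rewrite lerD2r.
  apply: nu_mono => //; last exact: thickening_poisson_layer.
  by apply: open_measurable; exact: open_thickening.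
rewrite big_split/= sumr_const card_ord -[_ *+ _]mulr_natl.
apply: lerD; last by rewrite ler_wpM2r// ler_nat.
by rewrite big_ord_recr/= lerDl nu_ge0.
Qed.

End levy_prokhorov_poisson.

Section levy_prokhorov_esd.
Variables (R : realType) (x eta : R).
Hypothesis eta0 : 0 < eta.
Local Notation g := (poisson_kernel x eta).
Variable mu : probability R R.

Definition poisson_transform (mu : probability R R) (x eta : R) : R :=
  fine (\int[mu]_y (poisson_kernel x eta y)%:E).

Let mg : measurable_fun setT (fun y => (g y)%:E).
Proof. by apply/measurable_EFinP; exact: measurable_poisson_kernel. Qed.

Lemma poisson_transformE :
  (\int[mu]_y (g y)%:E = (poisson_transform mu x eta)%:E)%E.
Proof.
rewrite /poisson_transform fineK// ge0_fin_numE; last first.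
  by apply: integral_ge0 => y _; rewrite lee_fin ltW// poisson_kernel_gt0.
apply: (@le_lt_trans _ _ (\int[mu]_y (cst (eta^-1)%:E y))%E).
  apply: ge0_le_integral => //.
  - by move=> y _; rewrite lee_fin ltW// poisson_kernel_gt0.
  - by move=> y _; rewrite lee_fin poisson_kernel_le.
by rewrite integral_cst//= probability_setT mule1 ltry.
Qed.

Let fmu (A : set R) : R := fine (mu A).

Let fmuE (A : set R) : measurable A -> mu A = (fmu A)%:E.
Proof. by move=> mA; rewrite /fmu fineK// fin_num_measure. Qed.

Lemma poisson_transform_layers m : (0 < m)%N ->
  poisson_transform mu x eta <=
    eta^-1 / m%:R * \sum_(k < m) fmu (poisson_layer x eta m k) <=
  poisson_transform mu x eta + eta^-1 / m%:R.
Proof.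
move=> m0.
have e0 : 0 < eta^-1 by rewrite invr_gt0.
set del := eta^-1 / m%:R.
have d0 : 0 <= del by rewrite divr_ge0// ltW.
have mL k := measurable_poisson_layer x eta0 m k.
have -> : del * \sum_(k < m) fmu (poisson_layer x eta m k) =
  fine (\int[mu]_y (del * \sum_(k < m) \1_(poisson_layer x eta m k) y)%:E).
  under eq_integral => y _ do rewrite EFinM -sumEFin.
  rewrite ge0_integralZl//; last 2 first.
  - by apply: emeasurable_sum => k; apply/measurable_EFinP; exact: measurable_indic.
  - by move=> y _; apply: sume_ge0 => k _; rewrite lee_fin.
  rewrite ge0_integral_sum//; last first.
    by move=> k; apply/measurable_EFinP; exact: measurable_indic.
  have iE (k : 'I_m) : (\int[mu]_y (\1_(poisson_layer x eta m k) y)%:E =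
      (fmu (poisson_layer x eta m k))%:E)%E.
    by rewrite integral_indic// setIT; exact: fmuE.
  by rewrite (eq_bigr (fun k : 'I_m => (fmu (poisson_layer x eta m k))%:E)) ?sumEFin -?EFinM.
have mS : measurable_fun setT
    (fun y => (del * \sum_(k < m) \1_(poisson_layer x eta m k) y)%:E).
  apply/measurable_EFinP; apply: measurable_funM => //.
  by apply: measurable_sum => k; exact: measurable_indic.
have SE y : del * \sum_(k < m) \1_(poisson_layer x eta m k) y =
    del * \sum_(k < m) (k%:R * del < g y)%R%:R.
  congr (_ * _); apply: eq_bigr => k _; rewrite indicE; congr (nat_of_bool _)%:R.
  by apply/idP/idP; rewrite inE.
have S0 y : 0 <= del * \sum_(k < m) \1_(poisson_layer x eta m k) y.
  by rewrite mulr_ge0// sumr_ge0.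
have g0 y := ltW (poisson_kernel_gt0 x eta0 y).
have Sfin : (\int[mu]_y (del * \sum_(k < m) \1_(poisson_layer x eta m k) y)%:E
    <= (poisson_transform mu x eta + del)%:E)%E.
  rewrite EFinD -poisson_transformE.
  have -> : (del%:E = \int[mu]_y (cst del%:E y))%E.
    by rewrite integral_cst//= probability_setT mule1.
  rewrite -ge0_integralD//; last by move=> y _; rewrite lee_fin.
  apply: ge0_le_integral => //.
  - by move=> y _; rewrite lee_fin.
  - by apply: emeasurable_funD.
  - by move=> y _; rewrite SE -EFinD lee_fin layers_le.
have Sge : ((poisson_transform mu x eta)%:E <=
    \int[mu]_y (del * \sum_(k < m) \1_(poisson_layer x eta m k) y)%:E)%E.
  rewrite -poisson_transformE; apply: ge0_le_integral => //.
  - by move=> y _; rewrite lee_fin.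
  - by move=> y _; rewrite SE lee_fin layers_ge// poisson_kernel_le.
have fn : (\int[mu]_y (del * \sum_(k < m) \1_(poisson_layer x eta m k) y)%:E)%E \is a fin_num.
  by rewrite ge0_fin_numE ?(le_lt_trans Sfin) ?ltry// (le_trans _ Sge)//
    lee_fin fine_ge0// integral_ge0// => y _; rewrite lee_fin.
by apply/andP; split; rewrite -lee_fin (fineK fn).
Qed.

Variables (n : nat) (H : 'M[R]_n).
Hypotheses (n0 : (0 < n)%N) (sH : H^T = H).

Let n0' : 0 < n%:R :> R. Proof. by rewrite ltr0n. Qed.

Definition esd_mass (A : set R) : R :=
  n%:R^-1 * \sum_(i < n) \1_A (tnth (eigenvalues H) i).

Lemma esd_massE (A : set R) : esd H A = (esd_mass A)%:E.
Proof. by rewrite /esd /esd_mass EFinM -sumEFin. Qed.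

Lemma esd_mass_le (A B : set R) : A `<=` B -> esd_mass A <= esd_mass B.
Proof.
move=> AB; apply: ler_wpM2l; first by rewrite invr_ge0 ltW.
apply: ler_sum => i _; rewrite !indicE ler_nat.
by case: (boolP (_ \in A)) => //; rewrite inE => /AB h; rewrite mem_set.
Qed.

Lemma esd_mass_ge0 (A : set R) : 0 <= esd_mass A.
Proof. by apply: mulr_ge0; [rewrite invr_ge0 ltW | exact: sumr_ge0]. Qed.

Lemma esd_mass_le1 (A : set R) : esd_mass A <= 1.
Proof.
rewrite /esd_mass mulrC ler_pdivrMr// mul1r -[X in X%:R]card_ord -sum1_card natr_sum.
by apply: ler_sum => i _; rewrite indicE; case: (_ \in _).
Qed.

Lemma mean_Im_resolvent_poisson :
  mean_Im_resolvent x eta H = n%:R^-1 * \sum_(i < n) g (tnth (eigenvalues H) i).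
Proof. by rewrite /mean_Im_resolvent Im_trace_resolvent. Qed.

Lemma mean_Im_resolvent_layers m : (0 < m)%N ->
  mean_Im_resolvent x eta H <=
    eta^-1 / m%:R * \sum_(k < m) esd_mass (poisson_layer x eta m k) <=
  mean_Im_resolvent x eta H + eta^-1 / m%:R.
Proof.
move=> m0; have e0 : 0 < eta^-1 by rewrite invr_gt0.
set del := eta^-1 / m%:R.
have -> : del * \sum_(k < m) esd_mass (poisson_layer x eta m k) =
    n%:R^-1 * \sum_(i < n) (del * \sum_(k < m) (k%:R * del < g (tnth (eigenvalues H) i))%R%:R).
  rewrite -!mulr_sumr exchange_big/= mulrCA; congr (_ * _).
  congr (_ * _); apply: eq_bigr => i _; apply: eq_bigr => k _.
  rewrite indicE; congr (nat_of_bool _)%:R.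
  by apply/idP/idP; rewrite inE.
have -> : mean_Im_resolvent x eta H + del =
    n%:R^-1 * \sum_(i < n) (g (tnth (eigenvalues H) i) + del).
  rewrite mean_Im_resolvent_poisson big_split/= mulrDr; congr (_ + _).
  by rewrite sumr_const card_ord -[del *+ n]mulr_natl mulrA mulVf ?mul1r// lt0r_neq0.
rewrite mean_Im_resolvent_poisson; apply/andP; split;
  (apply: ler_wpM2l; first by rewrite invr_ge0 ltW); apply: ler_sum => i _.
- by rewrite layers_ge// poisson_kernel_le.
- by rewrite layers_le// ltW// poisson_kernel_gt0.
Qed.

(** With del = eta^-1 / m, the error is one del for the discretization into layers, one for the
    bottom layer, and eta * del for the additive e summed over the m layers. *)
Lemma levy_prokhorov_poisson (eps : R) m : (0 < m)%N -> 0 < eps ->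
  2 * eps <= eta ^+ 2 * (eta^-1 / m%:R) ->
  levy_prokhorov (esd H) mu <= eps ->
  `|poisson_transform mu x eta - mean_Im_resolvent x eta H| <=
  (2 + eta) * (eta^-1 / m%:R).
Proof.
move=> m0 eps0 epsm LP.
have ei0 : 0 < eta^-1 by rewrite invr_gt0.
pose S := [set e : R | 0 < e /\ forall A : set R, measurable A ->
    (esd H A <= mu (thickening e A) + e%:E)%E /\
    (mu A <= esd H (thickening e A) + e%:E)%E].
have mT (e : R) (A : set R) : measurable (thickening e A).
  by apply: open_measurable; exact: open_thickening.
have Sinf : has_inf S.
  split; last by exists 0 => e [/ltW].
  exists 1; split => // A mA; rewrite !esd_massE !fmuE//.
  rewrite -!EFinD !lee_fin; split.
    by apply: (le_trans (esd_mass_le1 _)); rewrite lerDr fine_ge0.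
  rewrite (@le_trans _ _ 1)//; last by rewrite lerDr esd_mass_ge0.
  by rewrite -lee_fin -fmuE// probability_le1.
(* The infimum need not be attained, so an admissible e is taken within eps of it, hence at most 2 *
   eps. *)
have [e [e0 eS] elt] := inf_adherent eps0 Sinf.
have {}elt : e <= 2 * eps.
  by apply: (le_trans (ltW elt)); rewrite mulr_natl mulr2n lerD2r.
have em := le_trans elt epsm.
have mL k := measurable_poisson_layer x eta0 m k.
have c1 := @poisson_layers_compare R x eta eta0 fmu esd_mass m e m0 (ltW e0) em.
have c2 := @poisson_layers_compare R x eta eta0 esd_mass fmu m e m0 (ltW e0) em.
have {}c1 := c1 (fun A B _ _ => @esd_mass_le A B).
have {}c1 : \sum_(k < m) fmu (poisson_layer x eta m k) <=
    1 + \sum_(k < m) esd_mass (poisson_layer x eta m k) + m%:R * e.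
  apply: c1.
  - by move=> A mA; rewrite -lee_fin -fmuE// probability_le1.
  - by move=> A mA; exact: esd_mass_ge0.
  - move=> A mA; have [_] := eS A mA.
    by rewrite esd_massE fmuE// -EFinD lee_fin.
have {}c2 : \sum_(k < m) esd_mass (poisson_layer x eta m k) <=
    1 + \sum_(k < m) fmu (poisson_layer x eta m k) + m%:R * e.
  apply: c2.
  - move=> A B mA mB AB; rewrite -lee_fin -!fmuE//.
    by apply: le_measure => //; rewrite inE.
  - by move=> A mA; exact: esd_mass_le1.
  - by move=> A mA; exact: fine_ge0.
  - move=> A mA; have [+ _] := eS A mA.
    by rewrite esd_massE fmuE// -EFinD lee_fin.
have /andP[h1 h2] := poisson_transform_layers m0.
have /andP[h3 h4] := mean_Im_resolvent_layers m0.
have m0' : 0 < m%:R :> R by rewrite ltr0n.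
move: h1 h2 h3 h4 em; set del := eta^-1 / m%:R => h1 h2 h3 h4 em.
have d0 : 0 <= del by rewrite divr_ge0// ltW.
have {}c1 := ler_wpM2l d0 c1; have {}c2 := ler_wpM2l d0 c2.
have dm : del * (m%:R * e) <= eta * del.
  have -> : del * (m%:R * e) = eta^-1 * e by rewrite /del mulrA divfK// lt0r_neq0.
  rewrite ler_pdivrMl// mulrA -expr2; exact: em.
rewrite ler_norml; move: c1 c2; rewrite !mulrDr mulr1 => c1 c2; lra.
Qed.

End levy_prokhorov_esd.

(** * Laws with a bounded Poisson transform *)

Section bounded_poisson.
Variables (R : realType) (mu : probability R R) (C : R).
Hypothesis C0 : 0 <= C.
Hypothesis muC : forall x eta, 0 < eta -> poisson_transform mu x eta <= C.

(** The kernel centered at the midpoint, with eta half the length, is at least 1 / (b - a) on the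
    interval. *)
Lemma bounded_poisson_itv (a b : R) : a < b -> (mu `[a, b]%classic <= (C * (b - a))%:E)%E.
Proof.
move=> ab; set x := (a + b) / 2; set eta := (b - a) / 2.
have ba0 : 0 < b - a by rewrite subr_gt0.
have eta0 : 0 < eta by rewrite divr_gt0.
have mI : measurable (`[a, b]%classic : set R) by exact: measurable_itv.
apply: (@le_trans _ _ ((b - a)%:E * (poisson_transform mu x eta)%:E)%E); last first.
  by rewrite -EFinM lee_fin mulrC; apply: ler_wpM2r; [exact: ltW | exact: muC].
rewrite -poisson_transformE// -ge0_integralZl//; last 3 first.
- by apply/measurable_EFinP; exact: measurable_poisson_kernel.
- by move=> y _; rewrite lee_fin ltW// poisson_kernel_gt0.
- by rewrite lee_fin ltW.
have -> : mu `[a, b]%classic = (\int[mu]_y (\1_(`[a, b]%classic : set R) y)%:E)%E.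
  by rewrite integral_indic// setIT.
apply: ge0_le_integral => //.
- by apply/measurable_EFinP; exact: measurable_indic.
- apply: measurable_funeM.
  by apply/measurable_EFinP; exact: measurable_poisson_kernel.
- move=> y _; rewrite -EFinM lee_fin indicE.
  have g0 := poisson_kernel_gt0 x eta0 y.
  case: (boolP (y \in _)) => [|_]; last by rewrite mulr_ge0// ltW.
  rewrite inE/= in_itv/= => /andP[ay yb].
  have h : (y - x) ^+ 2 <= eta ^+ 2.
    rewrite -subr_ge0.
    have -> : eta ^+ 2 - (y - x) ^+ 2 = (y - a) * (b - y) by rewrite /eta /x; field.
    by rewrite mulr_ge0// subr_ge0.
  have d0 : 0 < (y - x) ^+ 2 + eta ^+ 2 by rewrite ltr_wpDl ?sqr_ge0 ?exprn_gt0.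
  rewrite /poisson_kernel mulrA ler_pdivlMr// mul1r.
  have -> : (b - a) * eta = eta ^+ 2 + eta ^+ 2 by rewrite /eta; field.
  by rewrite lerD2r.
Qed.

Lemma bounded_poisson_set1 (a : R) : mu [set a] = 0%E.
Proof.
apply/eqP; rewrite eq_le measure_ge0 andbT; apply/lee_addgt0Pr => e e0.
rewrite add0e; set h := e / (C + 1).
have C1 : 0 < C + 1 by rewrite ltr_wpDl.
have h0 : 0 < h by rewrite divr_gt0.
have mI : measurable (`[a, a + h]%classic : set R) by exact: measurable_itv.
apply: (@le_trans _ _ (mu `[a, a + h]%classic)).
  apply: le_measure; rewrite ?inE// => y ->.
  by rewrite /= in_itv/= lexx lerDl ltW.
apply: (le_trans (bounded_poisson_itv _)); first by rewrite ltrDl.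
rewrite lee_fin addrAC subrr add0r /h mulrCA ler_piMr ?(ltW e0)//.
by rewrite ler_pdivrMr// mul1r lerDl.
Qed.

(** Unfolding Lebesgue measure as an outer measure covers a null set by half-open intervals of total
    length below h, whose mu-mass is at most C * h. Taking h = e / (C + 1) allows C = 0. *)
Lemma bounded_poisson_dominated : mu `<< (@lebesgue_measure R).
Proof.
apply/null_content_dominatesP => A mA A0.
apply/eqP; rewrite eq_le measure_ge0 andbT; apply/lee_addgt0Pr => e e0.
rewrite add0e; set h := e / (C + 1).
have C1 : 0 < C + 1 by rewrite ltr_wpDl.
have h0 : 0 < h by rewrite divr_gt0.
have : (lebesgue_measure A < h%:E)%E by rewrite [ltLHS]A0 lte_fin.
rewrite /lebesgue_measure /lebesgue_stieltjes_measure /measure_extension /mu_ext.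
move=> /ereal_inf_lt[_ [F [mF AF] <-] Fh].
have mF' k : measurable (F k : set R).
  by apply: sub_sigma_algebra; exact: mF.
have Fle k : (mu (F k) <= C%:E * wlength (@idfun R) (F k))%E.
  have [[a b] _ <-] := mF k; rewrite /=.
  have [ab|ba] := ltP a b.
    rewrite wlength_itv_bnd ?(ltW ab)// -EFinM.
    apply: le_trans (bounded_poisson_itv ab).
    by apply: le_measure; rewrite ?inE//; exact: subset_itv_oc_cc.
  rewrite set_itv_ge ?bnd_simp -?leNgt// measure0.
  by rewrite wlength0 mule0.
have hs := @measure_sigma_subadditive _ R _ mu A F mF' mA AF.
apply: (le_trans hs).
apply: (@le_trans _ _ (\sum_(0 <= k <oo) (C%:E * wlength (@idfun R) (F k)))%E).
  by apply: lee_nneseries => [k _ _|k _]; [exact: measure_ge0 | exact: Fle].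
rewrite nneseriesZl; last by move=> k _; exact: wlength_ge0.
apply: (@le_trans _ _ (C%:E * h%:E)%E).
  by apply: lee_wpmul2l; [rewrite lee_fin | exact: ltW].
rewrite -EFinM lee_fin /h mulrCA ler_piMr ?(ltW e0)//.
by rewrite ler_pdivrMr// mul1r lerDl.
Qed.

End bounded_poisson.

(** * Inversion of the Poisson transform and symmetry *)

Section poisson_inversion.
Variable R : realType.
Implicit Types (mu nu : probability R R) (a b x y eta : R).

Definition poisson_primitive a b eta y : R :=
  atan ((b - y) / eta) - atan ((a - y) / eta).

Lemma integral_poisson_kernel a b eta y : 0 < eta -> a < b ->
  (\int[lebesgue_measure]_(x in `[a, b]) (poisson_kernel x eta y)%:E =
   (poisson_primitive a b eta y)%:E)%E.
Proof.
move=> eta0 ab; rewrite /poisson_primitive EFinB.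
pose F x : R := atan ((x - y) / eta).
have dF x : is_derive x 1 F (poisson_kernel x eta y).
  pose u x : R := (x - y) / eta.
  have d1 : is_derive x 1 u eta^-1.
    have -> : u = eta^-1 \*: (fun x => x - y).
      by apply/funext => v; rewrite /u/= mulrC.
    rewrite -[X in is_derive _ _ _ X]mulr1.
    apply: is_deriveZ.
    have -> : (fun x : R => x - y) = (fun x => x) \- cst y by [].
    by rewrite -[X in is_derive _ _ _ X]subr0; apply: is_deriveB.
  have := @is_derive1_comp R atan u x _ _ (is_derive1_atan (u x)) d1.
  congr (is_derive _ _ _ _); rewrite /u /poisson_kernel.
  have h1 : 0 < (y - x) ^+ 2 + eta ^+ 2 by rewrite ltr_wpDl ?sqr_ge0 ?exprn_gt0.
  have h2 : 0 < 1 + ((x - y) / eta) ^+ 2 by rewrite ltr_pwDl ?sqr_ge0.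
  have e0 := lt0r_neq0 eta0.
  have -> : 1 + ((x - y) / eta) ^+ 2 = ((y - x) ^+ 2 + eta ^+ 2) / eta ^+ 2 by field.
  by field; rewrite e0 lt0r_neq0.
have cF x : {for x, continuous F}.
  by apply: differentiable_continuous; apply/derivable1_diffP; case: (dF x).
rewrite (@continuous_FTC2 _ _ F)//.
- apply: continuous_subspaceT => x.
  apply: cvgM; first exact: cvg_cst.
  apply: cvgV; first by rewrite lt0r_neq0// ltr_wpDl ?sqr_ge0 ?exprn_gt0.
  apply: cvgD; last exact: cvg_cst.
  by apply: cvgM; apply: cvgB => //; exact: cvg_cst.
- split.
  + by move=> x _; case: (dF x).
  + by apply: cvg_at_right_filter; exact: cF.
  + by apply: cvg_at_left_filter; exact: cF.
- by move=> x _; rewrite derive1E; case: (dF x).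
Qed.

Lemma measurable_poisson_primitive a b eta : 0 < eta ->
  measurable_fun setT (poisson_primitive a b eta).
Proof.
move=> eta0; apply: continuous_measurable_fun => y.
have c (d : R) : (fun y => atan ((d - y) / eta)) z @[z --> y] --> atan ((d - y) / eta).
  apply: (@cvg_comp _ _ _ (fun y => (d - y) / eta) (@atan R) _ (nbhs ((d - y) / eta))).
    by apply: cvgM; [apply: cvgB => //; exact: cvg_cst | exact: cvg_cst].
  exact: continuous_atan.
by apply: cvgB.
Qed.

Lemma poisson_primitive_ge0 a b eta y : 0 < eta -> a < b ->
  0 <= poisson_primitive a b eta y.
Proof.
move=> eta0 ab; rewrite subr_ge0 le_atan// ler_pM2r ?invr_gt0//.
by rewrite lerD2r ltW.
Qed.

Lemma poisson_primitive_le a b eta y : poisson_primitive a b eta y <= pi.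
Proof.
have h1 := ltW (atan_ltpi2 ((b - y) / eta)).
have h2 := ltW (atan_gtNpi2 ((a - y) / eta)).
rewrite /poisson_primitive; lra.
Qed.

Lemma poisson_transform_integral mu a b eta : 0 < eta -> a < b ->
  (\int[mu]_y (poisson_primitive a b eta y)%:E =
   \int[lebesgue_measure]_(x in `[a, b]) (poisson_transform mu x eta)%:E)%E.
Proof.
move=> eta0 ab; apply/esym.
have mI : measurable (`[a, b]%classic : set R) by exact: measurable_itv.
pose h (z : R * R) : \bar R :=
  ((poisson_kernel z.1 eta z.2)%:E * (\1_(`[a, b]%classic : set R) z.1)%:E)%E.
have mh : measurable_fun setT h.
  apply: emeasurable_funM.
    apply/measurable_EFinP.
    have -> : (fun z : R * R => poisson_kernel z.1 eta z.2) =
        (poisson_kernel 0 eta) \o (fun z : R * R => z.2 - z.1).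
      by apply/funext => z; rewrite /poisson_kernel/= subr0.
    apply: measurableT_comp; first exact: measurable_poisson_kernel.
    by apply: measurable_funB.
  apply/measurable_EFinP.
  have -> : (fun z : R * R => \1_(`[a, b]%classic : set R) z.1 : R) =
            \1_(fst @^-1` (`[a, b]%classic : set R)) by [].
  by apply: measurable_indic; rewrite -[X in measurable X]setTI; exact: measurable_fst.
have h0 z : (0 <= h z)%E.
  by rewrite mule_ge0// lee_fin// ltW// poisson_kernel_gt0.
rewrite integral_mkcond.
transitivity (\int[lebesgue_measure]_x \int[mu]_y h (x, y))%E.
  apply: eq_integral => x _; rewrite /h/= patchE indicE.
  case: (boolP (x \in _)) => _.
    under eq_integral => y _ do rewrite mule1.
    by rewrite poisson_transformE.
  under eq_integral => y _ do rewrite mule0.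
  by rewrite integral0.
rewrite (@fubini_tonelli _ _ _ _ _ (@lebesgue_measure R) mu h mh h0).
apply: eq_integral => y _; rewrite -integral_poisson_kernel// [RHS]integral_mkcond.
apply: eq_integral => x _; rewrite /h/= patchE indicE.
by case: (boolP (x \in _)) => _; rewrite ?mule1 ?mule0.
Qed.

Lemma cvg_atan_dilation (c : R) :
  (fun n : nat => atan (c / (n.+1%:R)^-1)) @ \oo --> Num.sg c * (pi / 2).
Proof.
have cy (u : R) : 0 < u -> atan (u / (n.+1%:R)^-1) @[n --> \oo] --> pi / 2.
  move=> u0; apply: (@cvg_comp _ _ _ (fun n : nat => u / (n.+1%:R)^-1) (@atan R) _ +oo%R);
    last exact: cvgy_atan.
  have -> : (fun n : nat => u / (n.+1%:R)^-1) = fun n => u * n.+1%:R.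
    by apply/funext => n; rewrite invrK.
  suff : (fun n : nat => u * n.+1%:R) @ \oo --> +oo by [].
  apply/cvgryPge => M; near=> n; rewrite mulrC -ler_pdivrMr//.
  apply: ltW; apply: (@lt_le_trans _ _ n%:R); last by rewrite ler_nat.
  by near: n; exact: nbhs_infty_gtr.
have [->|c0|c0] := sgrP c.
- by rewrite mul0r; apply: cvg_near_cst; near=> n; rewrite mul0r atan0.
- by rewrite mul1r; exact: cy.
- rewrite mulN1r.
  have -> : (fun n : nat => atan (c / (n.+1%:R)^-1)) = fun n => - atan ((- c) / (n.+1%:R)^-1).
    by apply/funext => n; rewrite -atanN mulNr opprK.
  by apply: cvgN; apply: cy; rewrite oppr_gt0.
Unshelve. all: by end_near. Qed.

(** For a < b, equal to pi inside the interval, pi / 2 at its end points and 0 outside. *)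
Definition poisson_primitive_lim a b y : R :=
  Num.sg (b - y) * (pi / 2) - Num.sg (a - y) * (pi / 2).

Lemma cvg_integral_poisson_primitive mu a b : a < b ->
  (\int[mu]_y (poisson_primitive a b (n.+1%:R)^-1 y)%:E @[n --> \oo] -->
   \int[mu]_y (poisson_primitive_lim a b y)%:E)%E.
Proof.
move=> ab.
have n0 (n : nat) : 0 < (n.+1%:R)^-1 :> R by rewrite invr_gt0.
apply: (@dominated_cvg _ _ _ mu setT measurableT _ _ (cst (pi : R)%:E)) => //.
- by move=> n; apply/measurable_EFinP; exact: measurable_poisson_primitive.
- move=> y _; apply: cvg_EFin; first by near=> n.
  by apply: cvgB; exact: cvg_atan_dilation.
- by apply: finite_measure_integrable_cst.
- move=> n y _; rewrite abse_EFin lee_fin ger0_norm.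
    exact: poisson_primitive_le.
  exact: poisson_primitive_ge0.
Unshelve. all: by end_near. Qed.

Lemma integral_poisson_primitive_lim mu a b : a < b ->
  mu [set a] = 0%E -> mu [set b] = 0%E ->
  (\int[mu]_y (poisson_primitive_lim a b y)%:E = (pi : R)%:E * mu `]a, b]%classic)%E.
Proof.
move=> ab a0 b0.
have msg (c : R) : measurable_fun setT (fun y : R => Num.sg (c - y)).
  rewrite (_ : (fun y => Num.sg (c - y)) =
    fun y => \1_(`]-oo, c[%classic : set R) y - \1_(`]c, +oo[%classic : set R) y).
    by apply: measurable_funB; exact: measurable_indic.
  apply/funext => y; rewrite !indicE.
  have [cy|yc|->] := ltgtP c y.
  - rewrite ltr0_sg ?subr_lt0// memNset ?mem_set ?sub0r//= in_itv/=.
      by rewrite andbT.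
    by apply/negP; rewrite -leNgt ltW.
  - rewrite gtr0_sg ?subr_gt0// mem_set ?memNset ?subr0//= in_itv/=.
    by apply/negP; rewrite andbT -leNgt ltW.
  - by rewrite subrr sgr0 !memNset ?subr0//= in_itv/= ltxx.
have -> : ((pi : R)%:E * mu `]a, b]%classic =
    \int[mu]_y ((pi : R)%:E * (\1_(`]a, b]%classic : set R) y)%:E))%E.
  rewrite ge0_integralZl//.
  - by rewrite integral_indic// setIT.
  - by apply/measurable_EFinP; exact: measurable_indic.
  - by rewrite lee_fin pi_ge0.
apply: ae_eq_integral => //.
- apply/measurable_EFinP; apply: measurable_funB; apply: measurable_funM => //;
    exact: msg.
- by apply: measurable_funeM; apply/measurable_EFinP; exact: measurable_indic.
exists ([set a] `|` [set b]); split.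
- by apply: measurableU.
- apply/eqP; rewrite eq_le measure_ge0 andbT.
  apply: (@le_trans _ _ (mu [set a] + mu [set b])%E); first exact: measureU2.
  by rewrite a0 b0 adde0.
move=> y /= h; apply: contrapT => /not_orP[ya yb]; apply: h => _.
rewrite /poisson_primitive_lim -EFinM indicE; congr EFin.
have [ay|ay|ay] := ltgtP a y; last by rewrite ay in ya.
- have [yb'|yb'|yb'] := ltgtP y b; last by rewrite yb' in yb.
  + rewrite mem_set/=; last by rewrite in_itv/= ay ltW.
    by rewrite gtr0_sg ?subr_gt0// ltr0_sg ?subr_lt0//; field.
  + rewrite memNset/=; last by rewrite in_itv/= ay/=; apply/negP; rewrite -ltNge.
    by rewrite !ltr0_sg ?subr_lt0//; ring.
- rewrite memNset/=; last by rewrite in_itv/= => /andP[]; rewrite ltNge ltW.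
  by rewrite !gtr0_sg ?subr_gt0//; [ring | exact: lt_trans ay ab].
Qed.

(** Stieltjes inversion: integrate the transform over x in [a, b] and let eta = 1 / (n + 1) tend to
    0. Without atoms the end points do not count, and half-open intervals determine the law. *)
Lemma poisson_transform_inj mu nu :
  (forall a, mu [set a] = 0%E) -> (forall a, nu [set a] = 0%E) ->
  (forall x eta, 0 < eta -> poisson_transform mu x eta = poisson_transform nu x eta) ->
  forall A : set R, measurable A -> mu A = nu A.
Proof.
move=> mu0 nu0 munu.
have oc a b : mu `]a, b]%classic = nu `]a, b]%classic.
  have [ab|ba] := ltP a b; last by rewrite set_itv_ge ?bnd_simp -?leNgt// !measure0.
  have c1 := @cvg_integral_poisson_primitive mu _ _ ab.
  have c2 := @cvg_integral_poisson_primitive nu _ _ ab.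
  have e : (fun n : nat => \int[mu]_y (poisson_primitive a b (n.+1%:R)^-1 y)%:E)%E =
           (fun n : nat => \int[nu]_y (poisson_primitive a b (n.+1%:R)^-1 y)%:E)%E.
    apply/funext => n; rewrite !poisson_transform_integral//.
    by apply: eq_integral => x _; rewrite munu.
  rewrite e in c1; have : (\int[mu]_y (poisson_primitive_lim a b y)%:E =
          \int[nu]_y (poisson_primitive_lim a b y)%:E)%E.
    by apply: (cvg_unique _ c1 c2); exact: ereal_hausdorff.
  rewrite !integral_poisson_primitive_lim// => h.
  have f1 : mu `]a, b]%classic \is a fin_num by exact: fin_num_measure.
  have f2 : nu `]a, b]%classic \is a fin_num by exact: fin_num_measure.
  move: h; rewrite -(fineK f1) -(fineK f2) -!EFinM => -[] /mulfI -> //.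
  by rewrite gt_eqF// pi_gt0.
apply: (measure_unique (@ocitv R) (fun n => `](- n%:R), n%:R]%classic)) => //.
- by move=> A B; exact: ocitvI.
- by move=> k; exact: is_ocitv.
- apply/seteqP; split => // y _; exists (Num.bound `|y|).+1 => //=.
  rewrite in_itv/=.
  have h : `|y| < (Num.bound `|y|).+1%:R.
    by apply: (lt_trans (archi_boundP (normr_ge0 y))); rewrite ltr_nat.
  by move: h; rewrite ltr_norml => /andP[-> /ltW ->].
- by move=> _ [[a b] _ <-]; exact: oc.
- by move=> k; rewrite ltey_eq fin_num_measure.
Qed.

(** The image of mu under y -> - y has the transform of mu reflected in x; boundedness excludes
    atoms, so inversion applies to both laws. *)
Lemma bounded_poisson_symmetric mu (C : R) : 0 <= C ->
  (forall x eta, 0 < eta -> poisson_transform mu x eta <= C) ->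
  (forall x eta, 0 < eta -> poisson_transform mu x eta = poisson_transform mu (- x) eta) ->
  symmetric_law mu.
Proof.
move=> C0 muC musym A mA.
have mN : measurable_fun setT (-%R : R -> R).
  by apply: continuous_measurable_fun; exact: opp_continuous.
pose X : {RV mu >-> R} := mfun_Sub (mem_set mN).
have XE x eta : 0 < eta ->
    poisson_transform (distribution mu X) x eta = poisson_transform mu (- x) eta.
  move=> eta0; rewrite /poisson_transform ge0_integral_distribution.
  - congr fine; apply: eq_integral => y _ /=; congr EFin.
    rewrite /poisson_kernel opprK.
    by have -> : - y - x = - (y + x) by [rewrite opprD]; rewrite sqrrN.
  - by apply/measurable_EFinP; exact: measurable_poisson_kernel.
  - by move=> y; rewrite lee_fin ltW// poisson_kernel_gt0.
have nuC x eta : 0 < eta -> poisson_transform (distribution mu X) x eta <= C.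
  by move=> eta0; rewrite XE// muC.
apply/esym; apply: (@poisson_transform_inj mu (distribution mu X)) => //.
- exact: bounded_poisson_set1 C0 muC.
- exact: bounded_poisson_set1 C0 nuC.
- by move=> x eta eta0; rewrite XE// musym.
Qed.

End poisson_inversion.

(** * Averaging over the weights *)

Section configurations.
Variables (R : realType) (d N : nat) (alpha tau sigma : R).
Variables (disp : measure_display) (Omega : measurableType disp).
Variables (P : probability Omega R) (G : kbrg d N alpha tau sigma P).
Hypothesis hsigma : 0 < sigma < tau - 1.
Local Notation V := (vertex d N).
Local Notation n := #|V|.
Local Notation T := ('I_n * 'I_n)%type.
Local Notation S := (weights_gt1 G).

Definition index_prob (w : Omega) (i j : 'I_n) : R :=
  connection_prob alpha sigma (weight G ^~ w) (enum_val i) (enum_val j).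

(* Only increasing pairs carry an edge; upper_prob gives probability 0 to the
   other coordinates, which symmetric_mx ignores. *)
Definition edge_config (w : Omega) : {ffun T -> bool} :=
  [ffun t : T => (t.1 < t.2)%N && edge G (enum_val t.1) (enum_val t.2) w].

Definition config_event (b : {ffun T -> bool}) : set Omega :=
  [set w | edge_config w = b].

Lemma scaled_adjacencyE (w : Omega) :
  scaled_adjacency G w =
  adjacency_mx (Num.sqrt (scaling d N alpha))^-1 (edge_config w).
Proof.
apply/matrixP => i j; rewrite !mxE !ffunE.
case: ltngtP => [//|ij|/val_inj ->] /=.
  by rewrite kbrg_edge_sym.
by rewrite kbrg_edge_irr mulr0.
Qed.

Lemma measurable_config_event b : measurable (config_event b).
Proof.
have -> : config_event b =
    \bigcap_(t in [set: T]) [set w | edge_config w t = b t].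
  apply/seteqP; split => [w /= <- //|w h /=].
  by apply/ffunP => t; exact: h.
apply: fin_bigcap_measurable => [|t _]; first exact: finite_finset.
have [tlt|tge] := boolP (t.1 < t.2)%N.
  have -> : [set w | edge_config w t = b t] =
      edge G (enum_val t.1) (enum_val t.2) @^-1` [set b t].
    by apply/seteqP; split => w /=; rewrite ffunE tlt.
  by rewrite -[X in measurable X]setTI; exact: measurable_funPT.
have [bt|bt] := eqVneq false (b t).
  have -> : [set w | edge_config w t = b t] = setT.
    by apply/seteqP; split => w //= _; rewrite ffunE (negbTE tge).
  exact: measurableT.
have -> : [set w | edge_config w t = b t] = set0.
  by apply/seteqP; split => w //=; rewrite ffunE (negbTE tge)/= => /eqP; rewrite (negbTE bt).
exact: measurable0.
Qed.

(** Rewrites [kbrg_edge_law], a product over increasing pairs of vertices, as a Bernoulli product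
    over all pairs of indices. A bit set on or below the diagonal makes both sides 0; the unset ones
    contribute factors 1. *)
Lemma config_event_law b :
  P (S `&` config_event b) =
  (\int[P]_(w in S) (bernoulli_weight (upper_prob (index_prob w)) b)%:E)%E.
Proof.
have [supp|/forallPn/=[t]] :=
    boolP [forall t : T, ~~ (t.1 < t.2)%N ==> ~~ b t]; last first.
  rewrite negb_imply negbK => /andP[tge bt].
  have -> : config_event b = set0.
    apply/seteqP; split => w //= wb; move: bt; rewrite -wb ffunE.
    by rewrite (negbTE tge).
  rewrite setI0 measure0; under eq_integral => w _.
    have -> : bernoulli_weight (upper_prob (index_prob w)) b = 0.
      by rewrite /bernoulli_weight (bigD1 t)//= bt /upper_prob (negbTE tge) mul0r.
    over.
  by rewrite integral0.
have {}supp (t : T) : ~~ (t.1 < t.2)%N -> b t = false.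
  by move=> tge; have /forallP/(_ t)/implyP/(_ tge)/negbTE := supp.
pose e : rel V := fun i j => b (enum_rank i, enum_rank j).
have := @kbrg_edge_law _ _ _ _ _ _ _ _ _ G e S (@sigma_algebra_weights_gt1 _ _ _ _ _ _ _ _ _ G).
have -> : [set w | forall i j : V, (enum_rank i < enum_rank j)%N ->
     edge G i j w = e i j] = config_event b.
  apply/seteqP; split => w /= h.
    apply/ffunP => -[i j]; rewrite ffunE/=.
    have [ij|ij] := boolP (i < j)%N; last by rewrite supp.
    by rewrite /= h ?enum_valK// /e !enum_valK.
  by move=> i j ij; rewrite /e -h ffunE/= ij !enum_rankK.
move=> ->; apply: eq_integral => w _; congr EFin.
rewrite /bernoulli_weight (bigID (fun t : T => t.1 < t.2)%N)/= [X in _ = _ * X]big1 ?mulr1.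
  rewrite (reindex_onto (fun t : T => (enum_val t.1, enum_val t.2))
    (fun q : V * V => (enum_rank q.1, enum_rank q.2)))/=; last first.
    by case=> i j _ /=; rewrite !enum_rankK.
  apply: eq_big => [[i j]|[i j]] /=; first by rewrite !enum_valK eqxx andbT.
  rewrite !enum_valK /e /upper_prob /= => /andP[-> _].
  by rewrite !enum_valK.
by move=> t tge; rewrite supp// /upper_prob (negbTE tge) subr0.
Qed.

Lemma index_prob01 w : S w -> forall i j, 0 <= index_prob w i j <= 1.
Proof. by move=> Sw i j; exact: connection_prob_bounds. Qed.

Lemma index_prob_sym w i j : index_prob w i j = index_prob w j i.
Proof. exact: connection_prob_sym. Qed.

Lemma measurable_index_prob i j : measurable_fun setT (fun w => index_prob w i j).
Proof. exact: measurable_connection_prob. Qed.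

Lemma measurable_bernoulli_weight b :
  measurable_fun setT (fun w => bernoulli_weight (upper_prob (index_prob w)) b).
Proof.
apply: measurable_prod => t _; rewrite /upper_prob.
case: (b t); case: (t.1 < t.2)%N => //=.
  exact: measurable_index_prob.
by apply: measurable_funB => //; exact: measurable_index_prob.
Qed.

(** Expectation of Psi of the edges under the joint law, as a finite sum, so that an arbitrary real
    function Psi can be averaged. *)
Definition config_mean (Psi : {ffun T -> bool} -> R) : R :=
  \sum_b Psi b * fine (P (config_event b)).

Lemma config_event_gt1 b : P (S `&` config_event b) = P (config_event b).
Proof.
have mS := measurable_weights_gt1 G; have mb := measurable_config_event b.
have P0 : P (~` S) = 0%E.
  rewrite probability_setC//.
  by rewrite (probability_weights_gt1 G) subee.
have -> : P (config_event b) = (P (config_event b `&` S) + P (config_event b `&` ~` S))%E.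
  rewrite -measureU//; first by rewrite -setIUr setUv setIT.
  - exact: measurableI.
  - by apply: measurableI => //; exact: measurableC.
  - by rewrite setIACA setICr setI0.
rewrite [X in (_ + X)%E](_ : _ = 0%E) ?adde0 1?setIC//.
apply/eqP; rewrite eq_le measure_ge0 andbT -P0.
apply: le_measure; rewrite ?inE//.
- by apply: measurableI => //; exact: measurableC.
- exact: measurableC.
Qed.

(** Tower property: the joint expectation is the average over the weights of the conditional one. *)
Lemma config_meanE (Psi : {ffun T -> bool} -> R) : (forall b, 0 <= Psi b) ->
  (config_mean Psi)%:E =
  (\int[P]_(w in S) (bernoulli_mean (upper_prob (index_prob w)) Psi)%:E)%E.
Proof.
move=> Psi0; have mS := measurable_weights_gt1 G.
have w0 w b : S w -> 0 <= bernoulli_weight (upper_prob (index_prob w)) b.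
  by move=> Sw; apply: bernoulli_weight_ge0; apply: upper_prob01; exact: index_prob01.
rewrite /bernoulli_mean; under eq_integral => w _ do rewrite -sumEFin.
have mb b : measurable_fun S
    (fun w => (bernoulli_weight (upper_prob (index_prob w)) b * Psi b)%:E).
  apply: measurable_funTS; apply/measurable_EFinP; apply: measurable_funM => //.
  exact: measurable_bernoulli_weight.
rewrite ge0_integral_sum//; last by move=> b w Sw; rewrite lee_fin mulr_ge0 ?w0.
rewrite /config_mean -sumEFin; apply: eq_bigr => b _.
under eq_integral => w _ do rewrite EFinM muleC.
rewrite ge0_integralZl//; last 3 first.
- apply: measurable_funTS; apply/measurable_EFinP; exact: measurable_bernoulli_weight.
- by move=> w Sw; rewrite lee_fin w0.
- by rewrite lee_fin.
rewrite -config_event_law config_event_gt1 EFinM fineK// fin_num_measure//.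
exact: measurable_config_event.
Qed.

(** Any predicate of the edges is allowed, in particular a bound on the Levy-Prokhorov distance: its
    event is a finite union of configuration events. Measurability is carried along the induction
    for the sake of additivity. *)
Lemma sum_config_event (D : pred {ffun T -> bool}) :
  (\sum_(b | D b) P (config_event b))%E = P [set w | D (edge_config w)].
Proof.
have mD (r : seq {ffun T -> bool}) :
    measurable [set w | (edge_config w \in r) && D (edge_config w)] /\
    (uniq r -> (\sum_(b <- r | D b) P (config_event b))%E =
      P [set w | (edge_config w \in r) && D (edge_config w)]).
  elim: r => [|b r [mr IH]].
    have -> : [set w | (edge_config w \in [::]) && D (edge_config w)] = set0.
      by apply/seteqP; split.
    by split => [|_]; [exact: measurable0|rewrite big_nil measure0].
  have mb := measurable_config_event b.
  have [Db|Db] := boolP (D b).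
    have -> : [set w | (edge_config w \in b :: r) && D (edge_config w)] =
        config_event b `|` [set w | (edge_config w \in r) && D (edge_config w)].
      apply/seteqP; split => w /=; rewrite inE.
        by case: eqP => [|_ /= h]; [left|right].
      by case=> [->|/andP[-> ->]]; rewrite ?eqxx ?orbT.
    split=> [|/= /andP[br ur]]; first exact: measurableU.
    rewrite big_cons Db IH// measureU//.
    apply/seteqP; split => w //= [wb /andP[]].
    by rewrite wb (negbTE br).
  have -> : [set w | (edge_config w \in b :: r) && D (edge_config w)] =
      [set w | (edge_config w \in r) && D (edge_config w)].
    apply/seteqP; split => w /=; rewrite inE; last by move=> /andP[-> ->]; rewrite orbT.
    by case: eqP => [->|_ //]; rewrite (negbTE Db) andbF.
  by split=> [//|/= /andP[_ ur]]; rewrite big_cons (negbTE Db) IH.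
have [_] := mD (index_enum _); rewrite -/(index_enum _) => ->; last exact: index_enum_uniq.
by congr (P _); apply/seteqP; split => w /=; rewrite mem_index_enum.
Qed.

End configurations.

Section annealing.
Variables (R : realType) (d N : nat) (alpha tau sigma : R).
Variables (disp : measure_display) (Omega : measurableType disp).
Variables (P : probability Omega R) (G : kbrg d N alpha tau sigma P).
Hypothesis hsigma : 0 < sigma < tau - 1.
Local Notation V := (vertex d N).
Local Notation n := #|V|.
Local Notation T := ('I_n * 'I_n)%type.
Local Notation S := (weights_gt1 G).
Local Notation E w := (bernoulli_mean (upper_prob (index_prob G w))).

Definition power_density (s : R) (w : Omega) : R :=
  n%:R^-1 * \sum_(i : 'I_n) \sum_(j : 'I_n | j != i) index_prob G w i j `^ s.

Lemma power_density_ge0 s w : 0 <= power_density s w.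
Proof.
rewrite /power_density mulr_ge0 ?invr_ge0//.
by apply: sumr_ge0 => i _; apply: sumr_ge0 => j _; exact: powR_ge0.
Qed.

Lemma measurable_power_density s : measurable_fun setT (power_density s).
Proof.
apply: measurable_funM => //; apply: measurable_sum => i.
under eq_fun => w do rewrite big_mkcond.
apply: measurable_sum => j; case: (j != i) => //.
apply: measurableT_comp (measurable_powR s) _; exact: measurable_index_prob.
Qed.

Lemma integral_power_density_le s : 0 < s < tau - 1 -> sigma * s < tau - 1 ->
  (\int[P]_(w in S) (power_density s w)%:E <=
   (connection_moment tau sigma s * scaling d N (alpha * s))%:E)%E.
Proof.
move=> s_tau sigs_tau; have mS := measurable_weights_gt1 G.
have mp i j : measurable_fun S
    (fun w => (if j != i then (index_prob G w i j `^ s)%:E else 0)%E).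
  apply: measurable_funTS; case: (j != i) => //; apply/measurable_EFinP.
  apply: measurableT_comp (measurable_powR s) _; exact: measurable_index_prob.
have p0 i j w : (0 <= if j != i then (index_prob G w i j `^ s)%:E else 0)%E.
  by case: ifP => // _; rewrite lee_fin powR_ge0.
have -> : (\int[P]_(w in S) (power_density s w)%:E =
    (n%:R^-1)%:E * \sum_(i : 'I_n) \sum_(j : 'I_n)
      \int[P]_(w in S) (if j != i then (index_prob G w i j `^ s)%:E else 0))%E.
  under eq_integral => w _.
    rewrite /power_density EFinM -sumEFin.
    under eq_bigr => i _ do rewrite -sumEFin big_mkcond/=.
    over.
  rewrite ge0_integralZl//; last 2 first.
  - by apply: emeasurable_sum => i; apply: emeasurable_sum => j; exact: mp.
  - by move=> w _; apply: sume_ge0 => i _; apply: sume_ge0 => j _; exact: p0.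
  rewrite ge0_integral_sum//; last 2 first.
  - by move=> i; apply: emeasurable_sum => j; exact: mp.
  - by move=> i w _; apply: sume_ge0 => j _; exact: p0.
  congr (_ * _)%E; apply: eq_bigr => i _; rewrite ge0_integral_sum//.
have -> : connection_moment tau sigma s * scaling d N (alpha * s) =
    n%:R^-1 * \sum_(i : 'I_n) \sum_(j : 'I_n) if j != i then
      connection_moment tau sigma s *
      (torus_dist (enum_val i) (enum_val j))%:R `^ (- (alpha * s)) else 0.
  rewrite /scaling -card_vertex mulrCA; congr (_ * _); rewrite mulr_sumr.
  rewrite (reindex (@enum_val _ V))/=; last first.
    by exists enum_rank => i _; rewrite ?enum_rankK ?enum_valK.
  apply: eq_bigr => i _; rewrite mulr_sumr -big_mkcond/=.
  rewrite (reindex (@enum_val _ V))/=; last first.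
    by exists enum_rank => j _; rewrite ?enum_rankK ?enum_valK.
  by apply: eq_bigl => j; rewrite (inj_eq enum_val_inj).
rewrite EFinM lee_wpmul2l ?lee_fin ?invr_ge0//.
rewrite -sumEFin; apply: lee_sum => i _; rewrite -sumEFin; apply: lee_sum => j _.
case: ifPn => [ji|_]; last by rewrite integral0.
apply: integral_connection_prob_le => //.
by rewrite eq_sym (inj_eq enum_val_inj).
Qed.

Lemma edge_densityE a w : S w ->
  edge_density a (index_prob G w) = a ^+ 2 * power_density 1 w.
Proof.
move=> Sw; rewrite /edge_density mulrCA; congr (_ * (_ * _)).
apply: eq_bigr => i _; apply: eq_bigr => j _; rewrite powRr1//.
by have /andP[] := index_prob01 hsigma Sw i j.
Qed.

(** As 0 <= p <= 1, the square may be weakened to the power s, whose moments remain finite for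
    suitable s even when those of order 2 of the weights do not. *)
Lemma sqr_density_le a s w : S w -> s <= 2 ->
  sqr_density a (index_prob G w) <= a ^+ 2 * power_density s w.
Proof.
move=> Sw s2; rewrite /sqr_density mulrCA ler_wpM2l ?sqr_ge0// ler_wpM2l ?invr_ge0//.
apply: ler_sum => i _; apply: ler_sum => j ji.
have /andP[p0 p1] := index_prob01 hsigma Sw i j.
rewrite -powR_mulrn//.
have [->|p0'] := eqVneq (index_prob G w i j) 0.
  by rewrite powR0 ?pnatr_eq0// powR_ge0.
by rewrite ger_powR// lt0r p0' p0.
Qed.

(** Turns an inequality conditional on the weights into one for joint expectations; it serves both
    the uniform bound, with Psi2 = 0, and the reflection inequality. *)
Lemma config_mean_le (Psi1 Psi2 : {ffun T -> bool} -> R) (a A B1 B2 s : R) :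
  (forall b, 0 <= Psi1 b) -> (forall b, 0 <= Psi2 b) ->
  0 <= A -> 0 <= B1 -> 0 <= B2 -> 2 < tau -> 0 < s <= 2 -> s < tau - 1 ->
  sigma * s < tau - 1 ->
  (forall w, S w -> E w Psi1 <= E w Psi2 + A +
    B1 * edge_density a (index_prob G w) + B2 * sqr_density a (index_prob G w)) ->
  config_mean G Psi1 <= config_mean G Psi2 + A +
    B1 * (a ^+ 2 * (connection_moment tau sigma 1 * scaling d N alpha)) +
    B2 * (a ^+ 2 * (connection_moment tau sigma s * scaling d N (alpha * s))).
Proof.
move=> Psi10 Psi20 A0 B10 B20 tau2 /andP[s0 s2] stau sigs h.
have mS := measurable_weights_gt1 G.
have mE (Psi : {ffun T -> bool} -> R) : measurable_fun S (fun w => (E w Psi)%:E).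
  apply: measurable_funTS; apply/measurable_EFinP; apply: measurable_sum => b.
  by apply: measurable_funM => //; exact: measurable_bernoulli_weight.
have mD r : measurable_fun S (fun w => (power_density r w)%:E).
  by apply: measurable_funTS; apply/measurable_EFinP; exact: measurable_power_density.
have E0 w (Psi : {ffun T -> bool} -> R) : (forall b, 0 <= Psi b) -> S w -> 0 <= E w Psi.
  by move=> Psi0 Sw; apply: bernoulli_mean_ge0 => //; apply: upper_prob01; exact: index_prob01.
rewrite -lee_fin !EFinD (config_meanE G hsigma Psi10).
apply: (@le_trans _ _ (\int[P]_(w in S) ((E w Psi2)%:E + (A%:E +
    ((B1 * a ^+ 2)%:E * (power_density 1 w)%:E +
     (B2 * a ^+ 2)%:E * (power_density s w)%:E))))%E).
  apply: ge0_le_integral => //.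
  - by move=> w Sw; rewrite lee_fin E0.
  - apply: emeasurable_funD => //; apply: emeasurable_funD => //.
    by apply: emeasurable_funD; apply: emeasurable_funM.
  - move=> w Sw; rewrite -!EFinM -!EFinD lee_fin; apply: (le_trans (h _ Sw)).
    rewrite edge_densityE// !addrA -(mulrA B1) -(mulrA B2) lerD2l.
    by apply: ler_wpM2l => //; exact: sqr_density_le.
have c0 r w : S w -> forall B, 0 <= B -> (0 <= (B * a ^+ 2)%:E * (power_density r w)%:E)%E.
  by move=> Sw B B0; rewrite -EFinM lee_fin (mulr_ge0 (mulr_ge0 B0 (sqr_ge0 a)))//
    power_density_ge0.
have c00 w : S w -> (0 <= (B1 * a ^+ 2)%:E * (power_density 1 w)%:E +
    (B2 * a ^+ 2)%:E * (power_density s w)%:E)%E.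
  by move=> Sw; apply: adde_ge0; exact: c0.
rewrite ge0_integralD//; last 3 first.
- by move=> w Sw; rewrite lee_fin E0.
- by move=> w Sw; apply: adde_ge0; rewrite ?lee_fin//; exact: c00.
- apply: emeasurable_funD => //.
  by apply: emeasurable_funD; apply: emeasurable_funM.
rewrite -(config_meanE G hsigma Psi20) -!addeA; apply: leeD => //.
rewrite ge0_integralD//; last first.
- by apply: emeasurable_funD; apply: emeasurable_funM.
rewrite integral_cst//= probability_weights_gt1 mule1; apply: leeD => //.
rewrite ge0_integralD//; last 4 first.
- by move=> w Sw; exact: c0.
- exact: emeasurable_funM.
- by move=> w Sw; exact: c0.
- exact: emeasurable_funM.
have tau1 : 0 < (1 : R) < tau - 1 by rewrite ltr01 ltrBrDl.
have s_tau : 0 < s < tau - 1 by rewrite s0.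
have B0 B : 0 <= B -> (0 <= (B * a ^+ 2)%:E)%E.
  by move=> ?; rewrite lee_fin mulr_ge0// sqr_ge0.
have pd0 r w : S w -> (0 <= (power_density r w)%:E)%E.
  by move=> _; rewrite lee_fin power_density_ge0.
apply: leeD; rewrite ge0_integralZl ?B0//; try exact: pd0.
- rewrite mulrA (EFinM (B1 * a ^+ 2)); apply: lee_wpmul2l; first exact: B0.
  rewrite -[in leRHS](mulr1 alpha) integral_power_density_le// mulr1.
  by case/andP: hsigma.
- rewrite mulrA (EFinM (B2 * a ^+ 2)); apply: lee_wpmul2l; first exact: B0.
  exact: integral_power_density_le.
Qed.

End annealing.

(** * Bounds for the graph of a given size *)

Section graph_of_given_size.
Variables (R : realType) (d N : nat) (alpha tau sigma : R).
Variables (disp : measure_display) (Omega : measurableType disp).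
Variables (P : probability Omega R) (G : kbrg d N alpha tau sigma P).
Hypotheses (d0 : (0 < d)%N) (N1 : (1 < N)%N) (halpha : 0 < alpha < d%:R).
Hypotheses (tau2 : 2 < tau) (hsigma : 0 < sigma < tau - 1).
Local Notation V := (vertex d N).
Local Notation n := #|V|.
Local Notation T := ('I_n * 'I_n)%type.
Local Notation S := (weights_gt1 G).
Local Notation sc := (scaling d N).
Local Notation a := (Num.sqrt (sc alpha))^-1.

Definition stieltjes_mean (x eta : R) : R :=
  config_mean G (fun b => mean_Im_resolvent x eta (adjacency_mx a b)).

Let alpha0 : 0 < alpha. Proof. by case/andP: halpha. Qed.

Let n0 : (0 < n)%N. Proof. by rewrite card_vertex expn_gt0 ltnW. Qed.

Lemma scaling_gt0 (beta : R) : 0 <= beta -> 0 < sc beta.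
Proof.
move=> b0; apply: lt_le_trans (scaling_ge d0 b0 N1).
by rewrite !mulr_gt0 ?invr_gt0 ?powR_gt0 ?ltr0n// ltnW.
Qed.

Let a_sqr : a ^+ 2 = (sc alpha)^-1.
Proof. by rewrite exprVn sqr_sqrtr// ltW// scaling_gt0// ltW. Qed.

Let a_gt0 : 0 < a. Proof. by rewrite invr_gt0 sqrtr_gt0 scaling_gt0// ltW. Qed.

Let mean_ge0 x eta (b : {ffun T -> bool}) : 0 < eta ->
  0 <= mean_Im_resolvent x eta (adjacency_mx a b).
Proof. by move=> eta0; apply: mean_Im_resolvent_ge0 => //; exact: symmetric_mx_tr. Qed.

(* Quotient of the lower bound (d N)^(-alpha) on the connection probabilities by
   the upper bound scaling_le on c_N, up to a power of N. *)
Definition connection_constant (d' : nat) (alpha' : R) : R :=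
  d'%:R `^ (- alpha') / (6 / (1 - alpha' / d'%:R)) ^+ d'.

Lemma connection_constant_gt0 : 0 < connection_constant d alpha.
Proof.
have /andP[_ ad] := halpha; have dR : 0 < d%:R :> R by rewrite ltr0n.
by rewrite divr_gt0 ?powR_gt0// exprn_gt0// divr_gt0// subr_gt0 ltr_pdivrMr// mul1r.
Qed.

Lemma scaled_connection_prob_ge w : S w -> forall i j : 'I_n, i != j ->
  connection_constant d alpha / n%:R <= a ^+ 2 * index_prob G w i j.
Proof.
move=> Sw i j ij; rewrite a_sqr.
have /andP[_ ad] := halpha; have dR : 0 < d%:R :> R by rewrite ltr0n.
have NR : 0 < N%:R :> R by rewrite ltr0n ltnW.
have vij : (enum_val i : V) != enum_val j by rewrite (inj_eq enum_val_inj).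
have h1 := connection_prob_ge alpha0 hsigma Sw vij.
have C0 : 0 < (6 / (1 - alpha / d%:R)) ^+ d.
  by rewrite exprn_gt0// divr_gt0// subr_gt0 ltr_pdivrMr// mul1r.
have h2 := scaling_le d0 halpha (ltnW N1).
have h3 : (d * N)%:R `^ (- alpha) <= (torus_dist (enum_val i) (enum_val j : V))%:R `^ (- alpha).
  by apply: ler_powRN; rewrite ?ltr0n ?torus_dist_gt0 ?ler_nat ?torus_dist_le// ltW.
have h4 := le_trans h3 h1; rewrite -/(index_prob G w i j) in h4.
have sc0 : 0 < sc alpha by rewrite scaling_gt0// ltW.
rewrite [leRHS]mulrC ler_pdivlMr//; apply: le_trans h4.
rewrite natrM powRM ?ler0n// card_vertex natrX /connection_constant.
have -> : N%:R `^ (- alpha) = N%:R `^ (d%:R - alpha) / N%:R ^+ d :> R.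
  by rewrite powRD ?lt0r_neq0 ?implybT// powR_mulrn ?ltW// mulrAC divff ?mul1r//
    expf_neq0 ?lt0r_neq0.
have Nd0 : 0 < N%:R ^+ d :> R by rewrite exprn_gt0.
have Np0 : 0 < d%:R `^ (- alpha) :> R by rewrite powR_gt0.
rewrite -!mulrA ler_pM2l// [_ * (_ * _)]mulrCA [leRHS]mulrC ler_pM2l ?invr_gt0//.
by rewrite ler_pdivrMl.
Qed.

Section bounds.
Variables (x eta s del : R).
Hypotheses (eta0 : 0 < eta) (del0 : 0 < del).
Hypotheses (s02 : 0 < s <= 2) (stau : s < tau - 1) (sigs : sigma * s < tau - 1).
Local Notation e := eta^-1.
Local Notation M := (connection_moment tau sigma).

Lemma stieltjes_mean_le : 1 <= sc alpha ->
  stieltjes_mean x eta <= 1 + 2 / connection_constant d alpha +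
    6 * e ^+ 3 * (sc alpha)^-1 + connection_constant d alpha * e ^+ 3 / n%:R +
    del / 2 * e ^+ 2 +
    (6 * e ^+ 4 + 24 * e ^+ 5) * a * M 1 +
    (e ^+ 3 + (2 * del)^-1 * e ^+ 2) * (M s * (sc (alpha * s) / sc alpha)).
Proof.
move=> sc1; set c := connection_constant d alpha.
have c0 : 0 < c := connection_constant_gt0.
have e0 : 0 < e by rewrite invr_gt0.
have sc0 : 0 < sc alpha by rewrite scaling_gt0// ltW.
have a01 : 0 <= a <= 1.
  rewrite (ltW a_gt0)/= invf_le1 ?sqrtr_gt0//.
  by have := ler_wsqrtr sc1; rewrite sqrtr1.
pose A : R := 1 + 2 / c + 6 * e ^+ 3 * (sc alpha)^-1 + c * e ^+ 3 / n%:R +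
  del / 2 * e ^+ 2.
have A0 : 0 <= A.
  by rewrite /A; do ![exact: ltW|exact: ler0n|exact: ler01|rewrite invr_ge0|
    apply: exprn_ge0|apply: mulr_ge0|apply: addr_ge0].
have B10 : 0 <= (6 * e ^+ 4 + 24 * e ^+ 5) * a.
  by rewrite mulr_ge0 ?(ltW a_gt0)// addr_ge0// mulr_ge0// exprn_ge0// ltW.
have B20 : 0 <= e ^+ 3 + (2 * del)^-1 * e ^+ 2.
  by rewrite addr_ge0// ?mulr_ge0 ?invr_ge0 ?mulr_ge0 ?exprn_ge0// ltW.
have := config_mean_le (G := G) hsigma (Psi2 := fun=> 0) (a := a) (fun b => mean_ge0 x b eta0)
  (fun=> lexx 0) A0 B10 B20 tau2 s02 stau sigs _.
rewrite /stieltjes_mean; have -> : config_mean G (fun=> 0) = 0.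
  by rewrite /config_mean big1// => b _; rewrite mul0r.
rewrite add0r a_sqr.
have -> : (sc alpha)^-1 * (M 1 * sc alpha) = M 1 by field; exact: lt0r_neq0.
have -> : (sc alpha)^-1 * (M s * sc (alpha * s)) = M s * (sc (alpha * s) / sc alpha).
  by rewrite mulrC mulrA.
apply=> w Sw; rewrite bernoulli_mean_cst add0r.
have p01 := index_prob01 hsigma Sw; have psym := index_prob_sym G w.
have cp := scaled_connection_prob_ge Sw.
have := mean_Im_centered_le x eta0 a01 p01 psym n0 c0 cp.
have := mean_Im_adjacency_dist x a eta0 p01 psym n0 del0.
rewrite ler_norml => /andP[_]; rewrite lerBlDr => h1 h2.
apply: (le_trans h1); apply: (le_trans (lerD (lexx _) h2)).
by rewrite /A a_sqr le_eqVlt; apply/orP; left; apply/eqP; ring.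
Qed.

Lemma stieltjes_mean_reflect :
  stieltjes_mean x eta <= stieltjes_mean (- x) eta + del * e ^+ 2 +
    16 * e ^+ 4 * a * M 1 +
    del^-1 * e ^+ 2 * (M s * (sc (alpha * s) / sc alpha)).
Proof.
have e0 : 0 < e by rewrite invr_gt0.
have sc0 : 0 < sc alpha by rewrite scaling_gt0// ltW.
have A0 : 0 <= del * e ^+ 2 by rewrite mulr_ge0 ?exprn_ge0// ltW.
have B10 : 0 <= 16 * e ^+ 4 * a by rewrite !mulr_ge0 ?exprn_ge0// ltW// a_gt0.
have B20 : 0 <= del^-1 * e ^+ 2 by rewrite mulr_ge0 ?invr_ge0 ?exprn_ge0// ltW.
have := config_mean_le (G := G) hsigma (a := a) (fun b => mean_ge0 x b eta0)
  (fun b => mean_ge0 (- x) b eta0) A0 B10 B20 tau2 s02 stau sigs _.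
rewrite /stieltjes_mean a_sqr.
have -> : (sc alpha)^-1 * (M 1 * sc alpha) = M 1 by field; exact: lt0r_neq0.
have -> : (sc alpha)^-1 * (M s * sc (alpha * s)) = M s * (sc (alpha * s) / sc alpha).
  by rewrite mulrC mulrA.
apply=> w Sw.
have p01 := index_prob01 hsigma Sw; have psym := index_prob_sym G w.
have := mean_Im_adjacency_reflect x eta0 (ltW a_gt0) p01 psym n0 del0.
by move/le_trans; apply; rewrite le_eqVlt; apply/orP; left; apply/eqP; ring.
Qed.

(** Configurations at Levy-Prokhorov distance at most eps contribute the deterministic tolerance;
    the others contribute their probability times the trivial bound |I| + 1 / eta. *)
Lemma stieltjes_mean_dist (mu : probability R R) (eps : R) (m : nat) :
  (0 < m)%N -> 0 < eps -> 2 * eps <= eta ^+ 2 * (eta^-1 / m%:R) ->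
  `|poisson_transform mu x eta - stieltjes_mean x eta| <=
  (2 + eta) * (eta^-1 / m%:R) + (`|poisson_transform mu x eta| + e) *
  fine (P [set w | eps < levy_prokhorov (esd (scaled_adjacency G w)) mu]).
Proof.
move=> m0 eps0 epsm; set I := poisson_transform mu x eta; set tol := (2 + eta) * _.
have tol0 : 0 <= tol.
  by rewrite /tol !mulr_ge0 ?addr_ge0 ?invr_ge0 ?ler0n// ltW.
pose D (b : {ffun T -> bool}) := eps < levy_prokhorov (esd (adjacency_mx a b)) mu.
pose Y (b : {ffun T -> bool}) := mean_Im_resolvent x eta (adjacency_mx a b).
have sY b : (adjacency_mx a b)^T = adjacency_mx a b by exact: symmetric_mx_tr.
have Y_le b : Y b <= e.
  rewrite /Y mean_Im_resolvent_poisson// ler_pdivrMl ?ltr0n//.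
  have -> : n%:R * e = \sum_(i < n) e by rewrite sumr_const card_ord mulr_natl.
  apply: ler_sum => i _; exact: poisson_kernel_le.
pose q b := fine (P (config_event G b)).
have q0 b : 0 <= q b by rewrite fine_ge0.
have qE (F : pred {ffun T -> bool}) :
    \sum_(b | F b) q b = fine (P [set w | F (edge_config G w)]).
  rewrite -sum_config_event /q sum_fine// => b _.
  by rewrite fin_num_measure//; exact: measurable_config_event.
have q1 : \sum_b q b = 1.
  by rewrite (qE predT) (_ : [set w | _] = setT) ?probability_setT//; apply/seteqP; split.
have -> : [set w | eps < levy_prokhorov (esd (scaled_adjacency G w)) mu] =
    [set w | D (edge_config G w)].
  by apply/seteqP; split => w /=; rewrite scaled_adjacencyE.
rewrite -qE mulr_sumr.
have -> : I - stieltjes_mean x eta = \sum_b (I - Y b) * q b.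
  rewrite /stieltjes_mean /config_mean -[I in LHS]mulr1 -q1 mulr_sumr -sumrB.
  by apply: eq_bigr => b _; rewrite mulrBl.
apply: (le_trans (ler_norm_sum _ _ _)).
rewrite (bigID D)/= addrC; apply: lerD.
  apply: (@le_trans _ _ (\sum_(b | ~~ D b) tol * q b)).
    apply: ler_sum => b Db; rewrite normrM (ger0_norm (q0 b)) ler_wpM2r//.
    by apply: levy_prokhorov_poisson epsm _ => //; rewrite leNgt.
  rewrite -mulr_sumr -[leRHS]mulr1 ler_wpM2l// -q1 [leRHS](bigID D)/= lerDr.
  exact: sumr_ge0.
apply: ler_sum => b _; rewrite normrM (ger0_norm (q0 b)) ler_wpM2r//.
apply: (le_trans (ler_normB _ _)); rewrite lerD2l ger0_norm//.
exact: mean_ge0.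
Qed.

End bounds.
End graph_of_given_size.

(** * Passage to the limit *)

Section limits.
Variables (R : realType).

Lemma scaling_ge0 (d N : nat) (beta : R) : 0 <= scaling d N beta.
Proof.
rewrite mulr_ge0 ?invr_ge0//.
by apply: sumr_ge0 => i _; apply: sumr_ge0 => j _; exact: powR_ge0.
Qed.

Lemma cvg_powRN (r : R) : 0 < r -> (N%:R `^ (- r) : R) @[N --> \oo] --> (0 : R).
Proof.
move=> r0; apply/cvgrPdist_lt => e e0.
have := nbhs_infty_gtr (e `^ (- r^-1)); apply: filterS => N hN.
rewrite sub0r normrN ger0_norm ?powR_ge0//.
have N0 : 0 < N%:R :> R by apply: le_lt_trans hN; exact: powR_ge0.
have h : (e `^ (- r^-1)) `^ r < N%:R `^ r.
  by apply: gt0_ltr_powR => //; rewrite nnegrE ?powR_ge0// ltW.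
rewrite -powRrM mulNr mulVf ?lt0r_neq0// powR_inv1 ?(ltW e0)// in h.
by rewrite powRN invf_plt// ?posrE// powR_gt0.
Qed.

Lemma cvg_inv_scaling (d : nat) (alpha : R) : (0 < d)%N -> 0 < alpha < d%:R ->
  (scaling d N alpha)^-1 @[N --> \oo] --> (0 : R).
Proof.
move=> d0 /andP[a0 ad]; set k : R := 2^-1 * d%:R `^ (- alpha).
have k0 : 0 < k by rewrite mulr_gt0 ?invr_gt0// powR_gt0// ltr0n.
apply: (@squeeze_cvgr _ _ _ _ (fun=> 0) (fun N => k^-1 * N%:R `^ (- (d%:R - alpha)))).
- near=> N; have N1 : (1 < N)%N by near: N; exact: nbhs_infty_gt.
  have sc0 := scaling_gt0 d0 N1 (ltW a0).
  rewrite invr_ge0 ltW//= powRN -invfM lef_pV2 ?posrE//.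
    exact: scaling_ge d0 (ltW a0) N1.
  by rewrite mulr_gt0// powR_gt0// ltr0n ltnW.
- exact: cvg_cst.
- rewrite -[X in _ --> X](mulr0 k^-1); apply: cvgM; first exact: cvg_cst.
  by apply: cvg_powRN; rewrite subr_gt0.
Unshelve. all: by end_near. Qed.

Lemma cvg_inv_sqrt_scaling (d : nat) (alpha : R) : (0 < d)%N -> 0 < alpha < d%:R ->
  (Num.sqrt (scaling d N alpha))^-1 @[N --> \oo] --> (0 : R).
Proof.
move=> d0 halpha; rewrite -[X in _ --> X](@sqrtr0 R).
have -> : (fun N => (Num.sqrt (scaling d N alpha))^-1) =
    (fun N => Num.sqrt (scaling d N alpha)^-1) :> (nat -> R).
  by apply/funext => N; rewrite sqrtrV// scaling_ge0.
apply: (@continuous_cvg _ _ _ _ _ _ Num.sqrt); first exact: sqrt_continuous.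
exact: cvg_inv_scaling.
Qed.

(** For exponents beta in ]0, d[ the scaling is of order N^(d - beta), so the ratio decays like
    N^(alpha - alpha s). *)
Lemma cvg_scaling_ratio (d : nat) (alpha s : R) : (0 < d)%N -> 0 < alpha < d%:R ->
  1 < s -> alpha * s < d%:R ->
  scaling d N (alpha * s) / scaling d N alpha @[N --> \oo] --> (0 : R).
Proof.
move=> d0 /andP[a0 ad] s1 asd; set k : R := 2^-1 * d%:R `^ (- alpha).
have k0 : 0 < k by rewrite mulr_gt0 ?invr_gt0// powR_gt0// ltr0n.
have as0 : 0 < alpha * s by rewrite mulr_gt0// (lt_trans ltr01).
set K : R := (6 / (1 - alpha * s / d%:R)) ^+ d.
apply: (@squeeze_cvgr _ _ _ _ (fun=> 0) (fun N => K / k * N%:R `^ (- (alpha * s - alpha)))).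
- near=> N; have N1 : (1 < N)%N by near: N; exact: nbhs_infty_gt.
  have N0 : 0 < N%:R :> R by rewrite ltr0n ltnW.
  have sc0 := scaling_gt0 d0 N1 (ltW a0).
  have scs0 := scaling_gt0 d0 N1 (ltW as0).
  apply/andP; split; first by rewrite divr_ge0// ltW.
  rewrite ler_pdivrMr//.
  have as_d : 0 < alpha * s < d%:R by rewrite as0.
  apply: le_trans (scaling_le d0 as_d (ltnW N1)) _.
  have -> : N%:R `^ (d%:R - alpha * s) =
      N%:R `^ (- (alpha * s - alpha)) * N%:R `^ (d%:R - alpha) :> R.
    by rewrite -powRD ?lt0r_neq0 ?implybT//; congr (_ `^ _); ring.
  rewrite -/K -!mulrA; apply: ler_wpM2l.
    by rewrite exprn_ge0// divr_ge0// subr_ge0 ler_pdivrMr ?ltr0n// mul1r ltW.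
  rewrite [leRHS]mulrCA; apply: ler_wpM2l; first exact: powR_ge0.
  by rewrite ler_pdivlMl//; exact: scaling_ge d0 (ltW a0) N1.
- exact: cvg_cst.
- rewrite -[X in _ --> X](mulr0 (K / k)); apply: cvgM; first exact: cvg_cst.
  by apply: cvg_powRN; rewrite subr_gt0 ltr_pMr.
Unshelve. all: by end_near. Qed.

Lemma cvg_inv_card_vertex (d : nat) : (0 < d)%N ->
  (#|vertex d N|%:R^-1 : R) @[N --> \oo] --> (0 : R).
Proof.
move=> d0.
apply: (@squeeze_cvgr _ _ _ _ (fun=> 0) (fun N => N%:R `^ (- 1))).
- near=> N; have N0 : (0 < N)%N by near: N; exact: nbhs_infty_gt.
  rewrite invr_ge0 ler0n/= powR_inv1// card_vertex lef_pV2 ?posrE ?ltr0n ?expn_gt0 ?N0//.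
  by rewrite ler_nat -[X in (X <= _)%N]expn1 leq_pexp2l.
- exact: cvg_cst.
- exact: cvg_powRN.
Unshelve. all: by end_near. Qed.

End limits.

Section limiting_law.
Variables (R : realType) (d : nat) (alpha tau sigma : R).
Hypotheses (hd : (1 <= d)%N) (halpha : 0 < alpha < d%:R).
Hypotheses (htau : 2 < tau) (hsigma : 0 < sigma < tau - 1).
Variables (disp : nat -> measure_display) (Omega : forall N, measurableType (disp N)).
Variables (P : forall N, probability (Omega N) R).
Variables (G : forall N, kbrg d N alpha tau sigma (P N)) (mu : probability R R).
Hypothesis hmu : limiting_spectral_distribution G mu.

(** Each upper bound has its use: s <= 2 for p ^ 2 <= p ^ s, alpha s < d for the decay of the
    scaling ratio, the last two for the Pareto moments. All admit some s > 1, and the midpoint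
    between 1 and the least of them is taken. *)
Lemma moment_exponent : exists s : R, [/\ 1 < s, s <= 2, alpha * s < d%:R,
  s < tau - 1 & sigma * s < tau - 1].
Proof.
have /andP[a0 ad] := halpha; have /andP[s0 st] := hsigma.
pose b := Num.min (Num.min 2 (d%:R / alpha)) (Num.min (tau - 1) ((tau - 1) / sigma)).
have b1 : 1 < b.
  by rewrite !lt_min ltr1n/= ltr_pdivlMr// mul1r ad ltrBrDl htau/= ltr_pdivlMr// mul1r.
have bm : (1 + b) / 2 < b by lra.
exists ((1 + b) / 2); move: (bm); rewrite {2}/b !lt_min => /andP[/andP[b2 bd] /andP[bt bs]].
split; [lra|exact: ltW| | |].
- by rewrite mulrC -ltr_pdivlMr.
- by [].
- by rewrite mulrC -ltr_pdivlMr.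
Qed.

Lemma cvg_stieltjes_mean x eta : 0 < eta ->
  stieltjes_mean (G N) x eta @[N --> \oo] --> poisson_transform mu x eta.
Proof.
move=> eta0; apply/cvgrPdist_le => e e0.
set I := poisson_transform mu x eta.
have e1 : 0 < eta^-1 by rewrite invr_gt0.
have [m m0 hm] : exists2 m, (0 < m)%N & (2 + eta) * (eta^-1 / m%:R) <= e / 2.
  have t0 : 0 <= (2 + eta) * eta^-1 / (e / 2).
    by rewrite !mulr_ge0 ?invr_ge0 ?mulr_ge0 ?addr_ge0// ltW.
  have := archi_boundP t0; set m := Num.bound _ => hm; exists m.
    by rewrite -(ltr0n R); exact: le_lt_trans hm.
  have m0 : 0 < m%:R :> R by exact: le_lt_trans hm.
  have := ltW hm; rewrite ler_pdivrMr ?divr_gt0// => h.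
  by rewrite mulrA ler_pdivrMr// [leRHS]mulrC.
(* The number m of layers fixes the tolerance at e / 2, eps is the largest distance allowed by these
   layers, and N then makes the bad event so rare that it costs at most e / 2. *)
pose eps := eta ^+ 2 * (eta^-1 / m%:R) / 2.
have mR : 0 < m%:R :> R by rewrite ltr0n.
have eps0 : 0 < eps by rewrite !mulr_gt0 ?invr_gt0 ?exprn_gt0.
have epsm : 2 * eps <= eta ^+ 2 * (eta^-1 / m%:R) by rewrite /eps mulrC divfK.
have := hmu eps0 => /fine_cvgP[_] /cvgrPdist_lt.
pose del := e / 2 / (`|I| + eta^-1).
have I0 : 0 < `|I| + eta^-1 by rewrite ltr_wpDl.
have del0 : 0 < del by rewrite !divr_gt0.
move=> /(_ _ del0); apply: filter_app; near=> N => /= hN.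
have N1 : (1 < N)%N by near: N; exact: nbhs_infty_gt.
have dist := stieltjes_mean_dist (G N) N1 x eta0 mu m0 eps0 epsm; apply: (le_trans dist).
rewrite -/I [leRHS](_ : _ = e / 2 + e / 2); last lra.
apply: lerD => //; rewrite mulrC -ler_pdivlMr// -/del; apply: ltW.
by apply: le_lt_trans hN; rewrite sub0r normrN ler_norm.
Unshelve. all: by end_near. Qed.

(** N tends to infinity first, with eta and [del] fixed; the remaining term del / 2 * e ^+ 2 is then
    made arbitrarily small. *)
Lemma limiting_poisson_le x eta : 0 < eta ->
  poisson_transform mu x eta <= 1 + 2 / connection_constant d alpha.
Proof.
move=> eta0; have [s [s1 s2 sd st ss]] := moment_exponent.
have s02 : 0 < s <= 2 by rewrite s2 (lt_trans ltr01).
set c := connection_constant d alpha; set e := eta^-1.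
have e0 : 0 < e by rewrite invr_gt0.
have main del : 0 < del -> poisson_transform mu x eta <= 1 + 2 / c + del / 2 * e ^+ 2.
  move=> del0.
  have lim : 1 + 2 / c + 6 * e ^+ 3 * (scaling d N alpha)^-1 +
      c * e ^+ 3 * #|vertex d N|%:R^-1 + del / 2 * e ^+ 2 +
      (6 * e ^+ 4 + 24 * e ^+ 5) * (Num.sqrt (scaling d N alpha))^-1 *
        connection_moment tau sigma 1 +
      (e ^+ 3 + (2 * del)^-1 * e ^+ 2) * (connection_moment tau sigma s *
        (scaling d N (alpha * s) / scaling d N alpha)) @[N --> \oo] -->
      1 + 2 / c + 6 * e ^+ 3 * 0 + c * e ^+ 3 * 0 + del / 2 * e ^+ 2 +
      (6 * e ^+ 4 + 24 * e ^+ 5) * 0 * connection_moment tau sigma 1 +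
      (e ^+ 3 + (2 * del)^-1 * e ^+ 2) * (connection_moment tau sigma s * 0).
    apply: cvgD.
      apply: cvgD.
        apply: cvgD; last exact: cvg_cst.
        apply: cvgD.
          apply: cvgD; first exact: cvg_cst.
          apply: cvgM; [exact: cvg_cst|exact: cvg_inv_scaling].
        apply: cvgM; [exact: cvg_cst|exact: cvg_inv_card_vertex].
      apply: cvgM; last exact: cvg_cst.
      apply: cvgM; [exact: cvg_cst|exact: cvg_inv_sqrt_scaling].
    apply: cvgM; first exact: cvg_cst.
    apply: cvgM; [exact: cvg_cst|exact: cvg_scaling_ratio].
  rewrite !mulr0 !mul0r !addr0 in lim.
  have lhs : stieltjes_mean (G N) x eta @[N --> \oo] --> poisson_transform mu x eta.
    exact: cvg_stieltjes_mean.
  rewrite -(cvg_lim (@Rhausdorff R) lhs) -(cvg_lim (@Rhausdorff R) lim).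
  apply: ler_lim; [exact: cvgP lhs|exact: cvgP lim|near=> N].
  have N1 : (1 < N)%N by near: N; exact: nbhs_infty_gt.
  apply: stieltjes_mean_le => //.
  have a0 : 0 <= alpha by case/andP: halpha => /ltW.
  have sc0 := scaling_gt0 hd N1 a0.
  rewrite -invf_le1//; near: N.
  have /cvgrPdist_le/(_ _ ltr01) := cvg_inv_scaling hd halpha.
  by apply: filterS => N /=; rewrite sub0r normrN; apply: le_trans; exact: ler_norm.
apply/ler_addgt0Pr => t t0.
have := main (2 * t / e ^+ 2); rewrite divr_gt0 ?mulr_gt0 ?exprn_gt0// => /(_ isT).
by rewrite (_ : 2 * t / e ^+ 2 / 2 * e ^+ 2 = t)//; field; rewrite lt0r_neq0.
Unshelve. all: by end_near. Qed.

Lemma limiting_poisson_reflect x eta : 0 < eta ->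
  poisson_transform mu x eta <= poisson_transform mu (- x) eta.
Proof.
move=> eta0; have [s [s1 s2 sd st ss]] := moment_exponent.
have s02 : 0 < s <= 2 by rewrite s2 (lt_trans ltr01).
set e := eta^-1.
have e0 : 0 < e by rewrite invr_gt0.
have main del : 0 < del ->
    poisson_transform mu x eta <= poisson_transform mu (- x) eta + del * e ^+ 2.
  move=> del0.
  have lim : stieltjes_mean (G N) (- x) eta + del * e ^+ 2 +
      16 * e ^+ 4 * (Num.sqrt (scaling d N alpha))^-1 *
        connection_moment tau sigma 1 +
      del^-1 * e ^+ 2 * (connection_moment tau sigma s *
        (scaling d N (alpha * s) / scaling d N alpha)) @[N --> \oo] -->
      poisson_transform mu (- x) eta + del * e ^+ 2 +
      16 * e ^+ 4 * 0 * connection_moment tau sigma 1 +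
      del^-1 * e ^+ 2 * (connection_moment tau sigma s * 0).
    apply: cvgD.
      apply: cvgD.
        apply: cvgD; [exact: cvg_stieltjes_mean|exact: cvg_cst].
      apply: cvgM; last exact: cvg_cst.
      apply: cvgM; [exact: cvg_cst|exact: cvg_inv_sqrt_scaling].
    apply: cvgM; first exact: cvg_cst.
    apply: cvgM; [exact: cvg_cst|exact: cvg_scaling_ratio].
  rewrite !mulr0 !mul0r !addr0 in lim.
  have lhs : stieltjes_mean (G N) x eta @[N --> \oo] --> poisson_transform mu x eta.
    exact: cvg_stieltjes_mean.
  rewrite -(cvg_lim (@Rhausdorff R) lhs) -(cvg_lim (@Rhausdorff R) lim).
  apply: ler_lim; [exact: cvgP lhs|exact: cvgP lim|near=> N].
  have N1 : (1 < N)%N by near: N; exact: nbhs_infty_gt.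
  exact: stieltjes_mean_reflect.
apply/ler_addgt0Pr => t t0.
have := main (t / e ^+ 2); rewrite divr_gt0 ?exprn_gt0// => /(_ isT).
by rewrite divfK// expf_neq0// lt0r_neq0.
Unshelve. all: by end_near. Qed.

End limiting_law.

Theorem theorem2p4 (R : realType) (d : nat) (alpha tau sigma : R)
    (hd : (1 <= d)%N) (halpha : 0 < alpha < d%:R)
    (htau : 2 < tau) (hsigma : 0 < sigma < tau - 1)
    (disp : nat -> measure_display)
    (Omega : forall N, measurableType (disp N))
    (P : forall N, probability (Omega N) R)
    (G : forall N, kbrg d N alpha tau sigma (P N))
    (mu : probability R R)
    (hmu : limiting_spectral_distribution G mu) :
  symmetric_law mu /\ mu `<< (@lebesgue_measure R).
Proof.
pose C := 1 + 2 / connection_constant d alpha.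
have C0 : 0 <= C.
  by rewrite addr_ge0// divr_ge0// ltW// connection_constant_gt0.
have muC x eta : 0 < eta -> poisson_transform mu x eta <= C.
  exact: (limiting_poisson_le hd halpha htau hsigma hmu).
split; last exact: bounded_poisson_dominated muC.
apply: bounded_poisson_symmetric muC _ => // x eta eta0; apply/eqP.
(* The one-sided reflection inequality, at x and at - x, gives equality. *)
rewrite eq_le (limiting_poisson_reflect hd halpha htau hsigma hmu)//=.
by rewrite -{2}[x]opprK (limiting_poisson_reflect hd halpha htau hsigma hmu).
Qed.
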